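(* For any $\theta>0$, $x\in\mathbb{R}$, $\iota\in\{+,-\}$, neither of the two processes $Y_N^{+}$, $Y_N^{-}$ converges in distribution in the Skorohod $J_1$ topology on $D(-\infty,+\infty)$ when $N$ tends to $+\infty$.
   Context: Model. Let $w:\mathbb{Z}\to(0,+\infty)$ be non-decreasing and non-constant. The self-repelling random walk with directed edges $(X_n)_{n\in\mathbb{N}}$ is the nearest-neighbor random walk on $\mathbb{Z}$ with $X_0=0$ such that, with $\ell^\pm(n,i)=|\{0\le m\le n-1 : (X_m,X_{m+1})=(i,i\pm1)\}|$ for $n\in\mathbb{N}$, $i\in\mathbb{Z}$ (local time of the directed edge $(i,i\pm1)$ at time $n$), conditionally on the past up to time $n$, $$\mathbb{P}(X_{n+1}=X_n\pm1)=\frac{w(\pm(\ell^-(n,X_n)-\ell^+(n,X_n)))}{w(\ell^+(n,X_n)-\ell^-(n,X_n))+w(\ell^-(n,X_n)-\ell^+(n,X_n))}.$$ For $n\in\mathbb{N}$, $i\in\mathbb{Z}$, set $T^\pm_{n,i}=\min\{m\in\mathbb{N} : \ell^\pm(m,i)=n\}$; these stopping times are almost surely finite. Write $a_+=\max(a,0)$. Fluctuation processes. For $N\in\mathbb{N}^*$, $y\in\mathbb{R}$ (the dependence on $\theta,x,\iota$ is not written), $$Y_N^\pm(y)=\frac{1}{\sqrt N}\left(\ell^\pm(T^\iota_{\lfloor N\theta\rfloor,\lfloor Nx\rfloor},\lfloor Ny\rfloor)-N\left(\frac{|x|-|y|}{2}+\theta\right)_+\right).$$ Topology. $DI$ is the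 space of càdlàg functions on the interval $I$. For $a<b$, let $\Lambda_{a,b}$ be the set of strictly increasing continuous bijections $\lambda:[a,b]\to[a,b]$, $\mathrm{Id}_{a,b}$ the identity of $[a,b]$, and $d_{J_1,a,b}(Z_1,Z_2)=\inf_{\lambda\in\Lambda_{a,b}}\max(\|Z_1\circ\lambda-Z_2\|_\infty,\|\lambda-\mathrm{Id}_{a,b}\|_\infty)$ for $Z_1,Z_2\in D[a,b]$. The Skorohod $J_1$ topology on $D(-\infty,\infty)$ is given by the metric $d_{J_1}(Z_1,Z_2)=\int_0^{+\infty}e^{-a}(d_{J_1,-a,a}(Z_1|_{[-a,a]},Z_2|_{[-a,a]})\wedge1)\,\mathrm{d}a$. *)

(* Defs.v *)
From HB Require Import structures.
From mathcomp Require Import all_boot all_order all_algebra.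
From mathcomp Require Import all_classical all_reals all_analysis.

Set Implicit Arguments.
Unset Strict Implicit.
Unset Printing Implicit Defensive.

Import Order.TTheory GRing.Theory Num.Theory.
Import numFieldNormedType.Exports.

Local Open Scope classical_set_scope.
Local Open Scope ring_scope.

Section cadlag.
Context {R : realType}.

Definition cadlag (f : R -> R) : Prop :=
  forall t : R, f s @[s --> t^'+] --> f t /\ cvg (f s @[s --> t^'-]).

Record skorohod_space : Type := Skorohod {
  path :> R -> R ;
  path_cadlag : cadlag path }.

Lemma cadlag_cst (c : R) : cadlag (fun=> c).
Proof. by move=> t; split; [exact: cvg_cst|exact: is_cvg_cst]. Qed.

Lemma cadlagB (f g : R -> R) : cadlag f -> cadlag g ->
  cadlag (fun t => f t - g t).
Proof.
move=> cf cg t; have [fr fl] := cf t; have [gr gl] := cg t.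
by split; [exact: cvgB|exact: is_cvgB].
Qed.

Lemma cadlagZ (c : R) (f : R -> R) : cadlag f -> cadlag (fun t => c * f t).
Proof.
by move=> cf t; have [fr fl] := cf t; split; [exact: cvgMl_tmp|exact: is_cvgMl_tmp].
Qed.

Lemma continuous_cadlag (f : R -> R) : continuous f -> cadlag f.
Proof.
move=> cf t; split; first exact: cvg_at_right_filter (cf t).
by apply/cvg_ex; exists (f t); exact: cvg_at_left_filter (cf t).
Qed.

Lemma cadlag_step (c : R) (g : int -> R) : 0 <= c ->
  cadlag (fun t => g (Num.floor (c * t))).
Proof.
rewrite le_eqVlt => /orP[/eqP <-|c0].
  have -> : (fun t : R => g (Num.floor (0 * t))) = fun=> g (Num.floor (0 : R)).
    by apply/funext => t; rewrite mul0r.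
  exact: cadlag_cst.
move=> t; split.
  apply: cvg_near_cst.
  have tlt : t < (Num.floor (c * t) + 1)%:~R / c.
    by rewrite ltr_pdivlMr// mulrC floorD1_gt.
  near=> s.
  congr g; apply: floor_def; apply/andP; split.
    apply: (le_trans (floor_le (c * t))).
    by rewrite ler_pM2l//; near: s; exact: nbhs_right_ge.
  by rewrite mulrC -ltr_pdivlMr//; near: s; exact: nbhs_right_lt.
apply/cvg_ex; exists (g (Num.ceil (c * t) - 1)); apply: cvg_near_cst.
have /andP[clt cge] := ceil_itv (c * t).
have tgt : (Num.ceil (c * t) - 1)%:~R / c < t by rewrite ltr_pdivrMr// [ltRHS]mulrC.
near=> s.
congr g; apply: floor_def; rewrite subrK; apply/andP; split.
  rewrite [leRHS]mulrC -ler_pdivrMr//; near: s; exact: nbhs_left_ge.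
apply: lt_le_trans cge; rewrite ltr_pM2l//; near: s; exact: nbhs_left_lt.
Unshelve. all: by end_near. Qed.

End cadlag.

Arguments skorohod_space R : clear implicits.

Section J1.
Context {R : realType}.
Implicit Types (a b : R) (f g lam : R -> R).
Local Open Scope ereal_scope.

Definition sup_norm a b f : \bar R :=
  ereal_sup [set (`|f t|)%:E | t in `[a, b]].

(* Time changes of [a, b], as total functions: only their values on [a, b]
   matter below. *)
Definition time_change a b : set (R -> R) :=
  [set lam | [/\ set_bij `[a, b] `[a, b] lam,
                 {in `[a, b] &, {homo lam : s t / (s < t)%R}} &
                 {within `[a, b], continuous lam}]].

Definition dJ1_itv a b f g : \bar R :=
  ereal_inf [set maxe (sup_norm a b (fun t => f (lam t) - g t)%R)
                      (sup_norm a b (fun t => lam t - t)%R)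
            | lam in time_change a b].

Definition dJ1 f g : \bar R :=
  \int[lebesgue_measure]_(a in `[0%R, +oo[)
    ((expR (- a))%:E * mine (dJ1_itv (- a) a f g) 1).

Definition J1_open (U : set (skorohod_space R)) : Prop :=
  forall f : skorohod_space R, U f -> exists2 e : R, (0 < e)%R &
    forall g : skorohod_space R, dJ1 f g < e%:E -> U g.

Lemma J1_openT : J1_open setT.
Proof. by move=> f _; exists 1%R. Qed.

Lemma J1_openI : setI_closed J1_open.
Proof.
move=> U V oU oV f [Uf Vf].
have [e e0 eU] := oU f Uf; have [e' e'0 eV] := oV f Vf.
exists (Num.min e e'); first by rewrite lt_min e0.
move=> g; rewrite EFin_min lt_min => /andP[ge ge'].
by split; [exact: eU|exact: eV].
Qed.

Lemma J1_open_bigU (I : Type) (U : I -> set (skorohod_space R)) :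
  (forall i, J1_open (U i)) -> J1_open (\bigcup_i U i).
Proof.
move=> oU f [i _ Uif]; have [e e0 eU] := oU i f Uif.
by exists e => // g /eU Uig; exists i.
Qed.

HB.instance Definition _ := gen_eqMixin (skorohod_space R).
HB.instance Definition _ := gen_choiceMixin (skorohod_space R).
HB.instance Definition _ := isPointed.Build (skorohod_space R)
  (Skorohod (cadlag_cst 0%R)).
HB.instance Definition _ := isOpenTopological.Build (skorohod_space R)
  J1_openT J1_openI J1_open_bigU.

End J1.

(* The limit is given by its law, a Borel probability measure [mu] on the
   target space; measurability of [Z N] is left to its users. *)
Definition cvg_in_distribution {R : realType} {d : measure_display}
    {Omega : measurableType d} (P : probability Omega R)
    {S : ptopologicalType} (Z : nat -> Omega -> S) : Prop :=
  exists mu : probability (g_sigma_algebraType (@open S)) R,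
    forall F : S -> R, continuous F -> bounded_fun F ->
      'E_P[fun omega => F (Z N omega)]%E @[N --> \oo] --> ('E_mu[F])%E.

Variant sign : Set := Plus | Minus.

Definition sgn_int (s : sign) : int := if s is Plus then 1 else -1.

(* Local time of the directed edge (i, i +/- 1) at time n along x. *)
Definition ell (s : sign) (x : nat -> int) (n : nat) (i : int) : nat :=
  #|[pred m : 'I_n | (x m == i) && (x m.+1 == i + sgn_int s)]|.

(* min {m | ell s x m i = n}, with junk value 0 when this set is empty. *)
Definition hit_time (s : sign) (x : nat -> int) (n : nat) (i : int) : nat :=
  if pselect (exists m, ell s x m i == n) is left h then ex_minn h else 0.

Section walk.
Context {R : realType}.

Definition step_prob (w : int -> R) (s : sign) (x : nat -> int) (n : nat) : R :=
  let D := (ell Minus x n (x n))%:Z - (ell Plus x n (x n))%:Z in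
  w (sgn_int s * D) / (w (- D) + w D).

Context {d : measure_display} {Omega : measurableType d}.

Definition history (X : nat -> Omega -> int) (x : nat -> int) (n : nat) :
    set Omega :=
  [set omega | forall m, (m <= n)%N -> X m omega = x m].

(* The state space being countable, conditioning on the past up to time n means
   conditioning on each history (x 0, ..., x n); the formula is multiplied out
   so that histories of probability 0 are unconstrained. *)
Definition self_repelling_walk (P : probability Omega R) (w : int -> R)
    (X : nat -> Omega -> int) : Prop :=
  [/\ forall n i, measurable (X n @^-1` [set i]),
      P (X 0%N @^-1` [set 0]) = 1%E &
      forall (n : nat) (x : nat -> int) (s : sign),
        P (history X x n `&` X n.+1 @^-1` [set x n + sgn_int s])
          = ((step_prob w s x n)%:E * P (history X x n))%E].

End walk.

Section fluctuation.
Context {R : realType}.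
Variables (theta x : R) (iota : sign) (s : sign).

Definition fluct_fun (xi : nat -> int) (N : nat) (y : R) : R :=
  (Num.sqrt N%:R)^-1 *
  ((ell s xi (hit_time iota xi (Num.truncn (N%:R * theta))
                                (Num.floor (N%:R * x)))
             (Num.floor (N%:R * y)))%:R
   - N%:R * Num.max ((`|x| - `|y|) / 2 + theta) 0).

Lemma fluct_cadlag xi N : cadlag (fluct_fun xi N).
Proof.
apply: cadlagZ; apply: cadlagB.
  by apply: (@cadlag_step _ N%:R (fun i => (ell s xi _ i)%:R)).
apply: cadlagZ; apply: continuous_cadlag => y.
apply: (@continuous_max _ _ (fun y => (`|x| - `|y|) / 2 + theta) (fun=> 0)).
  apply: cvgD; last exact: cvg_cst.
  apply: cvgMr_tmp; apply: cvgB; first exact: cvg_cst.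
  exact: norm_continuous.
exact: cvg_cst.
Qed.

(* The path is determined by finitely many nonzero local times, so [fluctuation]
   takes countably many values, on measurable events, and is measurable for any
   sigma-algebra on the Skorohod space. The case N = 0 is a junk value. *)
Definition fluctuation {T : Type} (X : nat -> T -> int) (N : nat) (omega : T) :
    skorohod_space R :=
  Skorohod (fluct_cadlag (X ^~ omega) N).

End fluctuation.

(* Main.v *)
Require Import Defs.
From HB Require Import structures.
From mathcomp Require Import all_boot all_order all_algebra.
From mathcomp Require Import all_classical all_reals all_analysis.
From mathcomp Require Import measurable_realfun.
From mathcomp Require Import zify ring lra.
Import Order.TTheory GRing.Theory Num.Theory.
Import numFieldNormedType.Exports.
Local Open Scope classical_set_scope.
Local Open Scope ring_scope.

Set Implicit Arguments.
Unset Strict Implicit.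
Unset Printing Implicit Defensive.

(** The centred local times of the walk stopped at the hitting time follow the
    wedge [N ((|x| - |y|) / 2 + theta)_+], which reaches 0 at the two points
    [c = +- (|x| + 2 theta)]. Up to a distance [o(N)] before [N c], the
    fluctuation about the wedge is random of order [sqrt N]; right after [N c],
    the local times themselves are bounded. So the rescaled process falls from
    a nondegenerate random height to 0 in a window around [c] whose width tends
    to 0, and it does so by small jumps. A limit for the J1 topology would have
    to make this transition by a jump, and J1 convergence does not allow a jump
    to be approached by a steep passage through intermediate values.

    To turn this into a proof, [osc c delta f] measures how much [f] can change
    twice in a row within distance [delta] of [c], that is, the supremum over
    [s <= t <= u] of the minimum of [|f t - f s|] and [|f u - f t|], suitably
    localised. It is bounded and J1-continuous, as time changes preserve ordered
    triples ([osc_J1_continuous]), and for a fixed cadlag [f] it tends to 0 with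
    [delta], because [f] has one-sided limits at [c] ([osc_small]). Its
    expectation under a limit law thus tends to 0 by dominated convergence. It
    remains to bound its expectation along the sequence from below, uniformly in
    [delta] ([not_cvg_in_distribution], [walk_crosses]).

    By the reflection [walk_opp] we may explore the sites to the right of the
    hitting site. The departures from each site form a stack, and the stacks of
    different sites are independent. At the hitting time the numbers of crossings
    of an edge in the two directions agree, and each explored site was last left
    to the left; so the number of plus steps from a site, given the number [k]
    of its minus steps, which is the number of plus steps from its left
    neighbour, is read off the stack at its [k]-th minus step ([hit_consumed]).
    Hence the local times, from site to site, form a Markov chain with
    transition law [stack_law]. In place of a measure on infinite stacks, a
    martingale along the walk, the conditional expectation given the part of the
    stacks revealed so far, shows that finite path probabilities sum to
    expectations of the chain ([stack_value_average], [sum_path_prob_le]).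

    The imbalance between minus and plus steps from a site, looked at after each
    minus step, is a Markov chain with kernel [kern], whose invariant law is
    symmetric about [1 / 2]. The bias of the walk against its imbalance makes
    the increments of the mean decay like [1 / k], so after [k] minus steps the
    mean is [1 / 2 + O(1 / k)], and the fourth moment stays bounded
    ([kernel_bounds]). The chain of local times therefore loses [1 / 2] per site
    on average, up to errors that are negligible as long as it is large, and
    after compensation it is a martingale with increments of variance at least
    [1 / 16] and bounded fourth moment. By the Paley-Zygmund inequality it is at
    least a multiple of [sqrt N] shortly before the tip of the wedge with a
    probability bounded below ([crosses_prob]). The drift then brings the chain
    down to bounded values shortly after the tip, and since its jumps are small
    against [sqrt N] it passes through an intermediate height
    ([trajectory_crosses]). *)

(** The hypotheses over [R] slow [lia] down and do not help it. *)
Ltac zlia R :=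
  repeat match goal with H : ?Q |- _ =>
    match Q with context [R] => clear H end end;
  lia.

(** * The imbalance of a site between two minus steps *)

Lemma int_ind_above (b : int) (Q : int -> Prop) :
  (forall e, e <= b -> Q e) -> (forall e, b < e -> Q (e - 1) -> Q e) ->
  forall e, Q e.
Proof.
move=> Qle Qstep e.
have [/Qle//|be] := leP e b.
have [n ->] : exists n : nat, e = b + n%:Z by exists `|e - b|%N; lia.
elim: n => [|n IH]; first by apply: Qle; lia.
by apply: Qstep; [lia|rewrite (_ : _ - 1 = b + n%:Z)//; lia].
Qed.

Section kernel.
(* [p e] is the probability that the next departure from a site is a plus step
   when the site has seen [e] more minus steps than plus steps. *)
Variables (R : realFieldType) (p : int -> R) (B : nat).

Fixpoint kern_fuel (n : nat) (f : int -> R) (e : int) {struct n} : R :=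
  if n is n'.+1 then (1 - p e) * f (e + 1) + p e * kern_fuel n' f (e - 1)
  else f (e + 1).

(** Expectation of [f] at the imbalance right after the next minus step from a
    site whose imbalance is [e]. Each plus step lowers the imbalance and [p]
    vanishes below [- B], so at most [e + B] plus steps come first: this is the
    fuel of the recursion. *)
Definition kern (f : int -> R) (e : int) : R :=
  kern_fuel (if (e + B%:Z)%R is Posz n then n else 0%N) f e.

Hypothesis p_ge0 : forall e, 0 <= p e.
Hypothesis p_le1 : forall e, p e <= 1.
Hypothesis p_low : forall e, e <= - B%:Z -> p e = 0.

Lemma kernE f e : kern f e = (1 - p e) * f (e + 1) + p e * kern f (e - 1).
Proof.
rewrite /kern; have [eB|Be] := leP e (- B%:Z).
  rewrite p_low// subr0 mul1r mul0r addr0.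
  case E : (e + B%:Z) => [[|n]|n] //=; lia.
case E : (e + B%:Z) => [[|n]|n] /=; [lia| |lia].
by case E' : (e - 1 + B%:Z) => [m|m]; [have -> : m = n by lia|lia].
Qed.

Lemma kern_low f e : e <= - B%:Z -> kern f e = f (e + 1).
Proof. by move=> eB; rewrite kernE p_low// subr0 mul1r mul0r addr0. Qed.

(** A supersolution of the equation [kernE] dominates its solution, because
    below [- B] the equation has no recursive term and above it [kern f e] is
    determined by [kern f (e - 1)]. *)
Lemma kern_le (f h : int -> R) :
  (forall e, (1 - p e) * f (e + 1) + p e * h (e - 1) <= h e) ->
  forall e, kern f e <= h e.
Proof.
move=> fh; apply: (@int_ind_above (- B%:Z)) => [e eB|e Be IH].
  by rewrite kern_low//; have := fh e; rewrite p_low// subr0 mul1r mul0r addr0.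
by rewrite kernE; apply: le_trans (fh e); rewrite lerD2l ler_wpM2l.
Qed.

Lemma kern_linear a (f g : int -> R) e :
  kern (fun x => a * f x + g x) e = a * kern f e + kern g e.
Proof.
apply: (@int_ind_above (- B%:Z) (fun e => kern _ e = _)) => {e} [e eB|e Be IH].
  by rewrite !kern_low.
by rewrite kernE IH (kernE f e) (kernE g e); ring.
Qed.

Lemma kern_cst c e : kern (fun=> c) e = c.
Proof.
apply: (@int_ind_above (- B%:Z) (fun e => kern _ e = c)) => {e} [e eB|e Be IH].
  by rewrite !kern_low.
by rewrite kernE IH; ring.
Qed.

Lemma kern_homo (f g : int -> R) :
  (forall e, f e <= g e) -> forall e, kern f e <= kern g e.
Proof.
move=> fg; apply: kern_le => e; rewrite [leRHS]kernE lerD2r ler_wpM2l//.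
by rewrite subr_ge0.
Qed.

(** The imbalance only decreases until the minus step that ends the excursion,
    which raises it by one. *)
Lemma kern_support (f g : int -> R) (a : int) :
  (forall e, e <= a -> f e = g e) ->
  forall e, e < a -> kern f e = kern g e.
Proof.
move=> fg; apply: (@int_ind_above (- B%:Z)) => [e eB ea|e Be IH ea].
  by rewrite !kern_low//; apply: fg; lia.
by rewrite kernE [RHS]kernE fg ?IH//; lia.
Qed.

Definition kern_iter k (f : int -> R) : int -> R := iter k kern f.

Lemma kern_iterE k f e : kern_iter k.+1 f e =
  (1 - p e) * kern_iter k f (e + 1) + p e * kern_iter k.+1 f (e - 1).
Proof. exact: kernE. Qed.

Lemma kern_ext (f g : int -> R) : f =1 g -> kern f =1 kern g.
Proof. by move=> fg e; apply/eqP; rewrite eq_le !kern_homo// => x; rewrite fg. Qed.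

Lemma kern_iter_ext k (f g : int -> R) : f =1 g -> kern_iter k f =1 kern_iter k g.
Proof. by move=> fg; elim: k => [//|k IH]; apply: kern_ext. Qed.

Lemma kern_iter_homo k (f g : int -> R) :
  (forall e, f e <= g e) -> forall e, kern_iter k f e <= kern_iter k g e.
Proof. by move=> fg; elim: k => [//|k IH]; apply: kern_homo. Qed.

Lemma kern_iter_linear k a (f g : int -> R) e :
  kern_iter k (fun x => a * f x + g x) e = a * kern_iter k f e + kern_iter k g e.
Proof.
by elim: k e => [//|k IH] e; rewrite /= -kern_linear; apply: kern_ext.
Qed.

Lemma kern_iter_cst k c e : kern_iter k (fun=> c) e = c.
Proof. by elim: k e => [//|k IH] e; rewrite -[RHS](kern_cst c e); apply: kern_ext. Qed.

Lemma kern_iter_support k (f g : int -> R) (e : int) :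
  (forall x, x <= e + k%:Z -> f x = g x) -> kern_iter k f e = kern_iter k g e.
Proof.
elim: k e => [|k IH] e fg; first by apply: fg; lia.
apply: (kern_support (a := e + 1)); last lia.
by move=> x xe; apply: IH => y yx; apply: fg; lia.
Qed.

(** The drift condition carries the bound [M] from [rho * V + C] back to [V],
    hence through all iterates. *)
Lemma kern_iter_lyapunov (V : int -> R) rho C M k e :
  0 <= rho -> (forall x, kern V x <= rho * V x + C) ->
  rho * M + C <= M -> V e <= M -> kern_iter k V e <= M.
Proof.
move=> rho0 KV rM; elim: k e => [//|k IH] e VM.
rewrite /kern_iter iterSr -/(kern_iter _ _ _).
apply: le_trans (kern_iter_homo k KV e) _.
rewrite (kern_iter_linear k rho V (fun=> C)) kern_iter_cst.
by apply: le_trans rM; rewrite lerD2r ler_wpM2l// IH.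
Qed.

End kernel.

(** * Decay of the increments of the mean *)

Section kernel_diff.
Variables (R : realFieldType) (p : int -> R) (B : nat).
Hypothesis p_ge0 : forall e, 0 <= p e.
Hypothesis p_le1 : forall e, p e <= 1.
Hypothesis p_low : forall e, e <= - B%:Z -> p e = 0.
Hypothesis p_homo : {homo p : i j / i <= j}.
Local Notation kern := (kern p B).
Local Notation kern_iter := (kern_iter p B).

(** Up to the factor in [kern_diff], the increment of [kern f]; it is easier to
    handle than the increment because [overshootE] is a recursion of order one
    whose source is the increment of [f]. *)
Definition overshoot (f : int -> R) (e : int) : R := f (e + 1 + 1) - kern f e.

Lemma kern_diff f e : kern f (e + 1) - kern f e = (1 - p (e + 1)) * overshoot f e.
Proof. by rewrite (kernE p_low f (e + 1)) addrK /overshoot; ring. Qed.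

Lemma overshootE f e : overshoot f e = f (e + 1 + 1) - f (e + 1) + p e * overshoot f (e - 1).
Proof. by rewrite /overshoot (kernE p_low f e) subrK; ring. Qed.

Lemma overshoot_low f e : e <= - B%:Z -> overshoot f e = f (e + 1 + 1) - f (e + 1).
Proof. by move=> eB; rewrite overshootE p_low// mul0r addr0. Qed.

Lemma overshoot_le (f g : int -> R) :
  (forall e, f (e + 1) - f e <= g (e + 1) - g e) ->
  forall e, overshoot f e <= overshoot g e.
Proof.
move=> fg; apply: (@int_ind_above (- B%:Z)) => [e eB|e Be IH].
  by rewrite !overshoot_low.
by rewrite overshootE [leRHS]overshootE lerD// ler_wpM2l.
Qed.

Lemma kern_diff_le (f g : int -> R) :
  (forall e, f (e + 1) - f e <= g (e + 1) - g e) ->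
  forall e, kern f (e + 1) - kern f e <= kern g (e + 1) - kern g e.
Proof.
by move=> fg e; rewrite !kern_diff ler_wpM2l ?overshoot_le// subr_ge0.
Qed.

Definition mean_iter k : int -> R := kern_iter k (fun e => e%:~R).

Lemma mean_iter_diff_ge0 k e : 0 <= mean_iter k (e + 1) - mean_iter k e.
Proof.
elim: k e => [|k IH] e; first by rewrite /mean_iter /= intrD addrAC subrr add0r.
have H : forall x, (fun=> 0 : R) (x + 1) - (fun=> 0) x <= mean_iter k (x + 1) - mean_iter k x.
  by move=> x; rewrite subr0.
by have := kern_diff_le H e; rewrite !kern_cst// subr0.
Qed.

Lemma overshoot_id_ge0 e : 0 <= overshoot (fun e => e%:~R) e.
Proof.
have H : forall x, (fun=> 0 : R) (x + 1) - (fun=> 0) x <= (x + 1)%:~R - x%:~R.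
  by move=> x; rewrite subr0 intrD addrAC subrr add0r.
by have := overshoot_le H e; rewrite {1}/overshoot kern_cst// subr0.
Qed.

(** Here the monotonicity of [p] enters: from [e + 1] plus steps are likelier
    than from [e], so a minus step does not spread the two starting points. *)
Lemma mean_iter_diff1 e : mean_iter 1 (e + 1) - mean_iter 1 e <= 1.
Proof.
rewrite /mean_iter /= kern_diff.
elim/(@int_ind_above (- B%:Z)): e => [e eB|e Be IH].
  rewrite overshoot_low// intrD addrAC subrr add0r mulr1.
  by have := p_ge0 (e + 1); lra.
rewrite subrK in IH.
rewrite overshootE [in X in _ * (X + _)]intrD [in X in _ * (X + _)]addrAC subrr add0r.
have W0 := overshoot_id_ge0 (e - 1); set W := overshoot _ _ in IH W0 *.
have pp : p e <= p (e + 1) by apply: p_homo; lia.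
have p0 := p_ge0 e; have p1 := p_le1 e.
apply: (@le_trans _ _ ((1 - p e) * (1 + p e * W))).
  by rewrite ler_wpM2r ?lerD2l ?lerN2// addr_ge0 ?mulr_ge0.
have : p e * ((1 - p e) * W) <= p e * 1 by rewrite ler_wpM2l.
by nra.
Qed.

(** [kern] preserves the comparison of increments, and [mean_iter_diff1] is the
    comparison of the first two iterates. *)
Lemma mean_iter_diff_decr k e :
  mean_iter k.+1 (e + 1) - mean_iter k.+1 e <= mean_iter k (e + 1) - mean_iter k e.
Proof.
elim: k e => [|k IH] e.
  by apply: le_trans (mean_iter_diff1 e) _; rewrite /mean_iter /= intrD addrAC subrr add0r.
exact: kern_diff_le.
Qed.

Fixpoint sum_iter n (e : int) : R :=
  if n is n'.+1 then sum_iter n' e + mean_iter n' e else 0.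

Lemma sum_iterE n e : sum_iter n.+1 e = e%:~R + kern (sum_iter n) e.
Proof.
elim: n e => [|n IH] e; first by rewrite /= kern_cst// /mean_iter /= add0r addr0.
rewrite [LHS](_ : _ = sum_iter n.+1 e + mean_iter n.+1 e)// IH -addrA.
congr (_ + _); rewrite -[X in X + _]mul1r -[mean_iter n.+1 e]/(kern (mean_iter n) e).
by rewrite -(kern_linear p_low 1); apply: kern_ext => // x; rewrite mul1r.
Qed.

(** As the increments decrease with the number of iterations, [n] times the
    last one is at most their sum. A bound on the sum that does not depend on
    [n] therefore gives decay of order [1 / n] without any mixing estimate. *)
Lemma mean_iter_diff_le_kern_sum n e :
  n%:R * (mean_iter n (e + 1) - mean_iter n e) <=
  kern (sum_iter n) (e + 1) - kern (sum_iter n) e.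
Proof.
elim: n => [|n IH]; first by rewrite mul0r /= !kern_cst// subrr.
have E x : kern (sum_iter n.+1) x = kern (sum_iter n) x + mean_iter n.+1 x.
  have : sum_iter n.+2 x = sum_iter n.+1 x + mean_iter n.+1 x by [].
  by rewrite !sum_iterE; lra.
rewrite !E; have := mean_iter_diff_decr n e.
have : 0 <= n%:R :> R by [].
by rewrite -natr1; nra.
Qed.

(* [r] is the odds ratio of a plus step, and [b] a supersolution of the
   equation satisfied by the increments of the potential [sum_iter]. *)
Variables (r b : int -> R).
Hypothesis r_ge0 : forall e, 0 <= r e.
Hypothesis b_ge0 : forall e, 0 <= b e.
Hypothesis p_high : forall e, B%:Z <= e -> p e = 1.
Hypothesis p_r : forall e, - B%:Z < e < B%:Z -> p e * (1 + r e) = r e.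
Let g e := (1 + r e) * b e - r (e - 1) * b (e - 1).
Hypothesis b_super : forall e, 1 + b (e + 1) <= g e.

(** [g] is the profile of increments for which the recursion [overshootE]
    telescopes and leaves [b] after [kern_diff]. *)
Lemma overshoot_contract (f : int -> R) :
  (forall e, - B%:Z <= e -> f (e + 1) - f e <= g e) ->
  forall e, - B%:Z <= e < B%:Z -> overshoot f e <= (1 + r (e + 1)) * b (e + 1).
Proof.
move=> fg; apply: (@int_ind_above (- B%:Z)) => [e eB /andP[Be _]|e Be IH /andP[_ eB]].
  rewrite overshoot_low//; apply: le_trans (fg (e + 1) _) _; first lia.
  by rewrite /g addrK lerBlDr lerDl mulr_ge0.
have {}IH := IH ltac:(lia).
rewrite overshootE.
have := fg (e + 1) ltac:(lia); rewrite /g addrK.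
have : p e * overshoot f (e - 1) <= r e * b e.
  rewrite -(p_r (e := e)); last lia.
  by rewrite -mulrA ler_wpM2l//; rewrite subrK in IH.
by lra.
Qed.

Lemma kern_contract (f : int -> R) :
  (forall e, - B%:Z <= e -> f (e + 1) - f e <= g e) ->
  forall e, - B%:Z <= e -> kern f (e + 1) - kern f e <= b (e + 1).
Proof.
move=> fg e eB; rewrite kern_diff.
have [Be|eB'] := leP B%:Z (e + 1); first by rewrite p_high// subrr mul0r.
have /ler_wpM2l -/(_ (1 - p (e + 1))) := overshoot_contract fg (e := e) ltac:(lia).
have E : (1 - p (e + 1)) * (1 + r (e + 1)) = 1.
  by have := p_r (e := e + 1) ltac:(lia); lra.
by rewrite mulrA E mul1r; apply; rewrite subr_ge0.
Qed.

Lemma sum_iter_diff n e : - B%:Z <= e -> sum_iter n (e + 1) - sum_iter n e <= g e.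
Proof.
elim: n e => [|n IH] e eB.
  rewrite /= subrr; apply: le_trans (b_super e); by rewrite addr_ge0.
rewrite !sum_iterE; apply: le_trans (b_super e).
have := kern_contract IH eB.
by rewrite intrD; lra.
Qed.

(** The increments of the potential stay below [g] for all [n]: [kern] turns
    [g] into [b], and the new term of the potential adds the 1 that [b_super]
    allows for. *)
Lemma mean_iter_diff n e : - B%:Z <= e ->
  n%:R * (mean_iter n (e + 1) - mean_iter n e) <= b (e + 1).
Proof.
move=> eB; apply: le_trans (mean_iter_diff_le_kern_sum n e) _.
exact: kern_contract (@sum_iter_diff n) _ eB.
Qed.

End kernel_diff.

(** * The invariant law *)

Section invariant.
Variables (R : realFieldType) (p : int -> R) (B : nat).
Hypothesis p_ge0 : forall e, 0 <= p e.
Hypothesis p_le1 : forall e, p e <= 1.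
Hypothesis p_low : forall e, e <= - B%:Z -> p e = 0.
Hypothesis p_sym : forall e, p (- e) = 1 - p e.
Hypothesis p_pos : forall n, 0 < p (n.+1)%:Z.
Local Notation kern := (kern p B).
Local Notation kern_iter := (kern_iter p B).

(** The common mass of [n + 1] and [- n] under the invariant law, given by
    detailed balance; that the two masses agree is the symmetry [p_sym]. *)
Fixpoint inv_weight n : R := if n is n'.+1 then inv_weight n' * (1 - p n) / p n else 1.

Lemma inv_weight_ge0 n : 0 <= inv_weight n.
Proof.
elim: n => [//|n IH] /=.
by rewrite divr_ge0 ?mulr_ge0 ?subr_ge0.
Qed.

Lemma inv_weightS n : inv_weight n.+1 * p n.+1 = inv_weight n * (1 - p n.+1).
Proof. by rewrite /= divfK// gt_eqF. Qed.

(** The unnormalised invariant law of [kern], cut off after [n] pairs of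
    points symmetric about [1 / 2]. *)
Definition inv_measure n (f : int -> R) : R :=
  \sum_(i < n) inv_weight i * (f (i.+1)%:Z + f (- i%:Z)).

(** A cut-off sum is invariant up to a boundary term, which carries the weight
    of the first omitted pair and so vanishes at the cut-off [B]. *)
Lemma inv_measure_kern_partial n f : inv_measure n (kern f) =
  inv_measure n f + inv_weight n *
    (f (n%:Z + 1) - kern f n - kern f (- n%:Z) + kern f (- n%:Z - 1)).
Proof.
elim: n => [|n IH].
  rewrite /inv_measure !big_ord0 /= mul1r oppr0 !add0r.
  have := kernE p_low f 0; have := p_sym 0; rewrite oppr0 !add0r => p0 ->.
  have -> : p 0 = 1 / 2 by lra.
  by field.
rewrite /inv_measure !big_ord_recr/= -!/(inv_measure _ _) IH.
have E1 := kernE p_low f n.+1; have E2 := kernE p_low f (- (n.+1)%:Z).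
have W := inv_weightS n.
rewrite p_sym in E2.
rewrite (_ : (n.+1)%:Z - 1 = n) in E1; last lia.
rewrite (_ : - (n.+1)%:Z + 1 = - n%:Z) in E2; last lia.
rewrite (_ : - n%:Z - 1 = - (n.+1)%:Z); last lia.
rewrite (_ : n%:Z + 1 = n.+1); last lia.
rewrite -/(inv_weight n.+1).
move: E1 E2 W.
set a := kern f n.+1; set b := kern f (- (n.+1)%:Z).
set c := kern f n; set d := kern f (- (n.+1)%:Z - 1).
set q := p n.+1; set x := inv_weight n; set y := inv_weight n.+1.
set f1 := f _; set f2 := f (- n%:Z); set f3 := f (n.+1%:Z); set k := kern f (- n%:Z).
move=> E1 E2 W.
(* by detailed balance, a proportion [q] of the mass [x + y] is [x] *)
have H1 : (x + y) * a = y * f1 + x * c.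
  have xq : x = (x + y) * q by lra.
  have yq : y = (x + y) * (1 - q) by lra.
  by rewrite {2}yq {3}xq E1; ring.
have H2 : (x + y) * b = x * f2 + y * d.
  have xq : x = (x + y) * q by lra.
  have yq : y = (x + y) * (1 - q) by lra.
  by rewrite {2}xq {3}yq E2; ring.
by lra.
Qed.

Hypothesis B_gt0 : (0 < B)%N.
Lemma inv_weight_B : inv_weight B = 0.
Proof.
case: B B_gt0 p_low => // n _ pl /=.
by have := p_sym (n.+1)%:Z; rewrite pl// => /esym->; rewrite mulr0 mul0r.
Qed.

Lemma inv_measure_kern f : inv_measure B (kern f) = inv_measure B f.
Proof. by rewrite inv_measure_kern_partial inv_weight_B mul0r addr0. Qed.

Lemma inv_measure_kern_iter k f : inv_measure B (kern_iter k f) = inv_measure B f.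
Proof. by elim: k => [//|k IH]; rewrite inv_measure_kern. Qed.

Lemma inv_measure_linear a f g :
  inv_measure B (fun e => a * f e + g e) = a * inv_measure B f + inv_measure B g.
Proof.
by rewrite /inv_measure mulr_sumr -big_split /=; apply: eq_bigr => i _; ring.
Qed.

Lemma inv_measure_cst c : inv_measure B (fun=> c) = c * inv_measure B (fun=> 1).
Proof. by rewrite /inv_measure mulr_sumr; apply: eq_bigr => i _; ring. Qed.

Lemma inv_measure_id : inv_measure B (fun e => e%:~R) = inv_measure B (fun=> 1) / 2.
Proof.
rewrite /inv_measure mulr_suml; apply: eq_bigr => i _.
by rewrite -mulrA; congr (_ * _); rewrite -addn1 PoszD intrD mulrNz; lra.
Qed.

Lemma inv_measure1_gt0 : 0 < inv_measure B (fun=> 1).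
Proof.
case: B B_gt0 => // n _; rewrite /inv_measure big_ord_recl /= mul1r.
apply: ltr_pwDl; first by lra.
by apply: sumr_ge0 => i _; rewrite mulr_ge0 ?inv_weight_ge0 ?addr_ge0//
  -/(inv_weight i.+1) inv_weight_ge0.
Qed.

Lemma inv_measure_le f g : (forall e, - B%:Z < e <= B%:Z -> f e <= g e) ->
  inv_measure B f <= inv_measure B g.
Proof.
move=> fg; apply: ler_sum => i _; rewrite ler_wpM2l ?inv_weight_ge0//.
by apply: lerD; apply: fg; have := ltn_ord i; lia.
Qed.

Lemma inv_measure_lyapunov (V : int -> R) rho C : rho < 1 ->
  (forall x, kern V x <= rho * V x + C) ->
  inv_measure B V <= C / (1 - rho) * inv_measure B (fun=> 1).
Proof.
move=> r1 KV.
have : inv_measure B V <= rho * inv_measure B V + C * inv_measure B (fun=> 1).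
  by rewrite -{1}inv_measure_kern -inv_measure_cst -inv_measure_linear; apply: inv_measure_le => e _.
rewrite mulrAC ler_pdivlMr ?subr_gt0//; lra.
Qed.

End invariant.

(** * Step probabilities and their truncation *)

(** The fourth root of [z] exceeds some [1 + t], whose powers grow at least
    linearly by Bernoulli's inequality. *)
Lemma exp4_le_geometric (R : realFieldType) (z : R) : 1 < z ->
  exists2 C : R, 0 < C & forall n : nat, n%:R ^+ 4 <= C * z ^+ n.
Proof.
move=> z1; pose t : R := Num.min 1 ((z - 1) / 15).
have t0 : 0 < t by rewrite lt_min ltr01 divr_gt0// subr_gt0.
have t1 : t <= 1 by rewrite ge_min lexx.
have tz : 15 * t <= z - 1.
  by rewrite mulrC -ler_pdivlMr// ge_min lexx orbT.
have yz : (1 + t) ^+ 4 <= z.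
  have -> : (1 + t) ^+ 4 = 1 + t * (4 + 6 * t + 4 * t ^+ 2 + t ^+ 3) by ring.
  have t2 : t ^+ 2 <= 1 by rewrite exprn_ile1// ltW.
  have t3 : t ^+ 3 <= 1 by rewrite exprn_ile1// ltW.
  have : t * (4 + 6 * t + 4 * t ^+ 2 + t ^+ 3) <= t * 15.
    by rewrite ler_pM2l//; lra.
  lra.
have bern n : n%:R * t <= (1 + t) ^+ n.
  elim: n => [|n IH]; first by rewrite mul0r expr0.
  have y1 : 1 <= (1 + t) ^+ n by rewrite exprn_ege1//; lra.
  rewrite exprS -natr1; nra.
exists (t ^- 4) => [|n]; first by rewrite invr_gt0 exprn_gt0.
rewrite mulrC ler_pdivlMr ?exprn_gt0// -exprMn.
apply: le_trans (_ : ((1 + t) ^+ n) ^+ 4 <= _).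
  by apply: lerXn2r => //; rewrite nnegrE ?mulr_ge0 ?exprn_ge0//; lra.
rewrite -exprM mulnC exprM; apply: lerXn2r => //; rewrite nnegrE; last lra.
by apply: exprn_ge0; lra.
Qed.

Section weights.
Variables (R : realFieldType) (w : int -> R).
Hypothesis w_gt0 : forall k, 0 < w k.
Hypothesis w_homo : {homo w : i j / i <= j}.

Definition plus_prob (e : int) : R := w e / (w (- e) + w e).
Definition odds (e : int) : R := w e / w (- e).

Lemma plus_prob_gt0 e : 0 < plus_prob e.
Proof. by rewrite divr_gt0// addr_gt0. Qed.

Lemma plus_probN e : plus_prob (- e) = 1 - plus_prob e.
Proof.
rewrite /plus_prob opprK [w e + _]addrC.
have := w_gt0 e; have := w_gt0 (- e) => a b.
by field; lra.
Qed.

Lemma plus_prob_lt1 e : plus_prob e < 1.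
Proof. by have := plus_prob_gt0 (- e); rewrite plus_probN subr_gt0. Qed.

Lemma plus_prob_homo : {homo plus_prob : i j / i <= j}.
Proof.
move=> i j ij; rewrite /plus_prob ler_pdivrMr ?addr_gt0// mulrAC ler_pdivlMr ?addr_gt0//.
rewrite !mulrDr [w j * w i]mulrC lerD2r.
by rewrite ler_pM ?(ltW (w_gt0 _))// w_homo// lerN2.
Qed.

Lemma odds_gt0 e : 0 < odds e. Proof. exact: divr_gt0. Qed.

Lemma oddsN e : odds (- e) = (odds e)^-1.
Proof. by rewrite /odds opprK invf_div. Qed.

Lemma odds_homo : {homo odds : i j / i <= j}.
Proof.
move=> i j ij; rewrite ler_pM// ?invr_ge0 ?(ltW (w_gt0 _))//; first exact: w_homo.
by rewrite lef_pV2 ?posrE// w_homo// lerN2.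
Qed.

Lemma plus_prob_odds e : plus_prob e * (1 + odds e) = odds e.
Proof.
rewrite /plus_prob /odds; have := w_gt0 e; have := w_gt0 (- e) => a b.
by field; apply/andP; split; lra.
Qed.

(** The walk with this probability is forced back at imbalance [B] and [- B],
    which makes all the expectations below finite sums. A path of at most [B]
    steps does not see the truncation. *)
Definition trunc_prob (B : nat) (e : int) : R :=
  if e <= - B%:Z then 0 else if B%:Z <= e then 1 else plus_prob e.

Section trunc.
Variable B : nat.
Hypothesis B_gt0 : (0 < B)%N.
Local Notation p := (trunc_prob B).

Lemma trunc_ge0 e : 0 <= p e.
Proof. by rewrite /p; do 2?[case: ifP => // _]; exact/ltW/plus_prob_gt0. Qed.
Lemma trunc_le1 e : p e <= 1.
Proof. by rewrite /p; do 2?[case: ifP => // _]; exact/ltW/plus_prob_lt1. Qed.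
Lemma trunc_low e : e <= - B%:Z -> p e = 0.
Proof. by rewrite /p => ->. Qed.
Lemma trunc_high e : B%:Z <= e -> p e = 1.
Proof. by rewrite /p => Be; rewrite Be ifF//; lia. Qed.
Lemma trunc_mid e : - B%:Z < e < B%:Z -> p e = plus_prob e.
Proof. by rewrite /p => /andP[a b]; rewrite !ifF//; lia. Qed.

Lemma trunc_homo : {homo p : i j / i <= j}.
Proof.
move=> i j ij; have [iB|Bi] := leP i (- B%:Z); first by rewrite (trunc_low iB) trunc_ge0.
have [jB|Bj] := leP B%:Z j; first by rewrite (trunc_high jB) trunc_le1.
by rewrite !trunc_mid ?plus_prob_homo//; lia.
Qed.

Lemma truncN e : p (- e) = 1 - p e.
Proof.
have [iB|Bi] := leP e (- B%:Z).
  by rewrite (trunc_low iB) trunc_high ?subr0//; lia.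
have [jB|Bj] := leP B%:Z e.
  by rewrite (trunc_high jB) trunc_low ?subrr//; lia.
by rewrite !trunc_mid ?plus_probN//; lia.
Qed.

Lemma trunc_pos n : 0 < p (n.+1)%:Z.
Proof.
have [jB|Bj] := leP B%:Z n.+1%:Z; first by rewrite trunc_high.
by rewrite trunc_mid ?plus_prob_gt0//; lia.
Qed.

Lemma trunc_odds e : - B%:Z < e < B%:Z -> p e * (1 + odds e) = odds e.
Proof. by move=> eB; rewrite trunc_mid// plus_prob_odds. Qed.
End trunc.

Hypothesis w_nonconst : exists i j : int, w i <> w j.

(** If the weights of [n] and [- n] agreed for all [n], the monotone function
    [w] would be constant; [D] is the least imbalance that creates a bias. *)
Lemma first_bias : exists D : nat, [/\ (0 < D)%N, w (- D%:Z) < w D%:Z &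
  forall n : nat, (n < D)%N -> w (- n%:Z) = w n%:Z].
Proof.
have ex : exists n : nat, w (- n%:Z) < w n%:Z.
  case: (pselect (exists n : nat, w (- n%:Z) < w n%:Z)) => [//|no]; exfalso.
  have {}no : forall n : nat, w n%:Z <= w (- n%:Z).
    by move=> n; rewrite leNgt; apply/negP => h; apply: no; exists n.
  have [i [j]] := w_nonconst; apply.
  pose n := maxn `|i| `|j|.
  have c k : (`|k| <= n)%N -> w k = w n%:Z.
    move=> kn; apply/eqP; rewrite eq_le w_homo ?andTb; last by lia.
    by apply: le_trans (no n) _; apply: w_homo; lia.
  by rewrite !c//; lia.
case: (ex_minnP ex) => D wD minD; exists D; split => //.
  by case: D wD {minD} => //; rewrite ltxx.
move=> n nD; apply/eqP; rewrite eq_le w_homo/=; last lia.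
by rewrite leNgt; apply/negP => /minD; lia.
Qed.
End weights.

(** * Supersolutions that do not depend on the truncation *)

Section bounds.
Variables (R : realFieldType) (w : int -> R).
Hypothesis w_gt0 : forall k, 0 < w k.
Hypothesis w_homo : {homo w : i j / i <= j}.
Local Notation r := (odds w).

Section first.
Variable D : nat.
Hypothesis D_gt0 : (0 < D)%N.
Hypothesis wD : w (- D%:Z) < w D%:Z.
Hypothesis w_flat : forall n : nat, (n < D)%N -> w (- n%:Z) = w n%:Z.

Lemma odds_flat e : (`|e| < D)%N -> r e = 1.
Proof.
move=> eD; rewrite /odds.
have -> : w e = w (- e).
  have := w_flat eD; have [e0|e0] := leP 0 e.
    by rewrite gez0_abs.
  by rewrite ltz0_abs// opprK.
by rewrite divff// gt_eqF.
Qed.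

Lemma odds_D_gt1 : 1 < r D.
Proof. by rewrite /odds ltr_pdivlMr// mul1r. Qed.

Let kap := 1 - (r D)^-1.
Let kap_gt0 : 0 < kap.
Proof. by rewrite subr_gt0 invf_lt1 ?odds_D_gt1// odds_gt0. Qed.
Let kap_lt1 : kap < 1.
Proof. by rewrite ltrBlDr ltrDl invr_gt0 odds_gt0. Qed.

Let r_right e : D%:Z <= e -> 1 + kap <= r e.
Proof.
move=> De; apply: le_trans (odds_homo w_gt0 w_homo De).
have r1 := odds_D_gt1.
have : (r D)^-1 * r D = 1 by rewrite mulVf// gt_eqF// odds_gt0.
have : 0 < (r D)^-1 by rewrite invr_gt0 odds_gt0.
rewrite /kap; nra.
Qed.

Let r_left e : e <= - D%:Z -> r e <= 1 - kap.
Proof.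
move=> De; apply: le_trans (odds_homo w_gt0 w_homo De) _.
by rewrite oddsN /kap; lra.
Qed.

Let r0 e : 0 <= r e. Proof. exact/ltW/odds_gt0. Qed.

(* the slope [s] outside is small against the bias [kap], and the curvature
   [eps] inside is so small that the kinks at [1 - D] and [D] are absorbed by
   the bias at these points *)
Let s := kap / 4.
Let eps := kap / (8 * D%:R).

(** Where the odds are 1, strict concavity provides the gain required in
    [supersol_ineq], and a parabola is the simplest choice. Outside, where the
    odds are bounded away from 1, a linear function has a gain proportional to
    its slope. *)
Definition supersol (e : int) : R :=
  if e <= 1 - D%:Z then 1 + s * (1 - D%:R - e%:~R)
  else if e <= D%:Z then 1 + eps * ((e%:~R + D%:R - 1) * (D%:R - e%:~R))
  else 1 + s * (e%:~R - D%:R).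

Let supersol_left e : e <= 1 - D%:Z -> supersol e = 1 + s * (1 - D%:R - e%:~R).
Proof. by rewrite /supersol => ->. Qed.

Let supersol_mid e : 1 - D%:Z <= e <= D%:Z ->
  supersol e = 1 + eps * ((e%:~R + D%:R - 1) * (D%:R - e%:~R)).
Proof.
move=> /andP[e1 e2]; rewrite /supersol e2; case: ifP => // e3.
have -> : e = 1 - D%:Z by lia.
rewrite intrD mulrNz; ring.
Qed.

Let supersol_right e : D%:Z <= e -> supersol e = 1 + s * (e%:~R - D%:R).
Proof.
move=> e1; rewrite /supersol ifF; last by lia.
case: ifP => // e3; have -> : e = D%:Z by lia.
ring.
Qed.

Let D1 : 1 <= D%:R :> R. Proof. by rewrite ler1n. Qed.
Let epsD : eps * D%:R = kap / 8.
Proof. by rewrite /eps; field; rewrite pnatr_eq0; lia. Qed.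
Let eps_gt0 : 0 < eps.
Proof. by rewrite divr_gt0// mulr_gt0// ltr0n. Qed.
Let s_gt0 : 0 < s. Proof. by rewrite divr_gt0. Qed.

Lemma supersol_ge1 e : 1 <= supersol e.
Proof.
have i2r (a b : int) : a <= b -> (a%:~R : R) <= b%:~R by rewrite ler_int.
have [h|h] := leP e (1 - D%:Z).
  rewrite supersol_left// lerDl (mulr_ge0 (ltW s_gt0))//.
  by have := i2r _ _ h; rewrite intrD mulrNz -[D%:~R]/(D%:R); lra.
have [h'|h'] := leP e D%:Z.
  rewrite supersol_mid; last zlia R.
  have a1 := i2r _ _ h'; have a2 := i2r _ _ (ltW h).
  rewrite intrD mulrNz -[D%:~R]/(D%:R) in a2; rewrite -[D%:~R]/(D%:R) in a1.
  by rewrite lerDl (mulr_ge0 (ltW eps_gt0))// mulr_ge0; lra.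
rewrite supersol_right ?(ltW h')// lerDl (mulr_ge0 (ltW s_gt0))//.
by have := i2r _ _ (ltW h'); rewrite -[D%:~R]/(D%:R); lra.
Qed.

Let c := Num.min (eps * 2) (kap * s).

Lemma supersol_const_gt0 : 0 < c.
Proof. by rewrite /c lt_min (mulr_gt0 eps_gt0) ?ltr0n// (mulr_gt0 kap_gt0). Qed.

Lemma supersol_ineq e : c + supersol (e + 1) <=
  (1 + r e) * supersol e - r (e - 1) * supersol (e - 1).
Proof.
have c1 : c <= eps * 2 by rewrite /c ge_min lexx.
have c2 : c <= kap * s by rewrite /c ge_min lexx orbT.
have ks : kap * s <= s by rewrite -[leRHS]mul1r ler_wpM2r ?ltW.
have k4 : s = kap / 4 by [].
have kg := kap_gt0; have kl := kap_lt1; have sg := s_gt0; have eg := eps_gt0.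
have [e1|e1] := leP e (- D%:Z).
  rewrite !supersol_left; [|zlia R..].
  rewrite !intrD !mulrNz.
  set x := 1 - D%:R - e%:~R.
  have x0 : 0 <= x.
    have : (e%:~R : R) <= (- D%:Z)%:~R by rewrite ler_int.
    by rewrite mulrNz -[D%:~R]/(D%:R) /x; lra.
  have H1 : r (e - 1) <= r e by apply: odds_homo => //; zlia R.
  have H2 : r (e - 1) <= 1 - kap by apply: r_left; zlia R.
  have : r (e - 1) * (1 + s * x) <= r e * (1 + s * x).
    by rewrite ler_wpM2r// addr_ge0// (mulr_ge0 (ltW s_gt0) x0).
  have : r (e - 1) * s <= (1 - kap) * s by rewrite ler_wpM2r// (ltW s_gt0).
  rewrite -[(1 : int)%:~R]/(1 : R).
  have -> : 1 - D%:R - (e%:~R + 1) = x - 1 by rewrite /x; ring.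
  have -> : 1 - D%:R - (e%:~R - 1) = x + 1 by rewrite /x; ring.
  by lra.
have [e2|e2] := leP D%:Z e.
  have [e3|e3] := leP (D%:Z + 1) e.
    rewrite !supersol_right; [|zlia R..].
    rewrite !intrD !mulrNz.
    set x := e%:~R - D%:R.
    have x0 : 0 <= x.
      have : (D%:~R : R) <= e%:~R by rewrite ler_int.
      by rewrite -[D%:~R]/(D%:R) /x; lra.
    have H1 : r (e - 1) <= r e by apply: odds_homo => //; zlia R.
    have H2 : 1 + kap <= r (e - 1) by apply: r_right; zlia R.
    have : r (e - 1) * (1 + s * x) <= r e * (1 + s * x).
      by rewrite ler_wpM2r// addr_ge0// (mulr_ge0 (ltW s_gt0) x0).
    have : (1 + kap) * s <= r (e - 1) * s by rewrite ler_wpM2r// (ltW s_gt0).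
    rewrite -[(1 : int)%:~R]/(1 : R).
    have -> : e%:~R + 1 - D%:R = x + 1 by rewrite /x; ring.
    have -> : e%:~R - 1 - D%:R = x - 1 by rewrite /x; ring.
    by lra.
  have -> : e = D%:Z by zlia R.
  rewrite supersol_right; last zlia R.
  rewrite supersol_right//.
  rewrite supersol_mid; last zlia R.
  rewrite (odds_flat (e := D%:Z - 1)); last zlia R.
  rewrite !intrD !mulrNz -[D%:~R]/(D%:R) -[(1 : int)%:~R]/(1 : R).
  have rD : 1 + kap <= r D by apply: r_right.
  have -> : 1 + eps * ((D%:R - 1 + D%:R - 1) * (D%:R - (D%:R - 1))) =
            1 + 2 * (eps * D%:R) - 2 * eps by ring.
  rewrite epsD (_ : D%:R + 1 - D%:R = 1 :> R); last by ring.
  by rewrite subrr mulr0 addr0 !mulr1 mul1r; lra.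
have [e3|e3] := leP e (1 - D%:Z).
  have -> : e = 1 - D%:Z by zlia R.
  rewrite supersol_mid; last zlia R.
  rewrite supersol_left; last zlia R.
  rewrite supersol_left; last zlia R.
  rewrite (odds_flat (e := 1 - D%:Z)); last zlia R.
  rewrite !intrD !mulrNz -[D%:~R]/(D%:R) -[(1 : int)%:~R]/(1 : R).
  have rD : r (1 - D%:Z - 1) <= 1 - kap by apply: r_left; zlia R.
  have -> : 1 + eps * ((1 - D%:R + 1 + D%:R - 1) * (D%:R - (1 - D%:R + 1))) =
            1 + 2 * (eps * D%:R) - 2 * eps by ring.
  have -> : 1 - D%:R - (1 - D%:R - 1) = 1 :> R by ring.
  have : r (1 - D%:Z - 1) * (1 + s) <= (1 - kap) * (1 + s).
    by rewrite ler_wpM2r// addr_ge0// (ltW s_gt0).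
  rewrite epsD subrr mulr0 addr0 !mulr1.
  by lra.
rewrite !supersol_mid; [|zlia R..].
rewrite !odds_flat; [|zlia R..].
rewrite !intrD !mulrNz -[(1 : int)%:~R]/(1 : R).
have -> : forall x : R, (1 + 1) * (1 + eps * ((x + D%:R - 1) * (D%:R - x))) -
  1 * (1 + eps * ((x - 1 + D%:R - 1) * (D%:R - (x - 1)))) =
  1 + eps * ((x + 1 + D%:R - 1) * (D%:R - (x + 1))) + eps * 2.
  by move=> x; ring.
by lra.
Qed.

Lemma supersol_exists : exists2 c : R, 0 < c & forall e,
  c + supersol (e + 1) <= (1 + r e) * supersol e - r (e - 1) * supersol (e - 1).
Proof. by exists c; [exact: supersol_const_gt0|exact: supersol_ineq]. Qed.

Lemma supersol_linear e : supersol e <= (1 + 4 * D%:R) * (1 + `|e|%:R).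
Proof.
have a0 : 0 <= (`|e|%:R : R) by [].
have aE : (`|e|%:R : R) = `|e%:~R| by rewrite natr_absz intr_norm.
have ae := ler_norm (e%:~R : R); have ae' := ler_norm (- e%:~R : R); rewrite normrN in ae'.
rewrite -aE in ae ae'.
have kg := kap_gt0; have kl := kap_lt1; have sg := s_gt0; have eg := eps_gt0.
have s1 : s <= 1 by rewrite /s; lra.
have D0 := D1.
have mx x : 0 <= x -> x <= `|e|%:R -> 1 + s * x <= (1 + 4 * D%:R) * (1 + `|e|%:R) :> R.
  move=> x0 xe; have : s * x <= 1 * x by rewrite ler_wpM2r.
  by nra.
have [h|h] := leP e (1 - D%:Z).
  rewrite supersol_left//; apply: mx; last by lra.
  have : (e%:~R : R) <= (1 - D%:Z)%:~R by rewrite ler_int.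
  by rewrite intrD mulrNz -[D%:~R]/(D%:R); lra.
have [h'|h'] := leP e D%:Z.
  rewrite supersol_mid; last zlia R.
  have a1 : (e%:~R : R) <= D%:~R by rewrite ler_int.
  have a2 : ((1 - D%:Z)%:~R : R) <= e%:~R by rewrite ler_int ltW.
  rewrite intrD mulrNz -[D%:~R]/(D%:R) in a2; rewrite -[D%:~R]/(D%:R) in a1.
  have : (e%:~R + D%:R - 1) * (D%:R - e%:~R) <= (2 * D%:R) * (2 * D%:R) :> R.
    by apply: ler_pM; lra.
  move=> /(ler_wpM2l (ltW eps_gt0)).
  have -> : eps * ((2 * D%:R) * (2 * D%:R)) = 4 * (eps * D%:R) * D%:R by ring.
  rewrite epsD; have : kap / 8 * D%:R <= 1 * D%:R by rewrite ler_wpM2r//; lra.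
  by nra.
rewrite supersol_right ?(ltW h')//; apply: mx; last by lra.
have : (D%:~R : R) <= e%:~R by rewrite ler_int ltW.
by rewrite -[D%:~R]/(D%:R); lra.
Qed.

(* beyond [D] the walk turns back with probability at least [P0 > 1 / 2], which
   leaves room for an exponential moment with a base [z] greater than 1 *)
Let P0 := plus_prob w D.
Let z := 2 * P0.

Let P0_gt : 1 / 2 < P0.
Proof.
rewrite /P0 /plus_prob ltr_pdivlMr ?addr_gt0//.
by have := wD; lra.
Qed.
Let P0_lt1 : P0 < 1. Proof. exact: plus_prob_lt1. Qed.

(** Exponential moments of the imbalance contract outside the interval
    [- D, D]. By [kern_le] it suffices that the right-hand side be a supersolution; beyond
    [D] the inequality to check is affine in [p e], and its extreme value [P0]
    or [1 - P0] decides. *)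
Lemma lyapunov_exp : exists rho C : R, [/\ 0 <= rho, rho < 1, 0 <= C &
  forall B : nat, (D < B)%N -> forall e,
    kern (trunc_prob w B) B (fun x => z ^+ `|x|) e <= rho * z ^+ `|e| + C].
Proof.
have Pg := P0_gt; have Pl := P0_lt1.
have z1 : 1 < z by rewrite /z; lra.
have z0 : 0 < z by lra.
pose u := P0 ^+ 2 + (1 - P0) ^+ 2.
have u2 : 1 / 2 < u.
  have : 0 < (P0 - 1 / 2) ^+ 2 by rewrite exprn_gt0// subr_gt0.
  by rewrite /u; nra.
(* [r2] is what [e >= D] needs, [r1] and [r3] what [e <= - D] needs *)
have [rho [r_ge0 r_lt1 r1 r2 r3]] : exists rho : R,
    [/\ 0 <= rho, rho < 1, z^-1 <= rho, 4 * P0 * (1 - P0) <= rho & (2 * u)^-1 <= rho].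
  exists (Num.max z^-1 (Num.max (4 * P0 * (1 - P0)) (2 * u)^-1)).
  have i0 : 0 < z^-1 by rewrite invr_gt0.
  split; rewrite ?le_max ?lexx ?(ltW i0) ?orbT// !gt_max; apply/and3P; split.
  - by rewrite invf_lt1.
  - have : 0 < (P0 - 1 / 2) ^+ 2 by rewrite exprn_gt0// subr_gt0.
    by nra.
  - by rewrite invf_lt1; lra.
exists rho, (2 * z ^+ D); split => //; first by rewrite mulr_ge0 ?exprn_ge0 ?ltW.
move=> B DB; apply: (kern_le (trunc_ge0 w_gt0 B) (@trunc_low _ w B)
  (h := fun e => rho * z ^+ `|e| + 2 * z ^+ D)) => e; have B0 : (0 < B)%N by zlia R.
set p := trunc_prob w B.
have p0 : 0 <= p e := trunc_ge0 w_gt0 B e.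
have p1 : p e <= 1 := trunc_le1 w_gt0 B e.
have C0 : 0 <= 2 * z ^+ D by rewrite mulr_ge0 ?exprn_ge0 ?ltW.
have pC : p e * (2 * z ^+ D) <= 2 * z ^+ D by rewrite -[leRHS]mul1r ler_wpM2r.
have pE : p D = P0 by rewrite /p trunc_mid//; zlia R.
have [h|h] := leP D%:Z e.
  have Pp : P0 <= p e by rewrite -pE /p; apply: trunc_homo.
  have [n nE] : exists n : nat, e = n.+1 by exists (`|e|.-1)%N; zlia R.
  have -> : `|(e + 1)%R|%N = n.+2 by zlia R.
  have -> : `|(e - 1)%R|%N = n by zlia R.
  have -> : `|e|%N = n.+1 by zlia R.
  rewrite !exprS; have x0 : 0 < z ^+ n by rewrite exprn_gt0.
  suff : (1 - p e) * (z * z) + p e * rho <= rho * z.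
    move=> /(ler_wpM2r (ltW x0)); lra.
  have H1 : rho * P0 >= (1 - P0) * (z * z).
    have -> : (1 - P0) * (z * z) = 4 * P0 * (1 - P0) * P0 by rewrite /z; ring.
    by rewrite ler_wpM2r//; lra.
  have zr : rho <= z * z by nra.
  have : (p e - P0) * (z * z - rho) >= 0 by rewrite mulr_ge0; lra.
  have : rho * z = rho * P0 + rho * P0 by rewrite /z; ring.
  by lra.
have [h'|h'] := leP e (- D%:Z).
  have Pp : p e <= 1 - P0 by rewrite -pE /p -truncN//; apply: trunc_homo.
  have [n nE] : exists n : nat, e = - (n.+1)%:Z by exists (`|e|.-1)%N; zlia R.
  have -> : `|(e + 1)%R|%N = n by zlia R.
  have -> : `|(e - 1)%R|%N = n.+2 by zlia R.
  have -> : `|e|%N = n.+1 by zlia R.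
  rewrite !exprS; have x0 : 0 < z ^+ n by rewrite exprn_gt0.
  suff : (1 - p e) + p e * (rho * (z * z)) <= rho * z.
    move=> /(ler_wpM2r (ltW x0)); lra.
  have H0 : 1 <= rho * z by rewrite -ler_pdivrMr// mul1r.
  have H1 : 1 <= rho * (2 * u) by rewrite -ler_pdivrMr ?mul1r//; lra.
  have zz : 1 <= rho * (z * z) by rewrite mulrA; nra.
  have : (1 - P0 - p e) * (rho * (z * z) - 1) >= 0 by rewrite mulr_ge0; lra.
  have : rho * z - (1 - P0) * (rho * (z * z)) - P0 = P0 * (rho * (2 * u) - 1).
    by rewrite /z /u; ring.
  have : P0 * (rho * (2 * u) - 1) >= 0 by rewrite mulr_ge0; lra.
  by lra.
have zle a : (a <= D)%N -> z ^+ a <= z ^+ D by move=> aD; rewrite ler_eXn2l.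
have H1 : z ^+ `|(e + 1)%R| <= z ^+ D by apply: zle; zlia R.
have H2 : z ^+ `|(e - 1)%R| <= z ^+ D by apply: zle; zlia R.
have H3 : rho * z ^+ `|(e - 1)%R| <= z ^+ `|(e - 1)%R|.
  by rewrite -[leRHS]mul1r ler_wpM2r ?ltW// exprn_gt0.
have H4 : 0 <= rho * z ^+ `|e| by rewrite mulr_ge0// exprn_ge0// ltW.
have p2 : p e = 1 / 2.
  rewrite /p trunc_mid; [|zlia R..].
  have := plus_prob_odds w_gt0 e; rewrite odds_flat; last zlia R.
  by lra.
by rewrite p2; lra.
Qed.

End first.
End bounds.

(** * Drift and fourth moment of the imbalance after [k] minus steps *)

(** The fourth moment is controlled by the exponential one. For the mean, the
    [k]-th iterate [f] of the identity has increments [O(|e| / k)], so it differs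
    from [f 0] by [O(e ^ 2 / k)]; integrating against the invariant law, whose
    mean is [1 / 2] by symmetry and whose moments are bounded by [lyapunov_exp],
    shows that [f 0] is within [O(1 / k)] of [1 / 2]. *)
Lemma kernel_bounds (R : realFieldType) (w : int -> R) :
  (forall k, 0 < w k) -> {homo w : i j / i <= j} ->
  (exists i j : int, w i <> w j) ->
  exists (C : R) (D : nat), 0 < C /\ forall B : nat, (D < B)%N ->
    let p := trunc_prob w B in
    (forall k : nat, (0 < k)%N -> `|mean_iter p B k 0 - 1 / 2| <= C / k%:R) /\
    (forall k : nat, kern_iter p B k (fun e => e%:~R ^+ 4) 0 <= C).
Proof.
move=> w0 wh wn; have [D [D0 wD wflat]] := first_bias wh wn.
have [rho [C [r0 r1 C0 KV]]] := lyapunov_exp w0 wh D0 wD wflat.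
set z := 2 * plus_prob w D in KV.
have z1 : 1 < z.
  have : 1 / 2 < plus_prob w D.
    rewrite /plus_prob ltr_pdivlMr ?addr_gt0//; lra.
  by rewrite /z; lra.
have [Cz Cz0 hz] := exp4_le_geometric z1.
have [c c0 bs] := supersol_exists w0 wh D0 wD wflat.
have bl := supersol_linear w0 D0 wD.
have b1 := supersol_ge1 w0 D0 wD.
pose b e := c^-1 * supersol w D e.
pose A := c^-1 * (1 + 4 * D%:R).
have A0 : 0 < A by rewrite mulr_gt0 ?invr_gt0// ltr_pwDl// mulr_ge0.
have bA e : b e <= A * (1 + `|e|%:R).
  by rewrite /b /A -mulrA ler_pM2l ?invr_gt0.
have b_ge0 e : 0 <= b e.
  by rewrite mulr_ge0 ?invr_ge0 ?(ltW c0)// (le_trans ler01).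
have b_super e : 1 + b (e + 1) <= (1 + odds w e) * b e - odds w (e - 1) * b (e - 1).
  have := bs e; rewrite -(@ler_pM2l _ c^-1) ?invr_gt0//.
  rewrite mulrDr mulVf ?gt_eqF// -/(b _) => /le_trans; apply.
  rewrite le_eqVlt; apply/orP; left; apply/eqP; rewrite /b; ring.
pose M := Num.max 1 (C / (1 - rho)).
have M1 : 1 <= M by rewrite le_max lexx.
have M0 : 0 < M := lt_le_trans ltr01 M1.
have MC : C / (1 - rho) <= M by rewrite le_max lexx orbT.
clearbody b A M.
exists (Cz * M + 2 * A * Cz * M), D; split.
  by rewrite addr_gt0 ?mulr_gt0// ltr0n.
move=> B DB /=; set p := trunc_prob w B.
have B0 : (0 < B)%N by zlia R.
have p0 : forall e, 0 <= p e := trunc_ge0 w0 B.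
have p1 : forall e, p e <= 1 := trunc_le1 w0 B.
have pl : forall e, e <= - B%:Z -> p e = 0 := @trunc_low _ w B.
have ph : forall e, B%:Z <= e -> p e = 1 := trunc_high w B0.
have phomo : {homo p : i j / i <= j} := trunc_homo w0 wh B0.
have psym : forall e, p (- e) = 1 - p e := truncN w0 B0.
have ppos : forall n, 0 < p (n.+1)%:Z := trunc_pos w0 B0.
have podds : forall e, - B%:Z < e < B%:Z -> p e * (1 + odds w e) = odds w e :=
  trunc_odds w0 B0.
have o0 e : 0 <= odds w e by exact/ltW/odds_gt0.
have := mean_iter_diff p0 p1 pl phomo o0 b_ge0 ph podds b_super.
rewrite -/p => diff.
have V4 (e : int) : e%:~R ^+ 4 <= Cz * z ^+ `|e|.
  apply: le_trans (hz _); rewrite natr_absz intr_norm.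
  by rewrite -[X in _ <= X]ger0_norm ?exprn_ge0// -normrX normr_id [X in _ <= X]ger0_norm ?lexx// (exprM _ 2 2) sqr_ge0.
have rM : rho * M + C <= M.
  by move: MC; rewrite ler_pdivrMr ?subr_gt0//; lra.
have fourth k : kern_iter p B k (fun e => e%:~R ^+ 4) 0 <= Cz * M.
  apply: le_trans (_ : kern_iter p B k (fun e => Cz * z ^+ `|e| + 0) 0 <= _).
    by apply: kern_iter_homo => // e; rewrite addr0.
  rewrite (kern_iter_linear p0 p1 pl k Cz (fun e => z ^+ `|e|) (fun=> 0)).
  rewrite kern_iter_cst// addr0 ler_pM2l//.
  by apply: (@kern_iter_lyapunov _ p B p0 p1 pl _ rho C) => //; exact: KV.
split; last first.
  by move=> k; apply: le_trans (fourth k) _; rewrite lerDl !mulr_ge0// ltW.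
move=> k k0; have kR : 0 < k%:R :> R by rewrite ltr0n.
pose f := mean_iter p B k.
have dge e : 0 <= f (e + 1) - f e by exact: mean_iter_diff_ge0.
have dle e : - B%:Z <= e -> f (e + 1) - f e <= A * (1 + `|e + 1|%:R) / k%:R.
  by move=> eB; rewrite ler_pdivlMr// mulrC; apply: le_trans (diff k e eB) (bA _).
have up (n : nat) : 0 <= f n - f 0 <= n%:R * (A * (1 + n%:R) / k%:R).
  elim: n => [|n /andP[h1 h2]]; first by rewrite subrr mul0r lexx.
  have := dge n; have := dle n ltac:(zlia R).
  have -> : `|(n%:Z + 1)%R|%N = n.+1 by zlia R.
  have -> : n%:Z + 1 = n.+1 by zlia R.
  move=> h3 h4; apply/andP; split; first by lra.
  have mono : n%:R * (A * (1 + n%:R) / k%:R) <= n%:R * (A * (1 + n.+1%:R) / k%:R).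
    rewrite ler_wpM2l// ler_wpM2r ?invr_ge0 ?(ltW kR)// ler_wpM2l ?(ltW A0)//.
    by rewrite lerD2l ler_nat.
  by rewrite -[X in X%:R * _]addn1 natrD mulrDl mul1r; lra.
have dn (n : nat) : (n <= B)%N -> 0 <= f 0 - f (- n%:Z) <= n%:R * (A * (1 + n%:R) / k%:R).
  elim: n => [|n IH] nB; first by rewrite oppr0 subrr mul0r lexx.
  have /andP[h1 h2] := IH ltac:(zlia R).
  have := dge (- (n.+1)%:Z); have := dle (- (n.+1)%:Z) ltac:(zlia R).
  have -> : `|(- (n.+1)%:Z + 1)%R|%N = n by zlia R.
  have -> : - (n.+1)%:Z + 1 = - n%:Z by zlia R.
  move=> h3 h4; apply/andP; split; first by lra.
  have mono : A * (1 + n%:R) / k%:R <= A * (1 + n.+1%:R) / k%:R.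
    rewrite ler_wpM2r ?invr_ge0 ?(ltW kR)// ler_wpM2l ?(ltW A0)//.
    by rewrite lerD2l ler_nat.
  have n0 : 0 <= n%:R :> R by [].
  have mono' := ler_wpM2l n0 mono.
  by rewrite -[X in X%:R * _]addn1 natrD mulrDl mul1r; lra.
(* [up] and [dn] bound the sum of the increments between 0 and [e] by a
   quadratic polynomial, which the exponential dominates *)
have both (e : int) : - B%:Z < e <= B%:Z -> `|f e - f 0| <= 2 * A * Cz / k%:R * z ^+ `|e|.
  move=> eB; set n := `|e|%N.
  apply: le_trans (_ : n%:R * (A * (1 + n%:R) / k%:R) <= _).
    have [e0|e0] := leP 0 e.
      have -> : e = n by zlia R.
      by have /andP[h1 h2] := up n; rewrite ger0_norm.
    have -> : e = - n%:Z by zlia R.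
    by have /andP[h1 h2] := dn n ltac:(zlia R); rewrite distrC ger0_norm.
  have -> : n%:R * (A * (1 + n%:R) / k%:R) = A / k%:R * (n%:R * (1 + n%:R)) by ring.
  have -> : 2 * A * Cz / k%:R * z ^+ n = A / k%:R * (2 * (Cz * z ^+ n)) by ring.
  rewrite ler_wpM2l ?divr_ge0 ?(ltW A0)//.
  apply: le_trans (_ : 2 * n%:R ^+ 4 <= _); last by rewrite ler_pM2l.
  case: (n) => [|m]; first by rewrite mul0r mulr_ge0// exprn_ge0.
  have m1 : 1 <= m.+1%:R :> R by rewrite ler1n.
  have -> : m.+1%:R ^+ 4 = m.+1%:R ^+ 2 * m.+1%:R ^+ 2 :> R by ring.
  by nra.
have nu1 := inv_measure1_gt0 p0 p1 B0.
have nuf : inv_measure p B f = inv_measure p B (fun=> 1) / 2.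
  by rewrite inv_measure_kern_iter ?inv_measure_id.
have nuV : inv_measure p B (fun e => z ^+ `|e|) <= M * inv_measure p B (fun=> 1).
  apply: le_trans (_ : C / (1 - rho) * inv_measure p B (fun=> 1) <= _).
    by apply: inv_measure_lyapunov => //; exact: KV.
  by rewrite ler_pM2r.
have nuup : inv_measure p B (fun e => - 1 * f e + f 0) <=
    2 * A * Cz / k%:R * inv_measure p B (fun e => z ^+ `|e|).
  have -> : 2 * A * Cz / k%:R * inv_measure p B (fun e => z ^+ `|e|) =
     inv_measure p B (fun e => 2 * A * Cz / k%:R * z ^+ `|e| + 0).
    by rewrite inv_measure_linear inv_measure_cst mul0r addr0.
  apply: inv_measure_le => // e eB; rewrite addr0; apply: le_trans (both e eB).
  by rewrite mulN1r addrC distrC ler_norm.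
have nudn : inv_measure p B (fun e => 1 * f e + - f 0) <=
    2 * A * Cz / k%:R * inv_measure p B (fun e => z ^+ `|e|).
  have -> : 2 * A * Cz / k%:R * inv_measure p B (fun e => z ^+ `|e|) =
     inv_measure p B (fun e => 2 * A * Cz / k%:R * z ^+ `|e| + 0).
    by rewrite inv_measure_linear inv_measure_cst mul0r addr0.
  apply: inv_measure_le => // e eB; rewrite addr0; apply: le_trans (both e eB).
  by rewrite mul1r ler_norm.
have last : 2 * A * Cz / k%:R * inv_measure p B (fun e => z ^+ `|e|) <=
    2 * A * Cz * M / k%:R * inv_measure p B (fun=> 1).
  have -> : 2 * A * Cz * M / k%:R * inv_measure p B (fun=> 1) =
    2 * A * Cz / k%:R * (M * inv_measure p B (fun=> 1)) by ring.
  by rewrite ler_wpM2l// divr_ge0// !mulr_ge0// ltW.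
have main : `|f 0 - 1 / 2| <= 2 * A * Cz * M / k%:R.
  rewrite inv_measure_linear inv_measure_cst nuf in nuup; rewrite inv_measure_linear inv_measure_cst nuf in nudn.
  rewrite ler_norml; apply/andP; split; rewrite -(ler_pM2r nu1); lra.
by apply: le_trans main _; rewrite ler_wpM2r ?invr_ge0 ?(ltW kR)// lerDr mulr_ge0 ?(ltW Cz0) ?(ltW M0).
Qed.

(** * Chains of integers described by their expectations *)

Section chain.
Variable (R : realFieldType).

(** The transition laws are given by their action on functions: the arguments
    below use expectations only, and [stack_law] is defined as one. *)
Record expectation_kernel := ExpectationKernel {
  ker :> nat -> (nat -> R) -> R ;
  ker_linear : forall k a f g, ker k (fun l => a * f l + g l) = a * ker k f + ker k g ;
  ker_le : forall k f g, (forall l, f l <= g l) -> ker k f <= ker k g ;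
  ker_cst : forall k c, ker k (fun=> c) = c }.

Variable E : expectation_kernel.

Lemma ker_ext k f g : f =1 g -> E k f = E k g.
Proof. by move=> fg; apply/eqP; rewrite eq_le !ker_le// => l; rewrite fg. Qed.

(** Expectation over the [J] states that follow the state [k]. *)
Fixpoint path_exp (J : nat) (Phi : seq nat -> R) (k : nat) : R :=
  if J is J'.+1 then E k (fun l => path_exp J' (fun z => Phi (l :: z)) l)
  else Phi [::].

Lemma path_exp_le J Phi Psi k :
  (forall z, size z = J -> Phi z <= Psi z) -> path_exp J Phi k <= path_exp J Psi k.
Proof.
elim: J Phi Psi k => [|J IH] Phi Psi k le; first exact: le.
by apply: ker_le => l; apply: IH => z zJ; apply: le; rewrite /= zJ.
Qed.

Lemma path_exp_ext J Phi Psi k :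
  (forall z, size z = J -> Phi z = Psi z) -> path_exp J Phi k = path_exp J Psi k.
Proof.
by move=> eqf; apply/eqP; rewrite eq_le !path_exp_le// => z zJ; rewrite eqf.
Qed.

Lemma path_exp_cst J c k : path_exp J (fun=> c) k = c.
Proof.
elim: J k => [//|J IH] k /=.
by rewrite -[RHS](ker_cst E k c); apply: ker_ext.
Qed.

Lemma path_exp_linear J a Phi Psi k :
  path_exp J (fun z => a * Phi z + Psi z) k = a * path_exp J Phi k + path_exp J Psi k.
Proof.
elim: J Phi Psi k => [//|J IH] Phi Psi k /=.
by rewrite -ker_linear; apply: ker_ext => l; rewrite IH.
Qed.

Lemma path_expD J Phi Psi k :
  path_exp J (fun z => Phi z + Psi z) k = path_exp J Phi k + path_exp J Psi k.
Proof.
rewrite -[path_exp J Phi k]mul1r -path_exp_linear.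
by apply: path_exp_ext => z _; rewrite mul1r.
Qed.

Lemma path_expZ J a Phi k : path_exp J (fun z => a * Phi z) k = a * path_exp J Phi k.
Proof.
rewrite -[RHS]addr0 -(path_exp_cst J 0 k) -path_exp_linear.
by apply: path_exp_ext => z _; rewrite addr0.
Qed.

Lemma path_exp_sum J n (Phi : nat -> seq nat -> R) k :
  path_exp J (fun z => \sum_(i < n) Phi i z) k = \sum_(i < n) path_exp J (Phi i) k.
Proof.
elim: n => [|n IH].
  rewrite big_ord0 -[RHS](path_exp_cst J 0 k).
  by apply: path_exp_ext => z _; rewrite big_ord0.
rewrite big_ord_recr/= -IH -path_expD.
by apply: path_exp_ext => z _; rewrite big_ord_recr.
Qed.

Definition drift (k : nat) : R := E k (fun l => k%:R - l%:R).

Variable C : R.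
Hypothesis C_gt0 : 0 < C.
Hypothesis bias : forall k, (0 < k)%N -> `|drift k - 1 / 2| <= C / k%:R.
Hypothesis moment4 : forall k, E k (fun l => (k%:R - l%:R) ^+ 4) <= C.

Lemma drift_bound k : `|drift k| <= C + 1.
Proof.
have x4 (x : R) : x <= x ^+ 4 + 1.
  have -> : x ^+ 4 = (x ^+ 2) ^+ 2 by ring.
  have := sqr_ge0 (x ^+ 2 - 1); have := sqr_ge0 (x - 1); have := sqr_ge0 (x ^+ 2).
  by nra.
have h : E k (fun l => 1 * (k%:R - l%:R) ^+ 4 + 1) <= C + 1.
  by rewrite ker_linear ker_cst mul1r lerD2r.
rewrite ler_norml; apply/andP; split.
  rewrite lerNl; apply: le_trans h.
  rewrite -[- drift k]addr0 -mulN1r -[X in _ + X](ker_cst E k 0) -ker_linear.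
  apply: ker_le => l; rewrite addr0 mulN1r mul1r.
  by apply: le_trans (x4 _) _; rewrite (_ : (- _) ^+ 4 = (k%:R - l%:R) ^+ 4)//; ring.
by apply: le_trans h; apply: ker_le => l; rewrite mul1r.
Qed.
End chain.

(** * The compensated chain *)

Section compensated.
Variables (R : realFieldType) (E : expectation_kernel R) (C : R).
Hypothesis C_gt0 : 0 < C.
Hypothesis bias : forall k, (0 < k)%N -> `|drift E k - 1 / 2| <= C / k%:R.
Hypothesis moment4 : forall k, E k (fun l => (k%:R - l%:R) ^+ 4) <= C.
Local Notation m := (drift E).

(** The decrements of the chain, compensated by their conditional means, summed
    along the states [z] that follow [k]; see [martingale_step]. *)
Fixpoint martingale (k : nat) (z : seq nat) : R :=
  if z is l :: z' then (k%:R - l%:R - m k) + martingale l z' else 0.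

Definition increment (k l : nat) : R := k%:R - l%:R - m k.

Let F : R := 8 * C + 8 * (C + 1) ^+ 4.
Definition var_bound : R := 4 * (F + 1).
Local Notation A := var_bound.

Let F_gt0 : 0 < F.
Proof. by rewrite /F ltr_pwDl ?mulr_gt0 ?ltr0n// mulr_ge0// exprn_ge0// addr_ge0// ltW. Qed.

Lemma var_bound_gt0 : 0 < A.
Proof. by rewrite /A mulr_gt0 ?ltr0n// addr_gt0. Qed.

Lemma increment_mean k : E k (increment k) = 0.
Proof.
rewrite (@ker_ext _ E _ _ (fun l => 1 * (k%:R - l%:R) + - m k)).
  by rewrite ker_linear ker_cst mul1r subrr.
by move=> l; rewrite /increment mul1r.
Qed.

Lemma increment_moment4 k : E k (fun l => increment k l ^+ 4) <= F.
Proof.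
have pw (x y : R) : (x - y) ^+ 4 <= 8 * x ^+ 4 + 8 * y ^+ 4.
  have sq (a b : R) : (a + b) ^+ 2 <= 2 * (a ^+ 2 + b ^+ 2).
    by have := sqr_ge0 (a - b); nra.
  have h1 := sq x (- y); rewrite sqrrN in h1.
  have h2 := sq (x ^+ 2) (y ^+ 2).
  have h3 : (x - y) ^+ 4 <= 4 * (x ^+ 2 + y ^+ 2) ^+ 2.
    have -> : 4 * (x ^+ 2 + y ^+ 2) ^+ 2 = (2 * (x ^+ 2 + y ^+ 2)) ^+ 2 by ring.
    rewrite (exprM _ 2 2).
    by apply: lerXn2r; rewrite ?nnegrE ?sqr_ge0// mulr_ge0// addr_ge0// sqr_ge0.
  have e4 (t : R) : (t ^+ 2) ^+ 2 = t ^+ 4 by ring.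
  by rewrite !e4 in h2; lra.
apply: le_trans (_ : E k (fun l => 8 * (k%:R - l%:R) ^+ 4 + 8 * (m k) ^+ 4) <= _).
  by apply: ker_le => l; exact: pw.
rewrite ker_linear ker_cst /F lerD// ler_pM2l ?ltr0n//.
have md := drift_bound moment4 k.
have -> : m k ^+ 4 = `|m k| ^+ 4.
  by rewrite -normrX ger0_norm// (exprM _ 2 2) sqr_ge0.
by apply: lerXn2r => //; rewrite nnegrE// addr_ge0// ltW.
Qed.

Lemma increment_moment2 k : E k (fun l => increment k l ^+ 2) <= F + 1.
Proof.
apply: le_trans (_ : E k (fun l => 1 * increment k l ^+ 4 + 1) <= _).
  apply: ker_le => l; rewrite mul1r (exprM _ 2 2).
  by have := sqr_ge0 (increment k l ^+ 2 - 1); have := sqr_ge0 (increment k l ^+ 2); nra.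
by rewrite ker_linear ker_cst mul1r lerD2r increment_moment4.
Qed.

(** A bound of Burkholder type, by induction on the first step with
    an arbitrary starting value [c]: the term linear in the increment averages
    to 0, and the cubic one is absorbed by the square of [c x - x ^ 2]. *)
Lemma martingale_moment4 J i k c :
  path_exp E J (fun z => (c + martingale k (take i z)) ^+ 4) k <= (c ^+ 2 + A * i%:R) ^+ 2.
Proof.
have A0 := var_bound_gt0.
have c4 (i' : nat) (c' : R) : c' ^+ 4 <= (c' ^+ 2 + A * i'%:R) ^+ 2.
  rewrite (exprM _ 2 2); apply: lerXn2r; rewrite ?nnegrE ?sqr_ge0//.
    by rewrite addr_ge0 ?sqr_ge0// mulr_ge0// ltW.
  by rewrite lerDl mulr_ge0// ltW.
elim: J i k c => [|J IH] i k c; first by rewrite /= addr0.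
case: i => [|i].
  rewrite (@path_exp_ext _ E _ _ (fun=> c ^+ 4)); first by rewrite path_exp_cst.
  by move=> z _; rewrite take0 addr0.
rewrite /=; apply: le_trans (_ : E k (fun l => ((c + increment k l) ^+ 2 + A * i%:R) ^+ 2) <= _).
  apply: ker_le => l; apply: le_trans (IH i l (c + increment k l)).
  by apply: path_exp_le => z _; rewrite /increment addrA.
pose u := c ^+ 2 + A * i%:R.
have u0 : 0 <= u by rewrite addr_ge0 ?sqr_ge0// mulr_ge0// ltW.
have cu : c ^+ 2 <= u by rewrite lerDl mulr_ge0// ltW.
apply: le_trans (_ : E k (fun l => 4 * c * u * increment k l +
   (8 * u * increment k l ^+ 2 + (3 * increment k l ^+ 4 + u ^+ 2))) <= _).
  apply: ker_le => l; set x := increment k l.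
  have -> : ((c + x) ^+ 2 + A * i%:R) ^+ 2 =
    u ^+ 2 + 4 * c * u * x + (2 * u + 4 * c ^+ 2) * x ^+ 2 + 4 * c * x ^+ 3 + x ^+ 4.
    by rewrite /u; ring.
  have : 0 <= 2 * (c * x - x ^+ 2) ^+ 2 by rewrite mulr_ge0// sqr_ge0.
  have -> : 2 * (c * x - x ^+ 2) ^+ 2 = 2 * (c ^+ 2 * x ^+ 2) - 4 * c * x ^+ 3 + 2 * x ^+ 4 by ring.
  have : c ^+ 2 * x ^+ 2 <= u * x ^+ 2 by rewrite ler_wpM2r// sqr_ge0.
  by lra.
rewrite !ker_linear ker_cst increment_mean mulr0 add0r.
have h2 := increment_moment2 k; have h4 := increment_moment4 k.
have -> : (c ^+ 2 + A * i.+1%:R) ^+ 2 = u ^+ 2 + 2 * A * u + A ^+ 2.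
  by rewrite /u -natr1; ring.
have : 8 * u * E k (fun l => increment k l ^+ 2) <= 8 * u * (F + 1).
  by rewrite ler_wpM2l// mulr_ge0.
have AE : A = 4 * (F + 1) by [].
have : 3 * F <= A ^+ 2 by rewrite AE; have := F_gt0; nra.
have : 2 * A * u = 8 * u * (F + 1) by rewrite AE; ring.
by lra.
Qed.

Variable k0 : nat.
Hypothesis k0_bias : 8 * C <= k0%:R.
Hypothesis k0_gt0 : (0 < k0)%N.

Lemma drift_near k : (k0 <= k)%N -> `|m k - 1 / 2| <= 1 / 8.
Proof.
move=> k0k; apply: le_trans (bias _) _; first by lia.
rewrite ler_pdivrMr ?ltr0n; last by lia.
have := k0_bias; have : (k0%:R : R) <= k%:R by rewrite ler_nat.
by lra.
Qed.

(** A decrement of the chain is an integer, and above [k0] its mean is close to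
    [1 / 2], hence at distance at least [3 / 8] from every integer. *)
Lemma increment_var k : (k0 <= k)%N -> 1 / 16 <= E k (fun l => increment k l ^+ 2).
Proof.
move=> k0k; rewrite -[leLHS](ker_cst E k); apply: ker_le => l.
have := drift_near k0k; rewrite ler_norml => /andP[h1 h2].
rewrite /increment; have [lk|kl] := ltnP l k.
  have : (l.+1%:R : R) <= k%:R by rewrite ler_nat.
  by rewrite -natr1 => h; nra.
have : (k%:R : R) <= l%:R by rewrite ler_nat.
by move=> h; nra.
Qed.

(** Every step from a state above [k0] contributes at least [1 / 16] to the
    variance; the count pays for the other steps. *)
Lemma martingale_moment2 J i k c : (i <= J)%N -> c ^+ 2 + i%:R / 16 <=
  path_exp E J (fun z => (c + martingale k (take i z)) ^+ 2 +
    (count (fun v => (v < k0)%N) (take i (k :: z)))%:R / 16) k.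
Proof.
elim: J i k c => [|J IH] [|i] k c // iJ.
- by rewrite /= addr0 mul0r.
- rewrite -[leLHS](path_exp_cst E J.+1 _ k).
  by apply: path_exp_le => z _; rewrite !take0 /= addr0.
pose b : R := (k < k0)%N%:R / 16.
apply: le_trans (_ : E k (fun l => (c + increment k l) ^+ 2 + i%:R / 16 + b) <= _).
  rewrite (@ker_ext _ E _ _ (fun l => 2 * c * increment k l + (1 * increment k l ^+ 2 +
    (c ^+ 2 + i%:R / 16 + b)))); last by move=> l; ring.
  rewrite !ker_linear ker_cst increment_mean mulr0 add0r mul1r -natr1.
  have [kk0|k0k] := ltnP k k0.
    rewrite /b kk0 /=; suff : 0 <= E k (fun l => increment k l ^+ 2) by lra.
    by rewrite -[leLHS](ker_cst E k); apply: ker_le => l; rewrite sqr_ge0.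
  have := increment_var k0k; rewrite /b ltnNge k0k /=; lra.
apply: ker_le => l.
rewrite -[b](path_exp_cst E J _ l).
apply: le_trans (lerD (IH i l (c + increment k l) iJ) (lexx _)) _.
rewrite -path_expD; apply: path_exp_le => z _ /=.
by rewrite natrD /increment /b addrA; lra.
Qed.

Lemma jump_moment4 J i k : (i < J)%N ->
  path_exp E J (fun z => ((nth 0%N (k :: z) i)%:R - (nth 0%N (k :: z) i.+1)%:R) ^+ 4) k <= C.
Proof.
elim: J i k => [//|J IH] [|i] k iJ /=.
  apply: le_trans (moment4 k); apply: ker_le => l /=.
  by rewrite path_exp_cst.
rewrite -[leRHS](ker_cst E k); apply: ker_le => l; exact: IH.
Qed.

Lemma martingale_step k z i : (i < size z)%N ->
  (nth 0%N (k :: z) i.+1)%:R + martingale k (take i.+1 z) =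
  (nth 0%N (k :: z) i)%:R + martingale k (take i z) - m (nth 0%N (k :: z) i).
Proof.
elim: z i k => [//|l z IH] [|i] k iz /=.
  by rewrite take0 /=; ring.
have := IH i l iz; rewrite /= => h.
by rewrite addrCA h; ring.
Qed.
End compensated.

(** * Trajectories that follow the wedge *)

Definition wedge_gap {R : realFieldType} (k : R) (Z : nat -> nat) (j : nat) : R :=
  (Z j)%:R - Num.max (k - j%:R / 2) 0.

Lemma wedge_lipschitz (R : realFieldType) (x y : R) :
  `|Num.max x 0 - Num.max y 0| <= `|x - y|.
Proof.
have h1 := ler_norm (x - y); have h2 := ler_norm (- (x - y)); rewrite normrN in h2.
by rewrite ler_norml; apply/andP; split; case: (leP x 0); case: (leP y 0); lra.
Qed.

Section trajectory.
Variables (R : realFieldType) (Z : nat -> nat) (M m : nat -> R).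
Variables (k h k0 : nat) (C e : R).

(** As long as [Z >= h / 8], the mean decrement differs from [1 / 2] by at most
    [8 C / h] per step, which over [2 k] steps sums up to much less than [h].
    So [Z + M] follows the line [k - i / 2], which stays above [h / 2] until
    time [2 k - h]; this in turn gives [Z >= h / 8]. *)
Lemma trajectory_low :
  0 < C -> (0 < k0)%N ->
  (forall v, (0 < v)%N -> `|m v - 1 / 2| <= C / v%:R) ->
  Z 0 = k -> M 0 = 0 ->
  (forall i, (i < 2 * k + h)%N -> (Z i.+1)%:R + M i.+1 = (Z i)%:R + M i - m (Z i)) ->
  (h <= k)%N -> 8 * k0%:R <= h%:R :> R -> 16 * k%:R * C / h%:R <= h%:R / 64 ->
  (forall i, (i <= 2 * k + h)%N -> `|M i| <= h%:R / 64) ->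
  forall i, (i <= 2 * k - h)%N -> (k0 <= Z i)%N /\
    `|(Z i)%:R + M i - (k%:R - i%:R / 2)| <= 16 * k%:R * C / h%:R.
Proof.
move=> C0 k00 mb Z0 M0 step hk kh small1 Mb.
have k01 : 1 <= k0%:R :> R by rewrite ler1n.
have h0 : 0 < h%:R :> R by lra.
have hN : (0 < h)%N by rewrite -(ltr0n R).
have hkR : h%:R <= k%:R :> R by rewrite ler_nat.
pose q := 8 * C / h%:R.
have q0 : 0 <= q by rewrite divr_ge0// mulr_ge0// ltW.
have qE : 16 * k%:R * C / h%:R = 2 * k%:R * q by rewrite /q; ring.
have qk : 2 * k%:R * q <= h%:R / 64 by rewrite -qE.
have iR i : (i <= 2 * k - h)%N -> i%:R <= 2 * k%:R - h%:R :> R.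
  by move=> ik; rewrite -natrM -natrB ?ler_nat//; zlia R.
have iq i : (i <= 2 * k - h)%N -> i%:R * q <= 2 * k%:R * q.
  by move=> /iR ik; rewrite ler_wpM2r//; lra.
have low i : (i <= 2 * k - h)%N -> `|(Z i)%:R + M i - (k%:R - i%:R / 2)| <= i%:R * q ->
    h%:R / 8 <= (Z i)%:R :> R.
  move=> ik; have := Mb i ltac:(zlia R); have := iR i ik; have := iq i ik.
  by rewrite !ler_norml => ? ? /andP[? ?] /andP[? ?]; lra.
have A i : (i <= 2 * k - h)%N -> `|(Z i)%:R + M i - (k%:R - i%:R / 2)| <= i%:R * q.
  elim: i => [|i IH] ik.
    by rewrite Z0 M0 !mul0r subr0 addr0 subrr normr0.
  have {}IH := IH ltac:(zlia R); have Zi := low i ltac:(zlia R) IH.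
  rewrite step; last by zlia R.
  have Zpos : 0 < (Z i)%:R :> R by lra.
  have := mb (Z i); rewrite -(ltr0n R) => /(_ Zpos).
  have : C / (Z i)%:R <= q.
    rewrite ler_pdivrMr// /q mulrAC ler_pdivlMr//.
    have : 8 * C * (h%:R / 8) <= 8 * C * (Z i)%:R by rewrite ler_wpM2l// mulr_ge0// ltW.
    by lra.
  move: IH; rewrite -[i.+1%:R]natr1 !ler_norml => /andP[? ?] ? /andP[? ?].
  by apply/andP; split; lra.
have Alow i : (i <= 2 * k - h)%N -> (k0 <= Z i)%N.
  by move=> ik; have := low i ik (A i ik); rewrite -(ler_nat R); lra.
move=> i ik; split; first exact: Alow.
by rewrite qE; apply: le_trans (A i ik) (iq i ik).
Qed.

(** At time [s = 2 k - h] the gap to the wedge is the value of [M] up to an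
    error [e], so it is at least [5 e]. The drift, of order [1 / 2] above [k0],
    then brings [Z] below [k0 <= e], and the last time [t] below [k0] is at
    least [2 k], where the wedge is 0: the gap there is at most [e].
    All jumps of the gap being at most [e], some intermediate gap is at distance at
    least [e] from both. *)
Lemma trajectory_crosses :
  0 < C -> (0 < k0)%N -> 8 * C <= k0%:R -> k0%:R <= e ->
  (forall v, (0 < v)%N -> `|m v - 1 / 2| <= C / v%:R) ->
  (forall v, `|m v| <= C + 1) ->
  Z 0 = k -> M 0 = 0 ->
  (forall i, (i < 2 * k + h)%N -> (Z i.+1)%:R + M i.+1 = (Z i)%:R + M i - m (Z i)) ->
  (h <= k)%N -> 8 * k0%:R <= h%:R :> R -> 16 * k%:R * C / h%:R <= h%:R / 64 ->
  16 * k%:R * C / h%:R <= e -> 8 * (C + 2) <= h%:R ->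
  (forall i, (i <= 2 * k + h)%N -> `|M i| <= h%:R / 64) ->
  (forall i, (i < 2 * k + h)%N -> `|(Z i)%:R - (Z i.+1)%:R| <= e - 1 / 2) ->
  6 * e <= `|M (2 * k - h)%N| ->
  exists j1 j2 j3 : nat, [/\ (2 * k - h <= j1)%N, (j1 <= j2)%N, (j2 <= j3)%N,
    (j3 <= 2 * k + h)%N &
    e <= `|wedge_gap (k%:R : R) Z j1 - wedge_gap (k%:R : R) Z j2| /\
    e <= `|wedge_gap (k%:R : R) Z j2 - wedge_gap (k%:R : R) Z j3|].
Proof.
move=> C0 k00 k0C k0e mb mB Z0 M0 step hk kh small1 small2 hC Mb jump big.
have k01 : 1 <= k0%:R :> R by rewrite ler1n.
have h0 : 0 < h%:R :> R by lra.
have hN : (0 < h)%N by rewrite -(ltr0n R).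
have hkR : h%:R <= k%:R :> R by rewrite ler_nat.
have mk0 v : (k0 <= v)%N -> 3 / 8 <= m v.
  move=> kv; have := mb v ltac:(zlia R); have vR : (k0%:R : R) <= v%:R by rewrite ler_nat.
  have : C / v%:R <= 1 / 8 by rewrite ler_pdivrMr; lra.
  by move=> Cv; rewrite ler_norml => /andP[? ?]; lra.
have low := trajectory_low C0 k00 mb Z0 M0 step hk kh small1 Mb.
set s := (2 * k - h)%N.
have sR : s%:R = 2 * k%:R - h%:R :> R by rewrite /s natrB ?natrM//; zlia R.
have sA : `|(Z s)%:R + M s - h%:R / 2| <= e /\ `|(Z s)%:R + M s - h%:R / 2| <= h%:R / 64.
  have [_] := low s (leqnn s); rewrite sR.
  have -> : k%:R - (2 * k%:R - h%:R) / 2 = h%:R / 2 :> R by lra.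
  by move=> ?; split; lra.
have Ds : 5 * e <= `|wedge_gap (k%:R : R) Z s|.
  rewrite /wedge_gap (_ : Num.max _ _ = h%:R / 2); last first.
    by rewrite sR max_l; lra.
  move: sA => [+ _]; move: big; rewrite -/s.
  have := ler_normD ((Z s)%:R + M s - h%:R / 2) (- ((Z s)%:R - h%:R / 2)).
  rewrite normrN (_ : _ + - _ = M s); last by ring.
  by lra.
have last i : (s <= i)%N -> exists t, [/\ (s <= t <= i)%N, (t = s) \/ (Z t < k0)%N &
    forall r, (t < r <= i)%N -> (k0 <= Z r)%N].
  elim: i => [|i IH] si; first by exists s; split; [zlia R|left|move=> r; zlia R].
  have [<-|si'] := eqVneq s i.+1; first by exists s; split; [zlia R|left|move=> r; zlia R].
  have [t [t1 t2 t3]] := IH ltac:(zlia R).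
  have [Zi|Zi] := ltnP (Z i.+1) k0.
    by exists i.+1; split; [zlia R|right|move=> r; zlia R].
  exists t; split => //; first by zlia R.
  move=> r rt; have [->//|ri] := eqVneq r i.+1; apply: t3; zlia R.
have [t [t1 t2 t3]] := last (2 * k + h)%N ltac:(zlia R).
(* if [t < 2 k], a drift of at least [3 / 8] acts after [t] during at least
   [h] steps, and makes [Z] negative at time [2 k + h] *)
have [kt|tk] := leqP (2 * k) t; last first.
  exfalso.
  have dec i : (t < i <= 2 * k + h)%N -> (Z i)%:R + M i <=
      (Z t)%:R + M t - m (Z t) - 3 / 8 * (i%:R - t%:R - 1).
    elim: i => [|i IH] ti; first by zlia R.
    rewrite step; last by zlia R.
    have [<-|ti'] := eqVneq t i; first by rewrite -natr1; lra.
    have := IH ltac:(zlia R); have := mk0 _ (t3 i ltac:(zlia R)).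
    by rewrite -natr1; lra.
  have := dec (2 * k + h)%N ltac:(zlia R).
  have := Mb (2 * k + h)%N ltac:(zlia R); have := Mb t ltac:(zlia R).
  have := mB (Z t); have : 0 <= (Z (2 * k + h)%N)%:R :> R by [].
  have tR : t%:R + 1 <= 2 * k%:R :> R by rewrite natr1 -natrM ler_nat.
  rewrite !ler_norml natrD natrM => ? /andP[? ?] /andP[? ?] /andP[? ?] ?.
  case: t2 => [ts|].
    move: sA => [_]; rewrite ler_norml => /andP[? ?]; subst t.
    have := Mb s ltac:(zlia R); rewrite ler_norml => /andP[? ?].
    by lra.
  rewrite -(ltr_nat R) => ?; lra.
have Zt : (Z t < k0)%N by case: t2 => // ts; zlia R.
have Dt : 0 <= wedge_gap (k%:R : R) Z t <= e.
  have tR : 2 * k%:R <= t%:R :> R by rewrite -natrM ler_nat.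
  rewrite /wedge_gap max_r; last by lra.
  rewrite subr0 ler0n /=; apply: le_trans k0e; rewrite ler_nat; zlia R.
have ejump i : (i < 2 * k + h)%N -> `|wedge_gap (k%:R : R) Z i - wedge_gap (k%:R : R) Z i.+1| <= e.
  move=> ik; rewrite /wedge_gap.
  have L : `|Num.max (k%:R - i%:R / 2) 0 - Num.max (k%:R - i.+1%:R / 2) 0| <= 1 / 2 :> R.
    apply: le_trans (wedge_lipschitz _ _) _.
    by rewrite -[i.+1%:R]natr1 ler_norml; apply/andP; split; lra.
  have := jump i ik; move: L; rewrite !ler_norml => /andP[? ?] /andP[? ?].
  by apply/andP; split; lra.
pose P i := (s <= i)%N && (e <= `|wedge_gap (k%:R : R) Z s - wedge_gap (k%:R : R) Z i|).
have e0 : 0 <= e by lra.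
have Pt : P t.
  apply/andP; split; first by zlia R.
  have := ler_normD (wedge_gap (k%:R : R) Z s - wedge_gap (k%:R : R) Z t) (wedge_gap (k%:R : R) Z t).
  move: Dt => /andP[Dt0 Dt1].
  by rewrite subrK (ger0_norm Dt0); lra.
have exP : exists i, P i by exists t.
case: (ex_minnP exP) => j /andP[sj ej] minj.
exists s, j, t; split; [by []|by []|exact: minj|zlia R|split=> //].
have [js|js] := eqVneq s j.
  subst j; have := ler_normD (wedge_gap (k%:R : R) Z s - wedge_gap (k%:R : R) Z t) (wedge_gap (k%:R : R) Z t).
  move: Dt => /andP[Dt0 Dt1].
  by rewrite subrK (ger0_norm Dt0); lra.
have [i ji] : exists i, j = i.+1 by exists j.-1; zlia R.
subst j; have jt := minj t Pt.
have := ejump i ltac:(zlia R).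
have : ~~ P i by apply/negP => /minj; zlia R.
rewrite /P negb_and -ltNge; have -> : (s <= i)%N by zlia R.
move=> /= Pi ej'; move: Dt => /andP[Dt0 Dt1].
have := ler_normD (wedge_gap (k%:R : R) Z s - wedge_gap (k%:R : R) Z i)
  (wedge_gap (k%:R : R) Z i - wedge_gap (k%:R : R) Z i.+1).
rewrite subrKA.
have := ler_normD (wedge_gap (k%:R : R) Z s - wedge_gap (k%:R : R) Z i.+1)
  (wedge_gap (k%:R : R) Z i.+1 - wedge_gap (k%:R : R) Z t).
rewrite subrKA.
have := ler_normD (wedge_gap (k%:R : R) Z s - wedge_gap (k%:R : R) Z t) (wedge_gap (k%:R : R) Z t).
rewrite subrK (ger0_norm Dt0).
by lra.
Qed.
End trajectory.

(** * Probability of a crossing *)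

Definition crosses {R : realFieldType} (k h : nat) (e : R) (z : seq nat) : bool :=
  `[< exists j1 j2 j3 : nat, [/\ (2 * k - h <= j1)%N, (j1 <= j2)%N, (j2 <= j3)%N,
    (j3 <= 2 * k + h)%N &
    e <= `|wedge_gap k%:R (nth 0%N (k :: z)) j1 - wedge_gap k%:R (nth 0%N (k :: z)) j2| /\
    e <= `|wedge_gap k%:R (nth 0%N (k :: z)) j2 - wedge_gap k%:R (nth 0%N (k :: z)) j3| ] >].

Section probability.
Variables (R : realFieldType) (E : expectation_kernel R) (C : R).
Hypothesis C_gt0 : 0 < C.
Hypothesis bias : forall k, (0 < k)%N -> `|drift E k - 1 / 2| <= C / k%:R.
Hypothesis moment4 : forall k, E k (fun l => (k%:R - l%:R) ^+ 4) <= C.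
Local Notation m := (drift E).
Local Notation A := (var_bound C).
Local Notation martingale := (martingale E).

Variables (k h k0 : nat) (e d1 d2 : R).
Let s := (2 * k - h)%N.
Let u := (2 * k + h)%N.
Hypothesis k0_gt0 : (0 < k0)%N.
Hypothesis k0_bias : 8 * C <= k0%:R.
Hypothesis k0_e : k0%:R <= e.
Hypothesis hk : (h <= k)%N.
Hypothesis k0h : 8 * k0%:R <= h%:R :> R.
Hypothesis small1 : 16 * k%:R * C / h%:R <= h%:R / 64.
Hypothesis small2 : 16 * k%:R * C / h%:R <= e.
Hypothesis hC : 8 * (C + 2) <= h%:R.
Hypothesis e_big : 36 * e ^+ 2 <= s%:R / 64.
Hypothesis d1_half : d1 <= 1 / 2.
Hypothesis fail1 : u.+1%:R * (A * u%:R) ^+ 2 * (64 / h%:R) ^+ 4 <= d1.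
Hypothesis fail2 : u%:R * C / (e - 1 / 2) ^+ 4 <= d2.

Let h_gt0 : 0 < h%:R :> R.
Proof.
have k1 : 1 <= k0%:R :> R by rewrite ler1n.
by have := k0h; lra.
Qed.

Definition big_drift (z : seq nat) : bool :=
  [exists i : 'I_u.+1, h%:R / 64 < `|martingale k (take i z)|].
Definition big_jump (z : seq nat) : bool :=
  [exists i : 'I_u, e - 1 / 2 <
    `|(nth 0%N (k :: z) i)%:R - (nth 0%N (k :: z) i.+1)%:R|].
Definition spread (z : seq nat) : bool := 6 * e <= `|martingale k (take s z)|.

(* Markov's inequality for fourth powers, summed over the indices *)
Let sum_event n (F : 'I_n -> R) (a : R) : 0 < a ->
  ([exists i, a < `|F i|]%:R : R) <= \sum_(i < n) a ^- 4 * F i ^+ 4.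
Proof.
move=> a0; have p4 (x : R) : 0 <= x ^+ 4 by rewrite (exprM _ 2 2) sqr_ge0.
have [/existsP[i ai]|_] /= := boolP [exists i, a < `|F i|]; last first.
  by apply: sumr_ge0 => i _; rewrite mulr_ge0// invr_ge0.
rewrite (bigD1 i)//= -[leLHS]addr0 lerD//; last first.
  by apply: sumr_ge0 => j _; rewrite mulr_ge0// invr_ge0.
rewrite mulrC ler_pdivlMr ?exprn_gt0// mul1r.
have -> : F i ^+ 4 = `|F i| ^+ 4 by rewrite -normrX ger0_norm.
by apply: lerXn2r; rewrite ?nnegrE ?normr_ge0 ?(ltW a0) ?(ltW ai).
Qed.

Lemma big_drift_prob : path_exp E u (fun z => (big_drift z)%:R) k <= d1.
Proof.
apply: le_trans fail1.
have a0 : 0 < h%:R / 64 :> R by rewrite divr_gt0.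
apply: le_trans (path_exp_le E k (Psi := fun z =>
  \sum_(i < u.+1) (h%:R / 64) ^- 4 * martingale k (take i z) ^+ 4) _) _.
  by move=> z _; exact: sum_event.
rewrite (@path_exp_sum R E u u.+1 (fun i z => (h%:R / 64) ^- 4 * martingale k (take i z) ^+ 4)).
apply: le_trans (_ : \sum_(i < u.+1) (A * u%:R) ^+ 2 * (64 / h%:R) ^+ 4 <= _); last first.
  rewrite sumr_const card_ord -mulr_natl.
  by rewrite le_eqVlt; apply/orP; left; apply/eqP; ring.
apply: ler_sum => i _; rewrite path_expZ.
have r0 : 0 <= (64 / h%:R) ^+ 4 :> R by apply/exprn_ge0/divr_ge0 => //; exact: ltW.
rewrite -exprVn invf_div mulrC (ler_wpM2r r0)//.
have := martingale_moment4 C_gt0 moment4 u i k 0.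
rewrite expr0n add0r => H.
apply: le_trans (_ : (A * i%:R) ^+ 2 <= _).
  by apply: le_trans H; apply: path_exp_le => z _; rewrite add0r.
have A0 := var_bound_gt0 C_gt0.
apply: lerXn2r; rewrite ?nnegrE ?(mulr_ge0 (ltW A0))//.
by rewrite ler_pM2l// ler_nat -ltnS.
Qed.

Lemma big_jump_prob : path_exp E u (fun z => (big_jump z)%:R) k <= d2.
Proof.
apply: le_trans fail2.
have e1 : 1 <= e by apply: le_trans k0_e; rewrite ler1n.
have a0 : 0 < e - 1 / 2 by lra.
pose F i z : R := (nth 0%N (k :: z) i)%:R - (nth 0%N (k :: z) i.+1)%:R.
apply: le_trans (path_exp_le E k (Psi := fun z =>
  \sum_(i < u) (e - 1 / 2) ^- 4 * F i z ^+ 4) _) _.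
  by move=> z _; exact: (sum_event (fun i => F i z)).
rewrite (@path_exp_sum R E u u (fun i z => (e - 1 / 2) ^- 4 * F i z ^+ 4)).
apply: le_trans (_ : \sum_(i < u) C * (e - 1 / 2) ^- 4 <= _); last first.
  rewrite sumr_const card_ord -mulr_natl.
  by rewrite le_eqVlt; apply/orP; left; apply/eqP; ring.
apply: ler_sum => i _; rewrite path_expZ mulrC ler_wpM2r//.
  by rewrite invr_ge0 exprn_ge0// ltW.
exact: jump_moment4.
Qed.

Let step z : size z = u -> forall i, (i < u)%N ->
  (nth 0%N (k :: z) i.+1)%:R + martingale k (take i.+1 z) =
  (nth 0%N (k :: z) i)%:R + martingale k (take i z) - m (nth 0%N (k :: z) i).
Proof. by move=> zu i iu; apply: martingale_step; rewrite zu. Qed.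

Let nodrift z : ~~ big_drift z -> forall i, (i <= u)%N -> `|martingale k (take i z)| <= h%:R / 64.
Proof.
move=> /existsPn nb i iu; have iu' : (i < u.+1)%N by rewrite ltnS.
by have := nb (Ordinal iu'); rewrite -leNgt.
Qed.

Lemma crosses_event z : size z = u -> spread z -> ~~ big_drift z -> ~~ big_jump z ->
  crosses k h e z.
Proof.
move=> zu sz nd /existsPn nj; apply/asboolP.
apply: (@trajectory_crosses R (nth 0%N (k :: z)) (fun i => martingale k (take i z)) m k h k0 C e) => //.
- by move=> v; exact: drift_bound.
- by rewrite take0.
- exact: step.
- exact: nodrift.
- by move=> i iu; have := nj (Ordinal iu); rewrite -leNgt.
Qed.

Lemma low_count z : size z = u -> ~~ big_drift z ->
  count (fun v => (v < k0)%N) (take s (k :: z)) = 0%N.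
Proof.
move=> zu nd; apply/eqP; rewrite -leqn0 leqNgt -has_count; apply/negP => /hasP[v vz vk].
have /(nthP 0%N)[i] := vz; rewrite size_take /= zu => iz E1.
have isx : (i < s)%N by move: iz; case: ifP; rewrite /s /u; zlia R.
rewrite nth_take// in E1.
have M0 : martingale k (take 0 z) = 0 by rewrite take0.
have [+ _] := @trajectory_low R (nth 0%N (k :: z)) (fun i => martingale k (take i z)) m k h k0 C
  C_gt0 k0_gt0 bias erefl M0 (step zu) hk k0h small1 (nodrift nd) i (ltnW isx).
by rewrite E1 leqNgt vk.
Qed.

(** The Paley-Zygmund inequality for the square of the martingale at time [s]:
    its second moment is of order [s] and its fourth of order [s ^ 2], so its
    absolute value is at least [6 e] with a probability bounded below. What remains is to discard
    the events of small probability excluded in [trajectory_crosses]. *)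
Lemma crosses_prob : ((64 * A) ^+ 2)^-1 - d1 - d2 <=
  path_exp E u (fun z => (crosses k h e z)%:R) k.
Proof.
have A0 := var_bound_gt0 C_gt0.
pose Pr (G : seq nat -> bool) := path_exp E u (fun z => (G z)%:R) k.
have spread_le : Pr spread <= Pr (crosses k h e) + d1 + d2.
  apply: le_trans (lerD (lerD (lexx _) big_drift_prob) big_jump_prob).
  rewrite /Pr -!path_expD; apply: path_exp_le => z zu.
  have [sz|] := boolP (spread z); last by rewrite !addr_ge0.
  have [dz|nd] := boolP (big_drift z); first by rewrite addrAC lerDr addr_ge0.
  have [jz|nj] := boolP (big_jump z); first by rewrite lerDr addr_ge0.
  by rewrite (crosses_event zu sz nd nj) addr0 lerDl.
rewrite -/(Pr (crosses k h e)).
suff : ((64 * A) ^+ 2)^-1 <= Pr spread by lra.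
have su : (s <= u)%N by rewrite /s /u; zlia R.
have hN : (0 < h)%N by rewrite -(ltr0n R).
have s0 : 0 < s%:R :> R by rewrite ltr0n /s; zlia R.
pose M2 := path_exp E u (fun z => martingale k (take s z) ^+ 2) k.
have lowM : s%:R / 32 <= M2.
  have := martingale_moment2 C_gt0 bias k0_bias k0_gt0 k 0 su.
  rewrite expr0n add0r => h2.
  have : path_exp E u (fun z => (0 + martingale k (take s z)) ^+ 2 +
     (count (fun v => (v < k0)%N) (take s (k :: z)))%:R / 16) k <= M2 + s%:R / 16 * d1.
    apply: le_trans (_ : M2 + s%:R / 16 * Pr big_drift <= _); last first.
      by rewrite lerD2l ler_pM2l ?big_drift_prob// divr_gt0.
    rewrite /Pr -path_expZ -path_expD; apply: path_exp_le => z zu.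
    rewrite add0r lerD2l.
    have [dz|nd] := boolP (big_drift z); last by rewrite low_count// mulr0 mul0r.
    rewrite (_ : true%:R = 1)// mulr1 ler_pM2r ?invr_gt0 ?ltr0n// ler_nat.
    by apply: leq_trans (count_size _ _) _; rewrite size_take; case: ifP => //; zlia R.
  have : s%:R / 16 * d1 <= s%:R / 16 * (1 / 2) by rewrite ler_wpM2l// divr_ge0// ltW.
  by lra.
pose M4 := path_exp E u (fun z => martingale k (take s z) ^+ 4) k.
have M4up : M4 <= (A * s%:R) ^+ 2.
  have := martingale_moment4 C_gt0 moment4 u s k 0.
  rewrite expr0n add0r; apply: le_trans.
  by apply: path_exp_le => z _; rewrite add0r.
(* [x ^ 2 <= t x ^ 4 + 1 / (4 t)] is used on the event [spread]; this [t] makes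
   the fourth moment cost half of what is left of the second *)
pose t := (128 * A ^+ 2 * s%:R)^-1.
have A2 : 0 < A ^+ 2 by exact: exprn_gt0.
have t0 : 0 < t by rewrite invr_gt0 (mulr_gt0 _ s0)// (mulr_gt0 _ A2)// ltr0n.
have upM : M2 <= s%:R / 64 + (t * M4 + (4 * t)^-1 * Pr spread).
  rewrite /M2 /M4 /Pr -!path_expZ -path_expD -[_ / 64](path_exp_cst E u _ k) -path_expD.
  apply: path_exp_le => z _; set x := martingale k _.
  have x4 : x ^+ 4 = (x ^+ 2) ^+ 2 by ring.
  have [sz|] := boolP (spread z); last first.
    rewrite /spread -ltNge -/x => xe.
    rewrite mulr0 addr0; apply: le_trans (_ : s%:R / 64 <= _); last first.
      by rewrite lerDl mulr_ge0 ?(ltW t0)// x4 sqr_ge0.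
    apply: le_trans e_big.
    have -> : x ^+ 2 = `|x| ^+ 2 by rewrite real_normK ?num_real.
    have -> : 36 * e ^+ 2 = (6 * e) ^+ 2 by ring.
    by apply: lerXn2r; rewrite ?nnegrE ?(ltW xe)// (le_trans _ (ltW xe)).
  rewrite (_ : true%:R = 1)// mulr1.
  have : 0 <= t * (x ^+ 2 - (2 * t)^-1) ^+ 2 by rewrite mulr_ge0 ?(ltW t0)// sqr_ge0.
  have -> : t * (x ^+ 2 - (2 * t)^-1) ^+ 2 = t * x ^+ 4 - x ^+ 2 + (4 * t)^-1.
    by field; rewrite gt_eqF.
  have : 0 <= s%:R / 64 :> R by rewrite divr_ge0.
  by lra.
have tM : t * M4 <= s%:R / 128.
  apply: le_trans (_ : t * (A * s%:R) ^+ 2 <= _); first by rewrite ler_pM2l.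
  rewrite le_eqVlt; apply/orP; left; apply/eqP.
  by rewrite /t; field; rewrite !gt_eqF.
have : s%:R / 128 <= (4 * t)^-1 * Pr spread by lra.
have -> : (4 * t)^-1 = 32 * A ^+ 2 * s%:R.
  by rewrite /t; field; rewrite !gt_eqF.
have -> : s%:R / 128 = s%:R * (1 / 128) :> R by lra.
have -> : 32 * A ^+ 2 * s%:R * Pr spread = s%:R * (32 * A ^+ 2 * Pr spread) by ring.
rewrite ler_pM2l// => H.
rewrite -[leLHS]mul1r ler_pdivrMr; last by rewrite exprn_gt0// (mulr_gt0 _ A0)// ltr0n.
have -> : Pr spread * (64 * A) ^+ 2 = 128 * (32 * A ^+ 2 * Pr spread) by ring.
lra.
Qed.

End probability.

(** * Choice of the scales *)

Ltac pos := repeat first [assumption | by rewrite ltr0n | apply: divr_gt0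
  | apply: mulr_gt0 | apply: exprn_gt0 | apply: addr_gt0].

Lemma ler_pM3 (R : realFieldType) (a b c a' b' c' : R) :
  0 <= a -> 0 <= b -> 0 <= c -> a <= a' -> b <= b' -> c <= c' ->
  a * b * c <= a' * b' * c'.
Proof. by move=> *; rewrite !ler_pM// mulr_ge0. Qed.

(** The window [h] is a small multiple of [N] and the height [e] a small
    multiple of [sqrt N]. The drift error [16 k C / h] is then [O(1)], and the
    two exceptional events, a martingale of size [h / 64] and a jump of size
    [e - 1 / 2], have probability [O(1 / N)] by fourth moments; so the lower
    bound of [crosses_prob] survives, and it does not depend on [delta]. *)
Lemma chain_crosses (R : realType) (C theta : R) : 0 < C -> 0 < theta ->
  exists kappa pr : R, [/\ 0 < kappa, 0 < pr & forall delta : R, 0 < delta ->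
  exists N0 : nat, forall N k : nat, (N0 <= N)%N ->
    `|k%:R - N%:R * theta| <= 2 ->
  exists h : nat, [/\ (0 < h)%N, (h <= k)%N, h%:R <= delta * N%:R &
  forall E : expectation_kernel R,
  (forall k, (0 < k)%N -> `|drift E k - 1 / 2| <= C / k%:R) ->
  (forall k, E k (fun l => (k%:R - l%:R) ^+ 4) <= C) ->
  pr <= path_exp E (2 * k + h)
    (fun z => (crosses k h (kappa * Num.sqrt N%:R) z)%:R) k]].
Proof.
move=> C0 T0; set T := theta in T0 *.
pose A := var_bound C; have A0 : 0 < A := var_bound_gt0 C0.
have A2 : 0 < A ^+ 2 by exact: exprn_gt0.
have A1 : 1 <= A.
  rewrite /A /var_bound; have : 0 <= (C + 1) ^+ 4 by rewrite exprn_ge0// addr_ge0// ltW.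
  by lra.
have AE : A = var_bound C by [].
clearbody A.
pose K := Num.min 1 T / 100.
have m0 : 0 < Num.min 1 T by rewrite lt_min ltr01.
have m1 : Num.min 1 T <= 1 by rewrite ge_min lexx.
have mT : Num.min 1 T <= T by rewrite ge_min lexx orbT.
have K0 : 0 < K by rewrite divr_gt0.
have K2 : 36 * K ^+ 2 <= T / 128.
  rewrite /K; set a := Num.min 1 T in m0 m1 mT *.
  have -> : (a / 100) ^+ 2 = a * a / 100 / 100 by field.
  have : a * a <= 1 * T by apply: ler_pM => //; exact: ltW.
  lra.
pose d := ((128 * A) ^+ 2)^-1.
have d0 : 0 < d by rewrite /d invr_gt0; apply/exprn_gt0/mulr_gt0; rewrite ?ltr0n.
have d12 : d <= 1 / 2.
  have h2 : 2 <= (128 * A) ^+ 2.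
    by rewrite (le_trans _ (_ : 2 ^+ 1 <= _))// ?expr1//; nra.
  rewrite /d -[_^-1]mul1r ler_pdivrMr; lra.
have dE : ((64 * A) ^+ 2)^-1 - d - d = 2 * d.
  by rewrite /d; field; rewrite gt_eqF.
exists K, (2 * d); split => //; first by rewrite mulr_gt0.
move=> delta dl0.
pose D := Num.min delta (T / 4).
have D0 : 0 < D by rewrite lt_min dl0 divr_gt0.
have Dd : D <= delta by rewrite ge_min lexx.
have DT : D <= T / 4 by rewrite ge_min lexx orbT.
clearbody D K d; clear m0 m1 mT A1 A2.
pose k0 := (Num.truncn (8 * C)).+1.
have k0C : 8 * C <= k0%:R by apply/ltW/truncnS_gt.
have k01 : 1 <= k0%:R :> R by rewrite ler1n.
have k0N : (0 < k0)%N by [].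
clearbody k0.
pose G := 64 * T * C / D.
have G0 : 0 < G by rewrite /G; pos.
pose H1 := 8 * T * (6 * A * T) ^+ 2 * (128 / D) ^+ 4.
have H10 : 0 < H1 by rewrite /H1; pos.
(* thresholds on [N] for the smallness conditions of [crosses_prob] *)
pose q1 := 4 / T. pose q2 := 2 / D. pose q3 := 16 * k0%:R / D.
pose q4 := 128 * G / D. pose q5 := 16 * (C + 2) / D. pose q6 := H1 / d.
pose q7 := 96 * T * C / (K ^+ 4 * d). pose q8 := (k0%:R / K) ^+ 2.
pose q9 := (G / K) ^+ 2.
have C2 : 0 < C + 2 by rewrite addr_gt0.
have k0R : 0 < k0%:R :> R := lt_le_trans ltr01 k01.
have [p1 p2 p3] : [/\ 0 < q1, 0 < q2 & 0 < q3].
  by rewrite /q1 /q2 /q3; split; pos.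
have [p4 p5 p6] : [/\ 0 < q4, 0 < q5 & 0 < q6].
  by rewrite /q4 /q5 /q6; split; pos.
have [p7 p8 p9] : [/\ 0 < q7, 0 < q8 & 0 < q9].
  by rewrite /q7 /q8 /q9; split; pos.
pose qs := [:: q1; q2; q3; q4; q5; q6; q7; q8; q9].
exists (\max_(q <- qs) (Num.truncn q).+1) => N k QN kN.
have nQ q : q \in qs -> q <= N%:R.
  move=> qq; apply: le_trans (ltW (truncnS_gt q)) _; rewrite ler_nat.
  exact: leq_trans (leq_bigmax_seq _ qq _) QN.
set n : R := N%:R in nQ kN *.
have [r1 r2 r3] : [/\ q1 <= n, q2 <= n & q3 <= n].
  by split; apply: nQ; rewrite /qs !inE eqxx ?orbT.
have [r4 r5 r6] : [/\ q4 <= n, q5 <= n & q6 <= n].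
  by split; apply: nQ; rewrite /qs !inE eqxx ?orbT.
have [r7 r8 r9] : [/\ q7 <= n, q8 <= n & q9 <= n].
  by split; apply: nQ; rewrite /qs !inE eqxx ?orbT.
clear nQ QN qs.
have n0 : 0 < n := lt_le_trans p1 r1.
pose S := Num.sqrt n; have S0 : 0 <= S by exact: sqrtr_ge0.
have S2 : S ^+ 2 = n by rewrite sqr_sqrtr// ltW.
have Sx x : 0 <= x -> x ^+ 2 <= n -> x <= S.
  by move=> x0; rewrite -S2 ler_pXn2r.
rewrite -/S.
rewrite /q1 ler_pdivrMr// in r1. rewrite /q2 ler_pdivrMr// in r2.
rewrite /q3 ler_pdivrMr// in r3. rewrite /q4 ler_pdivrMr// in r4.
rewrite /q5 ler_pdivrMr// in r5. rewrite /q6 ler_pdivrMr// in r6.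
rewrite /q7 ler_pdivrMr ?mulr_gt0 ?exprn_gt0// in r7.
clear p1 p2 p3 p4 p5 p6 p7 p8 p9.
have {r8}r8 : k0%:R <= K * S.
  by rewrite mulrC -ler_pdivrMr//; apply: Sx => //; rewrite divr_ge0// ltW.
have {r9}r9 : G <= K * S.
  by rewrite mulrC -ler_pdivrMr//; apply: Sx => //; rewrite divr_ge0// ltW.
clear Sx q1 q2 q3 q4 q5 q6 q7 q8 q9 dl0.
move: kN; rewrite ler_norml => /andP[kl ku].
have kge : T * n / 2 <= k%:R by lra.
have kle : k%:R <= 2 * T * n by lra.
have Dn0 : 0 <= D * n by rewrite mulr_ge0// ltW.
pose h := Num.truncn (D * n).
have hle : h%:R <= D * n by rewrite truncn_le.
have hge : D * n / 2 <= h%:R.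
  by have := truncnS_gt (D * n); rewrite -natr1 -/h; lra.
have hk : (h <= k)%N by rewrite -(ler_nat R); nra.
have h0 : 0 < h%:R :> R by lra.
exists h; split => //.
- by rewrite -(ltr0n R).
- by apply: le_trans hle _; rewrite ler_pM2r.
move=> E bias m4; rewrite -dE AE.
have Tn0 : 0 < T * n by rewrite mulr_gt0.
have k0' : 0 < k%:R :> R by lra.
have kh : 16 * k%:R * C / h%:R <= G.
  rewrite ler_pdivrMr// /G.
  apply: le_trans (_ : 64 * T * C / D * (D * n / 2) <= _); last first.
    by rewrite ler_pM2l.
  have -> : 64 * T * C / D * (D * n / 2) = (2 * T * n) * (16 * C).
    by field; rewrite gt_eqF.
  by rewrite mulrAC [leLHS]mulrC ler_pM2r ?mulr_gt0.
have uR : (2 * k + h)%N%:R = 2 * k%:R + h%:R :> R by rewrite natrD natrM.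
have sR : (2 * k - h)%N%:R = 2 * k%:R - h%:R :> R by rewrite natrB ?natrM//; zlia R.
have hkR : h%:R <= k%:R :> R by rewrite ler_nat.
apply: (@crosses_prob R E C C0 bias m4 k h k0 _ d d) => //.
- by lra.
- by lra.
- by apply: le_trans kh r9.
- by lra.
- rewrite exprMn S2 sR.
  have : 36 * K ^+ 2 * n <= T / 128 * n by rewrite ler_pM2r.
  by lra.
- rewrite -AE -[(2 * k + h).+1%:R]natr1 uR.
  apply: le_trans (_ : 8 * T * n * (6 * A * T * n) ^+ 2 * (128 / (D * n)) ^+ 4 <= _).
    have c0 : 2 * k%:R + h%:R <= 6 * (T * n) by lra.
    have c1 : 0 <= 2 * k%:R + h%:R :> R by rewrite -uR.
    have c2 : 0 <= 64 / h%:R :> R by rewrite divr_ge0.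
    have c3 : A * (2 * k%:R + h%:R) <= 6 * A * T * n.
      have -> : 6 * A * T * n = A * (6 * (T * n)) by ring.
      by rewrite ler_pM2l.
    have c4 : 64 / h%:R <= 128 / (D * n).
      by rewrite ler_pdivrMr// mulrAC ler_pdivlMr ?mulr_gt0//; lra.
    have c5 : 0 <= A * (2 * k%:R + h%:R) by exact: mulr_ge0 (ltW A0) c1.
    apply: ler_pM3.
    - by rewrite addr_ge0.
    - exact: exprn_ge0.
    - exact: exprn_ge0.
    - by lra.
    - by apply: lerXn2r => //; rewrite nnegrE// (le_trans c5).
    - by apply: lerXn2r => //; rewrite nnegrE// (le_trans c2).
  have -> : 8 * T * n * (6 * A * T * n) ^+ 2 * (128 / (D * n)) ^+ 4 = H1 / n.
    by rewrite /H1; field; rewrite !gt_eqF.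
  by rewrite ler_pdivrMr// mulrC.
- rewrite uR ler_pdivrMr; last by rewrite exprn_gt0//; lra.
  apply: le_trans (_ : d * (K * S / 2) ^+ 4 <= _); last first.
    have kS : K * S / 2 <= K * S - 1 / 2 by clear - r8 k01; lra.
    have kS0 : 0 <= K * S / 2 by clear - r8 k01; lra.
    by rewrite ler_pM2l//; apply: lerXn2r; rewrite ?nnegrE// (le_trans kS0).
  have -> : d * (K * S / 2) ^+ 4 = (S ^+ 2) ^+ 2 * (K ^+ 4 * d) / 16 by field.
  rewrite S2 ler_pdivlMr//.
  have : 96 * T * C * n <= n * (K ^+ 4 * d) * n by rewrite ler_pM2r.
  have : (2 * k%:R + h%:R) * C <= 6 * T * n * C by rewrite ler_pM2r//; lra.
  lra.
Qed.

(** * The chain of successive counts *)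

Section walk_kernel.
Variables (R : realFieldType) (w : int -> R).
Hypothesis w_gt0 : forall k, 0 < w k.
Variable B : nat.
Local Notation p := (trunc_prob w B).

(** Law of the number of plus steps from a site at its [k]-th minus step: the
    imbalance [e] is then [k] minus this number. *)
Definition stack_law (k : nat) (f : nat -> R) : R :=
  kern_iter p B k (fun e => f `|k%:Z - e|%N) 0.

Lemma stack_law_linear k a f g :
  stack_law k (fun l => a * f l + g l) = a * stack_law k f + stack_law k g.
Proof.
apply: (kern_iter_linear (trunc_ge0 w_gt0 B) (trunc_le1 w_gt0 B) (@trunc_low _ w B)).
Qed.

Lemma stack_law_le k f g : (forall l, f l <= g l) -> stack_law k f <= stack_law k g.
Proof.
move=> fg; apply: (kern_iter_homo (trunc_ge0 w_gt0 B) (trunc_le1 w_gt0 B) (@trunc_low _ w B)).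
by move=> e.
Qed.

Lemma stack_law_cst k c : stack_law k (fun=> c) = c.
Proof.
apply: (kern_iter_cst (trunc_ge0 w_gt0 B) (trunc_le1 w_gt0 B) (@trunc_low _ w B)).
Qed.

Definition stack_kernel := ExpectationKernel stack_law_linear stack_law_le stack_law_cst.

(** After [k] minus steps the imbalance is at most [k], so the absolute value in
    [stack_law] is that of a nonnegative number. *)
Lemma stack_law_shift k (f : R -> R) :
  stack_law k (fun l => f (k%:R - l%:R)) = kern_iter p B k (fun e => f e%:~R) 0.
Proof.
apply: kern_iter_support; first exact: trunc_low.
move=> e; rewrite add0r => ek; congr f.
by rewrite natr_absz ger0_norm ?subr_ge0// intrD mulrNz subKr.
Qed.
End walk_kernel.

Lemma stack_chain_crosses (R : realType) (w : int -> R) (theta : R) :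
  forall (w_gt0 : forall k, 0 < w k), {homo w : i j / i <= j} ->
  (exists i j : int, w i <> w j) -> 0 < theta ->
  exists kappa pr : R, [/\ 0 < kappa, 0 < pr & forall delta : R, 0 < delta ->
  exists N0 : nat, forall N k : nat, (N0 <= N)%N ->
    `|k%:R - N%:R * theta| <= 2 ->
  exists h : nat, [/\ (0 < h)%N, (h <= k)%N, h%:R <= delta * N%:R &
  forall B : nat, (N0 <= B)%N ->
  pr <= path_exp (stack_kernel w_gt0 B) (2 * k + h)
    (fun z => (crosses k h (kappa * Num.sqrt N%:R) z)%:R) k]].
Proof.
move=> w0 wh wn T0.
have [C [D [C0 kb]]] := kernel_bounds w0 wh wn.
have [kappa [pr [kappa0 pr0 H]]] := chain_crosses C0 T0.
exists kappa, pr; split => // delta delta0.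
have [N0 {}H] := H delta delta0.
exists (maxn N0 D.+1) => N k NN kN.
have [|h [h0 hk hd {}H]] := H N k _ kN; first by rewrite (leq_trans (leq_maxl _ _) NN).
exists h; split => // B BB; have [kb1 kb2] := kb B (leq_trans (leq_maxr _ _) BB).
apply: H => [j j0|j].
  have -> : drift (stack_kernel w0 B) j = mean_iter (trunc_prob w B) B j 0.
    exact: (stack_law_shift w B j id).
  exact: kb1.
have -> : stack_kernel w0 B j (fun l => (j%:R - l%:R) ^+ 4) =
    kern_iter (trunc_prob w B) B j (fun e => e%:~R ^+ 4) 0.
  exact: (stack_law_shift w B j (fun x => x ^+ 4)).
exact: kb2.
Qed.

(** * Stacks of departures *)

Definition bstep (b : bool) : int := if b then 1 else -1.

Fixpoint endpoint (x : int) (s : seq bool) : int :=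
  if s is b :: s' then endpoint (x + bstep b) s' else x.

(** The successive departures from the site [i] of the path that starts at [x]
    and takes the steps [s]. Plus steps are coded by [true]. *)
Fixpoint stack (x : int) (s : seq bool) (i : int) : seq bool :=
  if s is b :: s' then
    (if x == i then [:: b] else [::]) ++ stack (x + bstep b) s' i
  else [::].

Definition imbalance (t : seq bool) : int :=
  (count negb t)%:Z - (count id t)%:Z.

Lemma endpoint_cat x s t : endpoint x (s ++ t) = endpoint (endpoint x s) t.
Proof. by elim: s x => //= b s IH x. Qed.

Lemma stack_cat x s t i : stack x (s ++ t) i = stack x s i ++ stack (endpoint x s) t i.
Proof. by elim: s x => //= b s IH x; rewrite IH catA. Qed.

Lemma endpoint_rcons x s b : endpoint x (rcons s b) = endpoint x s + bstep b.
Proof. by rewrite -cats1 endpoint_cat. Qed.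

Lemma stack_rcons x s b i : stack x (rcons s b) i =
  stack x s i ++ (if endpoint x s == i then [:: b] else [::]).
Proof. by rewrite -cats1 stack_cat /= cats0. Qed.

Lemma imbalance_size t : (`|imbalance t| <= size t)%N.
Proof.
rewrite /imbalance -(count_predC negb t).
by rewrite (eq_count (a1 := predC negb) (a2 := id)); [lia|case].
Qed.

Lemma size_stack x s i : (size (stack x s i) <= size s)%N.
Proof.
elim: s x => //= b s IH x; rewrite size_cat; have := IH (x + bstep b).
by case: (x == i) => /=; lia.
Qed.

(** The net number of crossings of the edge from [i] to [i + 1] tells on which
    side of it a path from 0 ends. *)
Lemma flux s i : 0 <= i ->
  (count id (stack 0 s i))%:Z - (count negb (stack 0 s (i + 1)))%:Z =
  ((i + 1 <= endpoint 0 s)%R : nat)%:Z.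
Proof.
move=> i0; elim/last_ind: s => [|s b IH]; first by rewrite /=; case: leP => //; lia.
rewrite !stack_rcons !count_cat endpoint_rcons; move: IH.
set x := endpoint 0 s; case: (eqVneq x i) => [xi|xi]; case: (eqVneq x (i + 1)) => [xi'|xi'];
  case: b => /=; rewrite /bstep; do 2 case: leP; lia.
Qed.

Lemma last_departure s i b0 : endpoint 0 s < i ->
  stack 0 s i = [::] \/ last b0 (stack 0 s i) = false.
Proof.
elim/last_ind: s => [|s b IH]; first by left.
rewrite stack_rcons endpoint_rcons.
case: eqVneq => [->|xi].
  by case: b => /=; rewrite /bstep => h; [lia|right; rewrite last_cat].
rewrite cats0 => h; apply: IH; move: h; rewrite /bstep; case: b; lia.
Qed.

(** [t] has an initial segment that ends right at its [k]-th minus step and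
    contains [l] plus steps. *)
Definition consumed (k l : nat) (t : seq bool) : Prop :=
  exists t1 t2, [/\ t = t1 ++ t2, count negb t1 = k, count id t1 = l &
    t1 = [::] \/ last true t1 = false].

Section value.
Variables (R : realFieldType) (w : int -> R).
Hypothesis w_gt0 : forall k, 0 < w k.
Variable B : nat.
Local Notation p := (trunc_prob w B).
Let p_ge0 := trunc_ge0 w_gt0 B.
Let p_le1 := trunc_le1 w_gt0 B.
Let p_low := @trunc_low _ w B.

(** Conditional expectation of [f] at the imbalance of a site after [k] more
    minus steps, when its next departures are known to be [t] and the later ones
    are random. *)
Fixpoint resume (k : nat) (e : int) (t : seq bool) (f : int -> R) {struct t} : R :=
  if k is k'.+1 then
    match t with
    | [::] => kern_iter p B k f e
    | true :: t' => resume k (e - 1) t' f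
    | false :: t' => resume k' (e + 1) t' f
    end
  else f e.

Lemma resume_nil k e f : resume k e [::] f = kern_iter p B k f e.
Proof. by case: k. Qed.

(** Revealing one more departure is one step of the recursion [kernE], and has
    no effect when [t] already contains the [k] minus steps. *)
Lemma resume_average k e t f :
  resume k e t f = (1 - p (e + imbalance t)) * resume k e (t ++ [:: false]) f +
                   p (e + imbalance t) * resume k e (t ++ [:: true]) f.
Proof.
elim: t k e => [|b t IH] k e.
  have -> : e + imbalance [::] = e by rewrite /imbalance subrr addr0.
  case: k => [|k]; first by rewrite /=; ring.
  have -> : resume k.+1 e ([::] ++ [:: false]) f = kern_iter p B k f (e + 1).
    exact: resume_nil.
  exact: (kern_iterE p_low).
case: k => [|k] /=; first by ring.
case: b.
  have -> : e + imbalance (true :: t) = e - 1 + imbalance t.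
    by rewrite /imbalance /=; lia.
  exact: IH.
have -> : e + imbalance (false :: t) = e + 1 + imbalance t.
  by rewrite /imbalance /=; lia.
exact: IH.
Qed.

Lemma resume_linear k e t a f g :
  resume k e t (fun x => a * f x + g x) = a * resume k e t f + resume k e t g.
Proof.
elim: t k e => [|[] t IH] [|k] e //=.
exact: (kern_iter_linear p_ge0 p_le1 p_low k.+1).
Qed.

Lemma resume_le k e t f g : (forall x, f x <= g x) -> resume k e t f <= resume k e t g.
Proof.
move=> fg; elim: t k e => [|[] t IH] [|k] e //=.
exact: (kern_iter_homo p_ge0 p_le1 p_low k.+1).
Qed.

Lemma resume_ext k e t f g : f =1 g -> resume k e t f = resume k e t g.
Proof. by move=> fg; apply/eqP; rewrite eq_le !resume_le// => x; rewrite fg. Qed.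

Lemma resume_cst k e t c : resume k e t (fun=> c) = c.
Proof.
elim: t k e => [|[] t IH] [|k] e //=.
exact: (kern_iter_cst p_ge0 p_le1 p_low k.+1).
Qed.

Lemma resume_consumed k l e t f : consumed k l t ->
  resume k e t f = f (e + k%:Z - l%:Z).
Proof.
move=> [t1 [t2 [-> <- <-]]] {t k l}.
elim: t1 e => [|b t1 IH] e.
  by move=> _; case: t2 => [|b t2] /=; congr f; lia.
move=> [//|/= lt].
have nz : b -> (0 < count negb t1)%N.
  move=> bT; case: t1 lt {IH} => [|c t1] /=; first by rewrite bT.
  by move=> lt; rewrite -/(count negb (c :: t1)) -has_count; apply/hasP;
    exists (last c t1); rewrite ?mem_last//= lt.
have lt' : t1 = [::] \/ last true t1 = false.
  by case: t1 lt {IH nz} => [|c t1] /=; [left|right].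
case: b lt nz => lt nz /=.
  have := nz isT; case E : (count negb t1) => [//|c] _.
  by rewrite add0n -E (IH (e - 1) lt'); congr f; lia.
by rewrite add1n (IH (e + 1) lt'); congr f; lia.
Qed.

(** Conditional expectation of [Phi] along the chain that starts at [k] and
    explores the sites one after the other, given the initial segments [st] of
    their stacks: if the site [j] is stopped at its [Z_j]-th minus step, then
    [Z_(j+1)] is the number of its plus steps. *)
Fixpoint stack_value (J : nat) (Phi : seq nat -> R) (k : nat) (st : nat -> seq bool) : R :=
  if J is J'.+1 then
    resume k 0 (st 0%N) (fun e => stack_value J' (fun z => Phi (`|k%:Z - e|%N :: z))
      `|k%:Z - e|%N (fun j => st j.+1))
  else Phi [::].

Lemma stack_value_nil J Phi k : stack_value J Phi k (fun=> [::]) =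
  path_exp (stack_kernel w_gt0 B) J Phi k.
Proof.
elim: J Phi k => [//|J IH] Phi k.
transitivity (kern_iter p B k (fun e => stack_value J (fun z => Phi (`|k%:Z - e|%N :: z))
  `|k%:Z - e|%N (fun=> [::])) 0); first exact: resume_nil.
by apply: kern_iter_ext => // e; exact: IH.
Qed.

Lemma stack_value_ge0 J Phi k st : (forall z, 0 <= Phi z) -> 0 <= stack_value J Phi k st.
Proof.
elim: J Phi k st => [|J IH] Phi k st Phi0; first exact: Phi0.
apply: le_trans (_ : resume k 0 (st 0%N) (fun=> 0) <= _); first by rewrite resume_cst.
by apply: resume_le => e; apply: IH.
Qed.

(** The effect on the stacks of the sites [a], [a + 1], and so on, of one step
    [b] from the site [x]. *)
Definition push_step (x a : int) (b : bool) (st : nat -> seq bool) (j : nat) : seq bool :=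
  st j ++ (if x == a + j%:Z then [:: b] else [::]).

Lemma push_step_shift x a b st :
  (fun j => push_step x a b st j.+1) = push_step x (a + 1) b (fun j => st j.+1).
Proof.
by apply/funext => j; rewrite /push_step (_ : a + 1 + j%:Z = a + j.+1%:Z)//; lia.
Qed.

Lemma push_step_miss x a b st : x < a -> push_step x a b st = st.
Proof.
move=> xa; apply/funext => j; rewrite /push_step; case: eqP => [|_]; last by rewrite cats0.
lia.
Qed.

(** The martingale property along the walk: a step changes the stack of its
    starting point [x] only, and there [resume_average] applies. *)
Lemma stack_value_average J Phi k st x a e :
  (forall j : nat, x = a + j%:Z -> imbalance (st j) = e) ->
  stack_value J Phi k st = (1 - p e) * stack_value J Phi k (push_step x a false st) +
                   p e * stack_value J Phi k (push_step x a true st).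
Proof.
elim: J Phi k st a => [|J IH] Phi k st a xe; first by rewrite /=; ring.
rewrite ![stack_value J.+1 _ _ _]/= !push_step_shift.
case: (eqVneq x a) => [xa|xa].
  have e0 : imbalance (st 0%N) = e by apply: xe; rewrite addr0.
  rewrite !(push_step_miss (a := a + 1)) /push_step ?addr0 ?xa ?eqxx; [|lia..].
  by rewrite resume_average add0r e0.
have pu b : push_step x a b st 0 = st 0%N.
  by rewrite /push_step addr0 (negbTE xa) cats0.
pose F b f := stack_value J (fun z => Phi (`|k%:Z - f|%N :: z)) `|k%:Z - f|%N
  (push_step x (a + 1) b (fun j => st j.+1)).
rewrite !pu -/(F false) -/(F true).
have -> : p e * resume k 0 (st 0%N) (F true) =
    resume k 0 (st 0%N) (fun y => p e * F true y + 0).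
  by rewrite resume_linear resume_cst addr0.
rewrite -resume_linear; apply: resume_ext => y.
rewrite addr0; apply: IH => j xj; apply: xe; lia.
Qed.
End value.

(** * Probabilities of finite paths *)

Fixpoint bitseqs (n : nat) : seq (seq bool) :=
  if n is n'.+1 then flatten [seq [:: rcons s true; rcons s false] | s <- bitseqs n']
  else [:: [::]].

Lemma size_bitseqs n s : s \in bitseqs n -> size s = n.
Proof.
elim: n s => [|n IH] s /=; first by rewrite inE => /eqP->.
move=> /flattenP[l /mapP[t /IH tn ->]]; rewrite !inE => /orP[] /eqP->;
by rewrite size_rcons tn.
Qed.

Section path_prob.
Variables (R : realFieldType) (w : int -> R).
Hypothesis w_gt0 : forall k, 0 < w k.

Definition step_weight (e : int) (b : bool) : R :=
  if b then plus_prob w e else 1 - plus_prob w e.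

(** The law of a step depends on all the previous ones, so the recursion is on
    the last step and the path is read backwards. *)
Fixpoint rev_path_prob (r : seq bool) : R :=
  if r is b :: r' then rev_path_prob r' *
    step_weight (imbalance (stack 0 (rev r') (endpoint 0 (rev r')))) b
  else 1.

Definition path_prob (s : seq bool) : R := rev_path_prob (rev s).

Lemma path_prob_rcons s b : path_prob (rcons s b) =
  path_prob s * step_weight (imbalance (stack 0 s (endpoint 0 s))) b.
Proof. by rewrite /path_prob rev_rcons /= revK. Qed.

Lemma path_prob_ge0 s : 0 <= path_prob s.
Proof.
elim/last_ind: s => [|s b IH]; first by rewrite /path_prob.
rewrite path_prob_rcons mulr_ge0// /step_weight; case: b.
  exact/ltW/plus_prob_gt0.
by rewrite subr_ge0; apply/ltW/plus_prob_lt1.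
Qed.

(** [stack_value] is a martingale along the walk; its mean is its value before
    the first step, when nothing is known about the stacks. *)
Lemma sum_path_prob_value (B n J : nat) (a : int) (Phi : seq nat -> R) k :
  (n <= B)%N ->
  \sum_(s <- bitseqs n) path_prob s * stack_value w B J Phi k (fun j => stack 0 s (a + j%:Z)) =
  path_exp (stack_kernel w_gt0 B) J Phi k.
Proof.
elim: n => [|n IH] nB.
  by rewrite big_seq1 /path_prob /= mul1r -(stack_value_nil w_gt0).
rewrite -IH ?(ltnW nB)//= big_flatten big_map !big_seq.
apply: eq_bigr => s /size_bitseqs sn; rewrite !big_cons big_nil /= addr0.
rewrite !path_prob_rcons /step_weight.
set x := endpoint 0 s; set e := imbalance _; set st := fun j : nat => stack 0 s (a + j%:Z).
have pushE b : (fun j : nat => stack 0 (rcons s b) (a + j%:Z)) = push_step x a b st.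
  by apply/funext => j; rewrite stack_rcons.
rewrite !pushE (stack_value_average w_gt0 B J Phi k (x := x) (a := a) (e := e) (st := st)); last first.
  by move=> j xj; rewrite /st -xj.
have -> : trunc_prob w B e = plus_prob w e.
  have B0 : (0 < B)%N by lia.
  have eB : (`|e| < B)%N.
    apply: leq_ltn_trans (imbalance_size _) _; apply: leq_ltn_trans (size_stack _ _ _) _.
    by rewrite sn.
  by rewrite trunc_mid//; move: eB; clear; lia.
ring.
Qed.

Lemma sum_path_prob n : \sum_(s <- bitseqs n) path_prob s = 1.
Proof.
rewrite -[RHS](@sum_path_prob_value n n 0 0 (fun=> 1) 0 (leqnn n)).
by apply: eq_bigr => s _; rewrite mulr1.
Qed.

Lemma stack_value_consumed B J Phi (Z : nat -> nat) st :
  (forall j, (j < J)%N -> consumed (Z j) (Z j.+1) (st j)) ->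
  stack_value w B J Phi (Z 0%N) st = Phi [seq Z j.+1 | j <- iota 0 J].
Proof.
elim: J Phi Z st => [//|J IH] Phi Z st cZ /=.
rewrite (resume_consumed w B _ _ (cZ 0%N isT)) add0r.
have -> : `|((Z 0%N)%:Z - ((Z 0%N)%:Z - (Z 1%N)%:Z))%R|%N = Z 1%N by lia.
rewrite (IH (fun z => Phi (Z 1%N :: z)) (fun j => Z j.+1)); last first.
  by move=> j jJ; apply: cZ.
by congr (Phi (_ :: _)); rewrite (iotaDl 1 0) -map_comp.
Qed.

(** On a path whose stacks have been explored completely, [stack_value] is the
    actual value of [Phi]. *)
Lemma sum_path_prob_le (n J k : nat) (a : int) (Phi : seq nat -> R) (Q : pred (seq bool)) :
  (forall z, 0 <= Phi z) ->
  (forall s, size s = n -> Q s -> exists Z : nat -> nat, [/\ Z 0%N = k,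
     forall j, (j < J)%N -> consumed (Z j) (Z j.+1) (stack 0 s (a + j%:Z)) &
     1 <= Phi [seq Z j.+1 | j <- iota 0 J]]) ->
  forall B, (n <= B)%N ->
  \sum_(s <- bitseqs n | Q s) path_prob s <= path_exp (stack_kernel w_gt0 B) J Phi k.
Proof.
move=> Phi0 QZ B nB; rewrite -(sum_path_prob_value J a Phi k nB) big_mkcond/=.
rewrite !big_seq; apply: ler_sum => s /size_bitseqs sn.
case: ifPn => [Qs|_]; last first.
  by rewrite mulr_ge0 ?path_prob_ge0// stack_value_ge0.
have [Z [Zk cZ PZ]] := QZ s sn Qs.
by rewrite -Zk stack_value_consumed// -[leLHS]mulr1 ler_wpM2l// path_prob_ge0.
Qed.
End path_prob.

(** * Local times at the hitting time *)

Definition path_of (s : seq bool) (m : nat) : int := endpoint 0 (take m s).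

Definition is_plus (sg : sign) : bool := if sg is Plus then true else false.

Lemma ell0 sg x i : ell sg x 0 i = 0%N.
Proof. by rewrite /ell eq_card0// => -[]. Qed.

Lemma ellS sg x n i :
  ell sg x n.+1 i = (ell sg x n i + ((x n == i) && (x n.+1 == i + sgn_int sg)%R))%N.
Proof.
rewrite /ell -!sum1_card !big_mkcond big_ord_recr/=; congr addn.
by rewrite [RHS]big_mkcond; apply: eq_bigr.
Qed.

Lemma ell_ext sg (x y : nat -> int) n i : (forall m, (m <= n)%N -> x m = y m) ->
  ell sg x n i = ell sg y n i.
Proof.
elim: n => [|n IH] xy; first by rewrite !ell0.
by rewrite !ellS IH ?xy// => m mn; apply: xy; exact: leqW.
Qed.

Lemma path_ofS s m : (m < size s)%N ->
  path_of s m.+1 = path_of s m + bstep (nth false s m).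
Proof. by move=> ms; rewrite /path_of (take_nth false)// endpoint_rcons. Qed.

Lemma ell_path sg s n i : (n <= size s)%N ->
  ell sg (path_of s) n i = count (pred1 (is_plus sg)) (stack 0 (take n s) i).
Proof.
elim: n => [|n IH] ns; first by rewrite ell0 take0.
rewrite ellS (take_nth false)// stack_rcons count_cat IH ?(ltnW ns)//.
rewrite path_ofS// -/(path_of s n); congr addn.
case: eqP => [->|_] //=; rewrite addn0 (inj_eq (addrI _)); by case: (nth _ _ _); case: (sg).
Qed.

Lemma hit_timeP sg x n i : (exists m, ell sg x m i = n) ->
  ell sg x (hit_time sg x n i) i = n /\
  forall m, ell sg x m i = n -> (hit_time sg x n i <= m)%N.
Proof.
move=> [m mn]; rewrite /hit_time; case: pselect => [h|]; last by case; exists m; apply/eqP.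
by case: ex_minnP => k /eqP kn kmin; split => // j /eqP; exact: kmin.
Qed.

Lemma ell_plus s n i : (n <= size s)%N ->
  ell Plus (path_of s) n i = count id (stack 0 (take n s) i).
Proof. by move=> ns; rewrite ell_path//; apply: eq_count => -[]. Qed.

Lemma ell_minus s n i : (n <= size s)%N ->
  ell Minus (path_of s) n i = count negb (stack 0 (take n s) i).
Proof. by move=> ns; rewrite ell_path//; apply: eq_count => -[]. Qed.

(** The first site to explore to the right of [i0], and the number of its minus
    steps at the hitting time. For [Minus] these are [i0] and the prescribed
    level. For [Plus] the walk has just jumped to [i0 + 1], which it had left
    for [i0] one time less than it arrived from there. *)
Definition start_site (iota : sign) (i0 : nat) : int :=
  if iota is Plus then i0%:Z + 1 else i0%:Z.
Definition start_level (iota : sign) (n0 : nat) : nat :=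
  if iota is Plus then n0.-1 else n0.

(** At the hitting time the walk is at the first explored site or next to it on
    the left, so by [flux] the edge between two neighbouring sites has been
    crossed equally often in both directions, and by [last_departure] each site
    was last left by a minus step. Hence each stack has been consumed up to the minus step
    prescribed by its left neighbour. *)
Lemma hit_consumed iota (i0 n0 : nat) s : (0 < n0)%N ->
  (exists2 m, (m <= size s)%N & ell iota (path_of s) m i0%:Z = n0) ->
  let T := hit_time iota (path_of s) n0 i0%:Z in
  let a := start_site iota i0 in
  let Z j := ell Minus (path_of s) T (a + j%:Z) in
  [/\ (T <= size s)%N, Z 0%N = start_level iota n0 &
    forall j, Z j.+1 = ell Plus (path_of s) T (a + j%:Z) /\
      consumed (Z j) (Z j.+1) (stack 0 s (a + j%:Z))].
Proof.
move=> n00 [m ms mn] T a Z.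
have [Tn Tmin] := @hit_timeP iota (path_of s) n0 i0%:Z (ex_intro _ m mn).
rewrite -/T in Tn Tmin.
have Ts : (T <= size s)%N := leq_trans (Tmin m mn) ms.
have T0 : (0 < T)%N.
  by rewrite lt0n; apply/eqP => T0; move: Tn n00; rewrite T0 ell0 => <-.
have [t Tt] : exists t, T = t.+1 by exists T.-1; rewrite prednK.
have ts : (t < size s)%N by rewrite -Tt.
have /andP[/eqP ti /eqP tb] : (path_of s t == i0%:Z) && (path_of s t.+1 == i0%:Z + sgn_int iota).
  apply/negPn/negP => /negbTE nh.
  have : ell iota (path_of s) t i0%:Z = n0 by rewrite -Tn Tt ellS nh addn0.
  by move=> /Tmin; rewrite Tt ltnn.
pose s' := take t s; pose b := nth false s t.
have sE : take T s = rcons s' b by rewrite Tt (take_nth false).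
have es' : endpoint 0 s' = i0%:Z by [].
have bE : b = is_plus iota.
  move: tb; rewrite path_ofS// ti => /addrI; rewrite -/b /bstep.
  by case: (b); case: (iota).
have eT : endpoint 0 (take T s) = i0%:Z + sgn_int iota.
  by rewrite sE endpoint_rcons es' bE; case: (iota).
have ai0 : i0%:Z <= a by rewrite /a /start_site; case: (iota); lia.
have aT (j : nat) : endpoint 0 (take T s) < a + j%:Z + 1.
  by rewrite eT /a /start_site; case: (iota) => /=; lia.
have ZS j : Z j.+1 = ell Plus (path_of s) T (a + j%:Z).
  rewrite /Z ell_plus// ell_minus//.
  have := @flux (take T s) (a + j%:Z) ltac:(lia).
  have /negbTE -> : ~~ (a + j%:Z + 1 <= endpoint 0 (take T s)) by rewrite -ltNge.
  have -> : a + j.+1%:Z = a + j%:Z + 1 by lia.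
  by move/eqP; rewrite subr_eq0 => /eqP[->].
split => //.
  rewrite /Z addr0 /a /start_site /start_level.
  case: (iota) Tn eT => /= Tn eT; last by [].
  move: Tn; rewrite ell_plus// ell_minus// => Tn.
  have := @flux (take T s) i0%:Z ltac:(lia); rewrite eT lexx Tn /=.
  by set c := count negb _; move: n00; clear; lia.
move=> j; split; first exact: ZS.
exists (stack 0 (take T s) (a + j%:Z)), (stack (endpoint 0 (take T s)) (drop T s) (a + j%:Z)).
split.
- by rewrite -stack_cat cat_take_drop.
- by rewrite /Z ell_minus.
- by rewrite ZS ell_plus.
(* the only site at which the walk can be is [i0 + 1], where it has just
   arrived from the left; the previous position settles that case *)
have [lt|] := ltP (endpoint 0 (take T s)) (a + j%:Z); first exact: last_departure.
rewrite eT => ge.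
have ip : iota = Plus by move: ge; rewrite /a /start_site; case: (iota) => //=; lia.
have aj : a + j%:Z = i0%:Z + 1 by move: ge; rewrite /a ip /=; lia.
rewrite sE stack_rcons es' aj ifF; last by apply/eqP; lia.
rewrite cats0; apply: last_departure; rewrite es'; lia.
Qed.

(** * The crossing event *)

Lemma uniq_bitseqs n : uniq (bitseqs n).
Proof.
elim: n => [//|n IH].
apply: (@allpairs_uniq _ _ _ (fun s b => rcons s b) (bitseqs n) [:: true; false] IH isT).
by move=> [s b] [s' b'] _ _ /= /rcons_inj [-> ->].
Qed.

Lemma path_of_inj s s' : size s = size s' ->
  (forall m, (m <= size s)%N -> path_of s m = path_of s' m) -> s = s'.
Proof.
move=> ss ps; apply: (@eq_from_nth _ false) => // m ms.
have := ps m.+1 ms; rewrite !path_ofS -?ss// ps ?(ltnW ms)// => /addrI.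
by rewrite /bstep; case: (nth _ _ _); case: (nth _ _ _).
Qed.

Lemma path_of_rcons s b m : (m <= size s)%N -> path_of (rcons s b) m = path_of s m.
Proof. by move=> ms; rewrite /path_of -cats1 takel_cat. Qed.

Lemma path_of_size s : path_of s (size s) = endpoint 0 s.
Proof. by rewrite /path_of take_size. Qed.

Section walk.
Variables (R : realType) (d : measure_display) (Omega : measurableType d).
Variables (P : probability Omega R) (w : int -> R) (X : nat -> Omega -> int).
Hypothesis w_gt0 : forall k, 0 < w k.
Hypothesis X_walk : self_repelling_walk P w X.

Lemma historyS x n : history X x n.+1 = history X x n `&` X n.+1 @^-1` [set x n.+1].
Proof.
apply/seteqP; split => [om h|om [h1 h2] m].
  by split; [move=> m mn; apply: h; exact: leqW|exact: h].
by rewrite leq_eqVlt => /orP[/eqP->//|]; exact: h1.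
Qed.

Lemma history0 x : history X x 0 = X 0%N @^-1` [set x 0%N].
Proof.
by apply/seteqP; split => [om h|om h m]; [exact: h|rewrite leqn0 => /eqP->].
Qed.

Lemma measurable_history x n : measurable (history X x n).
Proof.
have [mX _ _] := X_walk.
elim: n => [|n IH]; first by rewrite history0.
by rewrite historyS; apply: measurableI.
Qed.

Lemma history_ext x y n : (forall m, (m <= n)%N -> x m = y m) ->
  history X x n = history X y n.
Proof. by move=> xy; apply/seteqP; split => om h m mn; rewrite h// xy. Qed.

Definition follows (s : seq bool) := history X (path_of s) (size s).

Lemma follows_prob s : P (follows s) = (path_prob w s)%:E.
Proof.
have [_ P0 PS] := X_walk.
elim/last_ind: s => [|s b IH]; first by rewrite /follows history0 P0.
rewrite /follows size_rcons historyS path_prob_rcons.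
have e1 m : (m <= size s)%N -> path_of (rcons s b) m = path_of s m by exact: path_of_rcons.
rewrite (history_ext e1).
pose sg := if b then Plus else Minus.
have -> : path_of (rcons s b) (size s).+1 = path_of s (size s) + sgn_int sg.
  by rewrite path_ofS ?size_rcons// nth_rcons ltnn eqxx e1// /sg; clear; case: b.
rewrite PS IH -EFinM mulrC; congr (_ * _)%:E.
rewrite /step_prob path_of_size ell_plus// ell_minus// take_size.
rewrite -[X in w (- X) + w X]/(imbalance (stack 0 s (endpoint 0 s))).
rewrite -[X in w (_ * X)]/(imbalance (stack 0 s (endpoint 0 s))).
set e := imbalance _; rewrite /step_weight /sg; clear sg e1; case: b.
  by rewrite mul1r.
by rewrite -plus_probN// /plus_prob opprK mulN1r addrC.
Qed.

Lemma measurable_follows s : measurable (follows s).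
Proof. exact: measurable_history. Qed.

Lemma union_follows_prob n (Q : pred (seq bool)) :
  P (\big[setU/set0]_(s <- bitseqs n | Q s) follows s) =
  (\sum_(s <- bitseqs n | Q s) path_prob w s)%:E.
Proof.
rewrite -!(big_filter _ Q).
have : uniq [seq s <- bitseqs n | Q s] by rewrite filter_uniq// uniq_bitseqs.
have : all (fun s => size s == n) [seq s <- bitseqs n | Q s].
  by apply/allP => s; rewrite mem_filter => /andP[_ /size_bitseqs ->].
elim: [seq s <- bitseqs n | Q s] => [|s l IH]; first by rewrite !big_nil measure0.
move=> /= /andP[/eqP sn sl] /andP[snl ul]; rewrite !big_cons measureU.
- by rewrite EFinD -(IH sl ul) -follows_prob.
- exact: measurable_follows.
- by apply: bigsetU_measurable => t _; exact: measurable_follows.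
apply/seteqP; split => [om [fs]|//].
rewrite -bigcup_seq => -[t /= tl ft].
have tn : size t = n by apply/eqP/(allP sl).
move: snl; suff -> : s = t by rewrite tl.
apply: path_of_inj => [|m ms]; first by rewrite tn.
by rewrite -(fs m ms) -(ft m)// tn -sn.
Qed.

(** The walk takes unit steps from 0 almost surely only, and the
    deterministic facts about bit sequences hold on this event. *)
Definition nearest_neighbour : set Omega :=
  \bigcap_n \big[setU/set0]_(s <- bitseqs n) follows s.

Lemma measurable_nn : measurable nearest_neighbour.
Proof.
apply: bigcapT_measurable => n; apply: bigsetU_measurable => s _.
exact: measurable_follows.
Qed.

Lemma nn_prob : P nearest_neighbour = 1%E.
Proof.
have full n : P (~` \big[setU/set0]_(s <- bitseqs n) follows s) = 0%E.
  rewrite probability_setC; last by apply: bigsetU_measurable => s _; exact: measurable_follows.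
  by rewrite union_follows_prob sum_path_prob// subee.
have C0 : P (~` nearest_neighbour) = 0%E.
  rewrite /nearest_neighbour setC_bigcap; apply/eqP; rewrite eq_le measure_ge0 andbT.
  apply: le_trans (measure_sigma_subadditive _ _ _ (@subset_refl _ _)) _.
  - by move=> n; apply/measurableC/bigsetU_measurable => s _; exact: measurable_follows.
  - apply: bigcupT_measurable => n.
    by apply/measurableC/bigsetU_measurable => s _; exact: measurable_follows.
  by rewrite eseries0// => n _ _; exact: full.
rewrite -[nearest_neighbour]setCK probability_setC ?C0 ?sube0//.
exact/measurableC/measurable_nn.
Qed.

Variables (io : sign) (i0 n0 h : nat) (e : R).
Hypothesis n0_gt0 : (0 < n0)%N.
Let k := start_level io n0.
Let J := (2 * k + h)%N.
Let a := start_site io i0.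

Definition profile (x : nat -> int) : seq nat :=
  [seq ell Plus x (hit_time io x n0 i0%:Z) (a + j%:Z) | j <- iota 0 J].

(** The hitting time has occurred by time [n] and the profile does not cross: a
    property of the first [n] steps, increasing in [n], so its probability is
    controlled by finite sums and passes to the limit. *)
Definition misses (x : nat -> int) (n : nat) : Prop :=
  (exists2 m, (m <= n)%N & ell io x m i0%:Z = n0) /\ ~~ crosses k h e (profile x).

Lemma missesW x n m : (n <= m)%N -> misses x n -> misses x m.
Proof. by move=> nm [[j jn hj] c]; split => //; exists j => //; exact: leq_trans nm. Qed.

Lemma hit_time_ext x y n : (forall m, (m <= n)%N -> x m = y m) ->
  (exists2 m, (m <= n)%N & ell io x m i0%:Z = n0) ->
  (hit_time io x n0 i0%:Z <= n)%N /\ hit_time io y n0 i0%:Z = hit_time io x n0 i0%:Z.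
Proof.
move=> xy [m mn hm].
have [Tx Txmin] := @hit_timeP io x n0 i0%:Z (ex_intro _ m hm).
have eqn j : (j <= n)%N -> ell io x j i0%:Z = ell io y j i0%:Z.
  by move=> jn; apply: ell_ext => q qj; apply: xy; exact: leq_trans jn.
have hm' : ell io y m i0%:Z = n0 by rewrite -eqn.
have [Ty Tymin] := @hit_timeP io y n0 i0%:Z (ex_intro _ m hm').
have Tn := leq_trans (Txmin m hm) mn; split => //.
apply/eqP; rewrite eqn_leq Tymin -?eqn//= Txmin// eqn//.
exact: leq_trans (Tymin m hm') mn.
Qed.

Lemma misses_ext x y n : (forall m, (m <= n)%N -> x m = y m) -> misses x n -> misses y n.
Proof.
move=> xy [hit c]; have [Tn TT] := hit_time_ext xy hit.
have eqn j : (j <= n)%N -> forall sg i, ell sg x j i = ell sg y j i.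
  by move=> jn sg i; apply: ell_ext => q qj; apply: xy; exact: leq_trans jn.
split; first by case: hit => m mn hm; exists m; rewrite -?eqn.
move: c; rewrite /profile TT; congr (~~ crosses _ _ _ _).
by apply/eq_in_map => j _; rewrite eqn.
Qed.

Lemma misses_sum B n pr : (n <= B)%N ->
  pr <= path_exp (stack_kernel w_gt0 B) J (fun z => (crosses k h e z)%:R) k ->
  \sum_(s <- bitseqs n | `[< misses (path_of s) n >]) path_prob w s <= 1 - pr.
Proof.
move=> nB prB.
apply: le_trans (@sum_path_prob_le _ w w_gt0 n J k a
  (fun z => (~~ crosses k h e z)%:R) _ _ _ B nB) _ => //.
  move=> s sn /asboolP[hit c]; rewrite -sn in hit.
  have [Tn Z0 ZS] := hit_consumed n0_gt0 hit.
  exists (fun j => ell Minus (path_of s) (hit_time io (path_of s) n0 i0%:Z) (a + j%:Z)).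
  split => // [j _|]; first by have [] := ZS j.
  rewrite (_ : [seq _ | _ <- _] = profile (path_of s)) ?c//.
  by apply/eq_map => j; have [] := ZS j.
rewrite lerBrDr; apply: le_trans (lerD (lexx _) prB) _.
rewrite -path_expD (path_exp_ext _ (Psi := fun=> 1)) ?path_exp_cst//.
by move=> z _; case: (crosses _ _ _ _); rewrite ?add0r ?addr0.
Qed.

(** The event is the complement of the limit of [misses]. On it, the profile
    crosses as soon as the hitting time is finite. *)
Lemma crossing_event pr :
  (forall n, exists2 B, (n <= B)%N &
    pr <= path_exp (stack_kernel w_gt0 B) J (fun z => (crosses k h e z)%:R) k) ->
  exists A : set Omega, [/\ measurable A, (pr%:E <= P A)%E &
    forall om, A om -> (exists m, ell io (X ^~ om) m i0%:Z = n0) ->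
      crosses k h e (profile (X ^~ om)) /\
      forall j : nat, let T := hit_time io (X ^~ om) n0 i0%:Z in
        ell Minus (X ^~ om) T (a + j.+1%:Z) = ell Plus (X ^~ om) T (a + j%:Z)].
Proof.
move=> prB.
pose U n := \big[setU/set0]_(s <- bitseqs n | `[< misses (path_of s) n >]) follows s.
pose G n := nearest_neighbour `&` U n.
have mU n : measurable (U n).
  by apply: bigsetU_measurable => s _; exact: measurable_follows.
have mG n : measurable (G n) by apply: measurableI => //; exact: measurable_nn.
have GE n : G n = [set om | nearest_neighbour om /\ misses (X ^~ om) n].
  apply/seteqP; split => om; rewrite /G /U => -[nom].
    rewrite -bigcup_seq_cond => -[s /= /andP[/size_bitseqs sn /asboolP bs] fs].
    split => //; apply: misses_ext bs => m mn.
    by rewrite (fs m)// sn.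
  move=> b; split => //; have := nom n I; rewrite -bigcup_seq => -[s /= sn fs].
  rewrite -bigcup_seq_cond; exists s => //=; rewrite sn; apply/asboolP.
  by apply: misses_ext b => m mn; apply: fs; rewrite (size_bitseqs sn).
have ndG : nondecreasing_seq G.
  move=> n m nm; apply/subsetPset; rewrite !GE => om [nom b]; split => //.
  exact: missesW b.
have PG n : (P (G n) <= (1 - pr)%:E)%E.
  apply: le_trans (_ : P (U n) <= _)%E.
    by apply: le_measure; rewrite ?inE//; exact: subIsetr.
  rewrite union_follows_prob lee_fin.
  by have [B nB prB'] := prB n; exact: misses_sum prB'.
have mbig : measurable (\bigcup_n G n) by exact: bigcupT_measurable.
have PbigG : (P (\bigcup_n G n) <= (1 - pr)%:E)%E.
  have cv := nondecreasing_cvg_mu (mu := P) mG mbig ndG.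
  rewrite -(cvg_lim _ cv)//; apply: lime_le; first by apply/cvg_ex; exists (P (\bigcup_n G n)).
  by apply: nearW => n; exact: PG.
exists (nearest_neighbour `\` \bigcup_n G n); split.
- by apply: measurableD => //; exact: measurable_nn.
- rewrite measureD//; [|exact: measurable_nn|].
    rewrite [X in (X - _)%E](_ : _ = 1%E); last exact: nn_prob.
    rewrite (_ : nearest_neighbour `&` _ = \bigcup_n G n); last first.
      by rewrite setIC; apply: setIidl => om [n _ []].
    have fG : P (\bigcup_n G n) \is a fin_num.
      by rewrite ge0_fin_numE// (le_lt_trans PbigG)// ltry.
    rewrite leeBrDr//; apply: le_trans (leeD2l _ PbigG) _.
    by rewrite -EFinD lee_fin; lra.
  by apply: le_lt_trans (probability_le1 P measurable_nn) _; rewrite ltry.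
move=> om [nom ng] [m hm]; split.
  apply/negPn/negP => c; apply: ng.
  by exists m => //; rewrite GE; split => //; split => //; exists m.
move=> j /=; have := nom m I; rewrite -bigcup_seq => -[s /= /size_bitseqs sm fs].
have xs q : (q <= m)%N -> X q om = path_of s q by move=> qm; apply: fs; rewrite sm.
have [Tm TT] := hit_time_ext xs (ex_intro2 _ _ m (leqnn m) hm).
have hs : exists2 q, (q <= size s)%N & ell io (path_of s) q i0%:Z = n0.
  by exists m; rewrite ?sm// -(ell_ext _ _ xs).
have [_ _ ZS] := hit_consumed n0_gt0 hs; have [] := ZS j; rewrite TT => E _.
have eqT sg i : ell sg (X ^~ om) (hit_time io (X ^~ om) n0 i0%:Z) i =
    ell sg (path_of s) (hit_time io (X ^~ om) n0 i0%:Z) i.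
  by apply: ell_ext => q qT; apply: xs; exact: leq_trans Tm.
by rewrite !eqT.
Qed.
End walk.

(** * Crossings seen from the hitting site *)

Definition level_gap {R : realType} (io sg : sign) (x : nat -> int) (i0 n0 : nat) (t : R)
    (j : nat) : R :=
  (ell sg x (hit_time io x n0 i0%:Z) (i0%:Z + j%:Z))%:R - Num.max (t - j%:R / 2) 0.

(** Both local time profiles, of plus and of minus edges, are read at the
    distance [j] from [i0], and the wedge [N (theta - j / (2 N))_+] is that of
    the fluctuation process with [t = N theta]. *)
Definition gap_crosses {R : realType} (io sg : sign) (x : nat -> int) (i0 n0 : nat)
    (t width e : R) : Prop :=
  exists j1 j2 j3 : nat, [/\ (j1 <= j2)%N, (j2 <= j3)%N,
    `|j1%:R - 2 * t| <= width, `|j3%:R - 2 * t| <= width &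
    e <= `|level_gap io sg x i0 n0 t j1 - level_gap io sg x i0 n0 t j2| /\
    e <= `|level_gap io sg x i0 n0 t j2 - level_gap io sg x i0 n0 t j3| ].

(** When the level is never reached the hitting time is 0 by convention, all
    local times vanish, and the gap is the opposite of the wedge, which grows
    linearly to the left of its tip. *)
Lemma gap_crosses_nohit (R : realType) (io sg : sign) x (i0 n0 : nat) (t width e : R) :
  (forall m, ell io x m i0%:Z <> n0) -> 0 < t -> 1 <= e -> width <= t ->
  4 * e + 5 <= width -> gap_crosses io sg x i0 n0 t width e.
Proof.
move=> nohit t0 e1 wt ew.
have T0 : hit_time io x n0 i0%:Z = 0%N.
  rewrite /hit_time; case: pselect => // hit; exfalso.
  by case: hit => m /eqP; exact: nohit.
pose c := Num.truncn (2 * t); pose q := Num.truncn (width / 2 - 1).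
have cle : c%:R <= 2 * t by rewrite truncn_le; lra.
have cge : 2 * t < c%:R + 1 by rewrite natr1 truncnS_gt.
have qle : q%:R <= width / 2 - 1 by rewrite truncn_le; lra.
have qge : width / 2 - 1 < q%:R + 1 by rewrite natr1 truncnS_gt.
have qc : (2 * q <= c)%N by rewrite -(ler_nat R) natrM; lra.
have G j : (j <= c)%N -> level_gap io sg x i0 n0 t j = - (t - j%:R / 2).
  move=> jc; rewrite /level_gap T0 ell0 sub0r max_l//.
  have : j%:R <= c%:R :> R by rewrite ler_nat.
  by lra.
have c2 : (c - 2 * q)%N%:R = c%:R - 2 * q%:R :> R by rewrite natrB// natrM.
have c1 : (c - q)%N%:R = c%:R - q%:R :> R by rewrite natrB//; zlia R.
exists (c - 2 * q)%N, (c - q)%N, c; rewrite !G ?leq_subr// c1 c2; split.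
- by zlia R.
- by zlia R.
- by rewrite ler_norml; apply/andP; split; lra.
- by rewrite ler_norml; apply/andP; split; lra.
- split; rewrite -normrN ler_normr; apply/orP; left; lra.
Qed.

Section walk.
Variables (R : realType) (d : measure_display) (Omega : measurableType d).
Variables (P : probability Omega R) (w : int -> R).
Hypothesis w_gt0 : forall k, 0 < w k.
Hypothesis w_homo : {homo w : i j / i <= j}.
Hypothesis w_nonconst : exists i j : int, w i <> w j.

(** The chain index and the distance to [i0], the level [k] and [t], differ by
    bounded amounts, so the two gaps differ by at most [5 / 2]. *)
Lemma crosses_level_gap (io sg : sign) x (i0 n0 h : nat) (t e width : R) :
  let k := start_level io n0 in
  let T := hit_time io x n0 i0%:Z in
  `|k%:R - t| <= 2 -> (0 < h)%N -> (h <= k)%N -> h%:R + 5 <= width ->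
  crosses k h (e + 5) (profile io i0 n0 h x) ->
  (forall j : nat, ell Minus x T (start_site io i0 + j.+1%:Z) =
                   ell Plus x T (start_site io i0 + j%:Z)) ->
  gap_crosses io sg x i0 n0 t width e.
Proof.
move=> k T kt h0 hk hw /asboolP[j1 [j2 [j3 [l1 l12 l23 l3 [c12 c23]]]]] fl.
(* the distance to [i0] of the site whose departures the [j]-th state of the
   chain counts *)
pose sh (j : nat) : nat := match io, sg with
  | Plus, Plus => j | Minus, Plus => j.-1 | Plus, Minus => j.+1 | Minus, Minus => j end.
have E j : (0 < j <= 2 * k + h)%N ->
    (ell sg x T (i0%:Z + (sh j)%:Z)) = nth 0%N (k :: profile io i0 n0 h x) j.
  case: j => [//|j] jJ; rewrite /= (nth_map 0%N) ?size_iota// nth_iota// add0n -/T.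
  have := fl j; rewrite /sh /start_site.
  case: (sg) => [_|<-]; congr (ell _ x T _); case: (io) => /=; zlia R.
have D j : (0 < j <= 2 * k + h)%N ->
    `|level_gap io sg x i0 n0 t (sh j) - wedge_gap k%:R (nth 0%N (k :: profile io i0 n0 h x)) j| <= 5 / 2.
  move=> jJ; rewrite /level_gap -/T E// /wedge_gap.
  have -> : forall u v y : R, u - v - (u - y) = y - v by move=> *; ring.
  apply: le_trans (wedge_lipschitz _ _) _.
  move: kt; rewrite !ler_norml => /andP[? ?].
  have : (sh j)%:R <= j%:R + 1 :> R by rewrite natr1 ler_nat /sh; case: (io); case: (sg); zlia R.
  have : j%:R <= (sh j)%:R + 1 :> R by rewrite natr1 ler_nat /sh; case: (io); case: (sg); zlia R.
  by move=> ? ?; apply/andP; split; lra.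
have shR j : (2 * k - h <= j <= 2 * k + h)%N -> `|(sh j)%:R - 2 * t| <= width.
  move=> /andP[ja jb].
  have : (sh j)%:R <= j%:R + 1 :> R by rewrite natr1 ler_nat /sh; case: (io); case: (sg); zlia R.
  have : j%:R <= (sh j)%:R + 1 :> R by rewrite natr1 ler_nat /sh; case: (io); case: (sg); zlia R.
  have : j%:R <= 2 * k%:R + h%:R :> R by rewrite -natrM -natrD ler_nat.
  have : 2 * k%:R <= j%:R + h%:R :> R by rewrite -natrM -natrD ler_nat; zlia R.
  by move: kt; rewrite !ler_norml => /andP[? ?] ? ? ? ?; apply/andP; split; lra.
have mono i j : (i <= j)%N -> (sh i <= sh j)%N.
  by rewrite /sh; case: (io); case: (sg); zlia R.
have k0 : (0 < 2 * k - h)%N by zlia R.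
exists (sh j1), (sh j2), (sh j3); split.
- exact: mono.
- exact: mono.
- by apply: shR; zlia R.
- by apply: shR; zlia R.
have D1 := D j1 ltac:(zlia R); have D2 := D j2 ltac:(zlia R); have D3 := D j3 ltac:(zlia R).
have tri (a b a' b' : R) : `|a - a'| <= 5 / 2 -> `|b - b'| <= 5 / 2 -> e + 5 <= `|a' - b'| -> e <= `|a - b|.
  move=> h1 h2 h3; have := ler_normD (a - b) ((b - b') - (a - a')).
  have := ler_normB (b - b') (a - a').
  rewrite (_ : a - b + _ = a' - b'); last by ring.
  by lra.
by split; [apply: tri D1 D2 c12|apply: tri D2 D3 c23].
Qed.

(** [kappa] and [pr] do not depend on the width [delta] of the window: this is
    what J1 convergence excludes. *)
Lemma walk_crosses (theta : R) : 0 < theta ->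
  exists kappa pr : R, [/\ 0 < kappa, 0 < pr & forall delta : R, 0 < delta ->
  exists N0 : nat, forall (N i0 : nat) (io sg : sign) (X : nat -> Omega -> int),
    (N0 <= N)%N -> self_repelling_walk P w X ->
    exists A : set Omega, [/\ measurable A, (pr%:E <= P A)%E &
    forall om, A om -> gap_crosses io sg (X ^~ om) i0 (Num.truncn (N%:R * theta))
      (N%:R * theta) (delta * N%:R) (kappa * Num.sqrt N%:R)]].
Proof.
move=> T0; have [kappa [pr [kappa0 pr0 H]]] := stack_chain_crosses w_gt0 w_homo w_nonconst T0.
exists (kappa / 2), pr; split => //; first by rewrite divr_gt0.
move=> delta delta0.
pose mu := Num.min delta theta.
have mu0 : 0 < mu by rewrite lt_min delta0.
have mud : mu <= delta by rewrite ge_min lexx.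
have mut : mu <= theta by rewrite ge_min lexx orbT.
have [N1 {}H] := H (mu / 2) (divr_gt0 mu0 (ltr0n _ 2)).
pose q1 := 1 / theta; pose q2 := 10 / mu; pose q3 := (10 / kappa) ^+ 2.
pose q4 := ((2 * kappa + 5) / mu) ^+ 2.
exists (maxn N1 (maxn (Num.truncn q1).+1 (maxn (Num.truncn q2).+1
  (maxn (Num.truncn q3).+1 (Num.truncn q4).+1)))) => N i0 io sg X.
rewrite !geq_max => /and5P[NN1 l1 l2 l3 l4] Xw.
set n : R := N%:R.
have up q : (Num.truncn q < N)%N -> q <= n.
  by move=> qN; apply: le_trans (ltW (truncnS_gt q)) _; rewrite ler_nat.
have S1 : 1 <= n by rewrite ler1n (leq_ltn_trans _ l1).
have {l1}l1 := up _ l1; have {l2}l2 := up _ l2; have {l3}l3 := up _ l3; have {l4}l4 := up _ l4.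
have n0 : 0 < n by apply: lt_le_trans l2; rewrite divr_gt0// ltr0n.
have S0 : 0 <= Num.sqrt n by exact: sqrtr_ge0.
have S2 : Num.sqrt n ^+ 2 = n by rewrite sqr_sqrtr// ltW.
have Sx x : 0 <= x -> x ^+ 2 <= n -> x <= Num.sqrt n.
  by move=> x0; rewrite -[X in _ <= X]S2 ler_pXn2r.
set S := Num.sqrt n in S0 S2 Sx *.
have {l1}l1 : 1 <= n * theta by rewrite -ler_pdivrMr.
have {l2}l2 : 10 <= n * mu by rewrite -ler_pdivrMr.
have {l3}l3 : 10 <= S * kappa.
  by rewrite -ler_pdivrMr//; apply: Sx => //; rewrite divr_ge0// ltW.
have {l4}l4 : 2 * kappa + 5 <= S * mu.
  by rewrite -ler_pdivrMr//; apply: Sx => //; rewrite divr_ge0// ?addr_ge0 ?mulr_ge0// ltW.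
have {}S1 : 1 <= S by apply: Sx; rewrite ?expr1n.
have SE : Num.sqrt N%:R = S by [].
clearbody mu S.
pose n0N := Num.truncn (n * theta).
have n0le : n0N%:R <= n * theta by rewrite truncn_le; lra.
have n0ge : n * theta < n0N%:R + 1 by rewrite natr1 truncnS_gt.
have n0N0 : (0 < n0N)%N by rewrite -(ltr0n R); lra.
have kt : `|(start_level io n0N)%:R - n * theta| <= 2.
  rewrite /start_level; case: (io); last by rewrite ler_norml; apply/andP; split; lra.
  have -> : n0N.-1%:R = n0N%:R - 1 :> R by rewrite -subn1 natrB.
  by rewrite ler_norml; apply/andP; split; lra.
have [h [h0 hk hd Hh]] := H N _ NN1 kt; rewrite SE in Hh.
have [|A [mA PA cA]] := @crossing_event R d Omega P w X w_gt0 Xw io i0 n0N h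
  (kappa * S) n0N0 pr.
  by move=> m; exists (maxn m N1); [exact: leq_maxl|apply: Hh; exact: leq_maxr].
exists A; split => // om Aom.
have [[m hm]|nohit] := pselect (exists m, ell io (X ^~ om) m i0%:Z = n0N).
  have [cr fl] := cA om Aom (ex_intro _ m hm).
  apply: (@crosses_level_gap io sg _ i0 n0N h) => //.
  - have : mu / 2 * n + 5 <= delta * n.
      have : mu * n <= delta * n by rewrite ler_pM2r.
      lra.
    by lra.
  - move: cr => /asboolP[j1 [j2 [j3 [a1 a2 a3 a4 [a5 a6]]]]].
    have e5 : kappa / 2 * S + 5 <= kappa * S by lra.
    apply/asboolP; exists j1, j2, j3; split => //.
    by split; [apply: le_trans e5 a5|apply: le_trans e5 a6].
have : gap_crosses io sg (X ^~ om) i0 n0N (n * theta) (mu * n) (kappa / 2 * S).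
  apply: gap_crosses_nohit; [|lra|lra| |].
  - by move=> m hm; apply: nohit; exists m.
  - by rewrite mulrC ler_pM2l.
  - have : (2 * kappa + 5) * S <= S * mu * S by rewrite ler_wpM2r.
    have -> : S * mu * S = mu * n by rewrite -S2; ring.
    have : 5 * 1 <= 5 * S by rewrite ler_pM2l ?ltr0n.
    lra.
have wd : mu * n <= delta * n by rewrite ler_pM2r.
move=> [j1 [j2 [j3 [a1 a2 a3 a4 a5]]]]; exists j1, j2, j3; split => //.
- exact: le_trans a3 wd.
- exact: le_trans a4 wd.
Qed.
End walk.

(** * Lower bounds for integrals and for the J1 distance *)

Import HBNNSimple.

(** [c 1_A] is one of the simple functions in the supremum that defines the
    integral of [f]. *)
Lemma integral_ge_cst d (T : measurableType d) (R : realType)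
    (mu : {measure set T -> \bar R}) (D A : set T) (f : T -> \bar R) (c : R) :
  measurable A -> A `<=` D -> 0 <= c -> (forall x, D x -> (0 <= f x)%E) ->
  (forall x, A x -> (c%:E <= f x)%E) ->
  (c%:E * mu A <= \int[mu]_(x in D) f x)%E.
Proof.
move=> mA AD c0 f0 fc; rewrite ge0_integralE//.
apply: ereal_sup_ubound; exists (scale_nnsfun (indic_nnsfun R mA) c0) => /=.
  move=> x; rewrite /patch measurable_realfun.mindicE; have [xA|xA] /= := boolP (x \in A).
    have Ax : A x by rewrite inE in xA.
    by rewrite mulr1 ifT ?fc// inE; exact: AD.
  by rewrite mulr0; case: ifPn => // xD; apply: f0; rewrite inE in xD.
have := sintegralrM mu c (indic_nnsfun R mA).
by rewrite [sintegral mu (indic_nnsfun R mA)](sintegral_indic mu A) => <-.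
Qed.

Lemma expectation_ge_cst d (T : measurableType d) (R : realType)
    (P : probability T R) (A : set T) (f : T -> R) (c pr : R) :
  measurable A -> 0 <= c -> (forall x, 0 <= f x) -> (forall x, A x -> c <= f x) ->
  (pr%:E <= P A)%E -> ((c * pr)%:E <= 'E_P[f])%E.
Proof.
move=> mA c0 f0 fc PA; rewrite unlock.
apply: le_trans (_ : c%:E * P A <= _)%E; first by rewrite EFinM lee_wpmul2l// lee_fin.
by apply: integral_ge_cst => // x _; rewrite lee_fin.
Qed.

Section J1.
Variable R : realType.
Implicit Types f g : R -> R.

Lemma sup_norm_lt a b f e t : (sup_norm a b f < e%:E)%E -> t \in `[a, b] ->
  `|f t| < e.
Proof.
move=> fe tab; rewrite -lte_fin; apply: le_lt_trans fe.
by apply: ereal_sup_ubound; exists t => //; rewrite /= in tab *.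
Qed.

Lemma sup_norm_ge0 a b f : a <= b -> (0 <= sup_norm a b f)%E.
Proof.
move=> ab; apply: le_trans (_ : (`|f a|)%:E <= _)%E; first by rewrite lee_fin.
by apply: ereal_sup_ubound; exists a => //=; rewrite in_itv /= lexx.
Qed.

Lemma dJ1_itv_ge0 a b f g : a <= b -> (0 <= dJ1_itv a b f g)%E.
Proof.
move=> ab; apply: le_ereal_inf_tmp => _ [lam _ <-].
by rewrite le_max sup_norm_ge0.
Qed.

(** If the distance on the interval from [- a] to [a] were at least [eta] for all
    [a] between [A] and [A + 1], the contribution of these [a] to the integral would be at least the
    right-hand side. *)
Lemma dJ1_lt (A eta : R) f g : 0 <= A -> 0 < eta -> eta <= 1 ->
  (dJ1 f g < (expR (- (A + 1)) * eta)%:E)%E ->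
  exists2 a, A <= a & (dJ1_itv (- a) a f g < eta%:E)%E.
Proof.
move=> A0 eta0 eta1 dlt; apply: contrapT => no.
have {}no a : A <= a -> (eta%:E <= dJ1_itv (- a) a f g)%E.
  by move=> Aa; rewrite leNgt; apply/negP => h; apply: no; exists a.
have : ((expR (- (A + 1)) * eta)%:E <= dJ1 f g)%E.
  rewrite /dJ1.
  have mI : measurable (`[A, A + 1]%classic : set R) by exact: measurable_itv.
  set c := expR (- (A + 1)) * eta.
  have -> : c%:E = (c%:E * lebesgue_measure (`[A, (A + 1)%R]%classic : set R))%E.
    rewrite lebesgue_measure_itv/= lte_fin ltrDl ltr01 -EFinD addrAC subrr add0r.
    by rewrite mule1.
  apply: integral_ge_cst => //.
  - by move=> x /=; rewrite !in_itv/= andbT => /andP[Ax _]; exact: le_trans Ax.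
  - by rewrite mulr_ge0 ?expR_ge0// ltW.
  - move=> x /=; rewrite in_itv/= andbT => x0.
    rewrite mule_ge0 ?lee_fin ?expR_ge0// le_min lee01 andbT.
    by apply: dJ1_itv_ge0; lra.
  - move=> x /=; rewrite in_itv/= => /andP[Ax xA].
    rewrite EFinM; apply: lee_pmul; rewrite ?lee_fin ?expR_ge0 ?(ltW eta0)//.
      by rewrite ler_expR lerN2.
    by rewrite le_min no// lee_fin.
by rewrite leNgt dlt.
Qed.

Lemma dJ1_itv_lt a b f g eta : (dJ1_itv a b f g < eta%:E)%E ->
  exists lam, [/\ set_bij `[a, b] `[a, b] lam,
    {in `[a, b] &, {homo lam : s t / s < t}} &
    forall t, t \in `[a, b] -> `|f (lam t) - g t| < eta /\ `|lam t - t| < eta].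
Proof.
move=> /ereal_inf_lt[_ [lam [bl hl _] <-]]; rewrite gt_max => /andP[l1 l2].
by exists lam; split => // t tab; split; [exact: sup_norm_lt l1 tab|exact: sup_norm_lt l2 tab].
Qed.

End J1.

(** * A J1-continuous modulus at a point *)

Section osc.
Variable R : realType.
Implicit Types f g : R -> R.
Variables (c delta : R).
Hypothesis delta_gt0 : 0 < delta.

Definition tent (v : R) : R := Num.max 0 (1 - `|v - c| / delta).

(** How much [f] changes from [s] to [t] and again from [t] to [u], cut off at 1
    and localised near [c]. Two changes are needed: a single one may be due to a
    jump at [c], which remains however small the neighbourhood. *)
Definition two_jumps f (s t u : R) : R :=
  Num.min (Num.min 1 (Num.min `|f t - f s| `|f u - f t|)) (Num.min (tent s) (tent u)).

(** The supremum over all ordered triples makes this insensitive to time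
    changes, which permute the triples; the position enters only through the
    Lipschitz function [tent]. *)
Definition osc f : R :=
  sup [set r | exists s t u, [/\ s <= t, t <= u & r = two_jumps f s t u]].

Lemma tent_ge0 v : 0 <= tent v.
Proof. by rewrite le_max lexx. Qed.

Lemma tent_gt0 v : 0 < tent v -> `|v - c| < delta.
Proof.
by rewrite lt_max ltxx/= subr_gt0 ltr_pdivrMr// mul1r.
Qed.

Lemma tent_close v v' eta : `|v' - v| <= eta -> tent v <= tent v' + eta / delta.
Proof.
move=> vv; have e0 : 0 <= eta by apply: le_trans vv.
rewrite /tent ge_max; apply/andP; split.
  by rewrite addr_ge0 ?divr_ge0 ?(ltW delta_gt0)// le_max lexx.
have : `|v' - c| <= `|v - c| + eta.
  have := ler_normD (v - c) (v' - v); rewrite addrC subrKA => h.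
  by apply: le_trans h _; rewrite lerD2l.
rewrite -(ler_pM2r (x := delta^-1)) ?invr_gt0// mulrDl => h.
by apply: le_trans (_ : 1 - `|v' - c| / delta + eta / delta <= _);
  [lra|rewrite lerD2r le_max lexx orbT].
Qed.

Lemma two_jumps_ge0 f s t u : 0 <= two_jumps f s t u.
Proof. by rewrite /two_jumps !le_min ler01 !normr_ge0 !tent_ge0. Qed.

Lemma two_jumps_le1 f s t u : two_jumps f s t u <= 1.
Proof. by rewrite /two_jumps !ge_min lexx. Qed.

Lemma osc_has_sup f :
  has_sup [set r | exists s t u, [/\ s <= t, t <= u & r = two_jumps f s t u]].
Proof.
split; first by exists (two_jumps f 0 0 0), 0, 0, 0.
by exists 1 => _ [s [t [u [_ _ ->]]]]; exact: two_jumps_le1.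
Qed.

Lemma osc_ge f s t u : s <= t -> t <= u -> two_jumps f s t u <= osc f.
Proof.
by move=> st tu; apply: ub_le_sup; [exact: (osc_has_sup f).2|exists s, t, u].
Qed.

Lemma osc_le f x : (forall s t u, s <= t -> t <= u -> two_jumps f s t u <= x) ->
  osc f <= x.
Proof.
move=> fx; apply: ge_sup; first exact: (osc_has_sup f).1.
by move=> _ [s [t [u [st tu ->]]]]; exact: fx.
Qed.

Lemma osc_ge0 f : 0 <= osc f.
Proof. exact: le_trans (two_jumps_ge0 f 0 0 0) (osc_ge f (lexx _) (lexx _)). Qed.

Lemma osc_le1 f : osc f <= 1.
Proof. by apply: osc_le => *; exact: two_jumps_le1. Qed.

Lemma two_jumps_gt0 f s t u : 0 < two_jumps f s t u ->
  `|s - c| < delta /\ `|u - c| < delta.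
Proof. by rewrite !lt_min => /andP[_ /andP[/tent_gt0 ? /tent_gt0 ?]]. Qed.

Lemma two_jumps_close f g s t u s' t' u' eta :
  `|f s' - g s| <= eta -> `|f t' - g t| <= eta -> `|f u' - g u| <= eta ->
  `|s' - s| <= eta -> `|u' - u| <= eta ->
  two_jumps g s t u <= two_jumps f s' t' u' + (2 + delta^-1) * eta.
Proof.
move=> hs ht hu ds du.
have e0 : 0 <= eta by apply: le_trans ds.
have de0 : 0 <= delta^-1 * eta by rewrite mulr_ge0// invr_ge0 ltW.
have ts := tent_close ds; have tu := tent_close du.
rewrite -lerBlDr {2}/two_jumps !le_min -!andbA.
have tri (x y x' y' : R) : `|x' - x| <= eta -> `|y' - y| <= eta ->
    `|x - y| - (2 + delta^-1) * eta <= `|x' - y'|.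
  move=> h1 h2; have := ler_normD (x' - y') ((y' - y) - (x' - x)).
  have := ler_normB (y' - y) (x' - x).
  by rewrite (_ : x' - y' + _ = x - y); [lra|ring].
set W := two_jumps g s t u.
have w1 : W <= 1 by exact: two_jumps_le1.
have w2 : W <= `|g t - g s| by rewrite /W /two_jumps !ge_min lexx ?orbT.
have w3 : W <= `|g u - g t| by rewrite /W /two_jumps !ge_min lexx ?orbT.
have w4 : W <= tent s by rewrite /W /two_jumps !ge_min lexx ?orbT.
have w5 : W <= tent u by rewrite /W /two_jumps !ge_min lexx ?orbT.
apply/and5P; split.
- lra.
- by apply: le_trans (tri _ _ _ _ ht hs); rewrite lerD2r.
- by apply: le_trans (tri _ _ _ _ hu ht); rewrite lerD2r.
- lra.
- lra.
Qed.

(** A time change of the interval [- a, a] maps ordered triples onto ordered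
    triples, with small changes of the values and of the positions; both directions of the
    estimate use [two_jumps_close]. *)
Lemma osc_dJ1_itv f g a eta : `|c| + delta <= a -> 0 < eta ->
  (dJ1_itv (- a) a f g < eta%:E)%E ->
  `|osc f - osc g| <= (2 + delta^-1) * eta.
Proof.
move=> ca eta0 /dJ1_itv_lt[lam [[lfun linj lsurj] lmono ld]].
have L0 : 0 <= (2 + delta^-1) * eta.
  by rewrite mulr_ge0 ?(ltW eta0)// addr_ge0// invr_ge0 ltW.
have inI v : `|v - c| < delta -> v \in `[- a, a].
  move=> vc; rewrite in_itv/= -ler_norml; apply: le_trans ca.
  by have := ler_normD (v - c) c; rewrite subrK; lra.
have inI3 s t u : s <= t -> t <= u -> `|s - c| < delta -> `|u - c| < delta ->
    [/\ s \in `[- a, a], t \in `[- a, a] & u \in `[- a, a]].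
  move=> st tu /inI sI /inI uI; split => //; move: sI uI.
  rewrite !in_itv/= => /andP[h1 h2] /andP[h3 h4]; apply/andP; split; lra.
have wmono s t : s \in `[- a, a] -> t \in `[- a, a] -> s <= t -> lam s <= lam t.
  move=> sI tI; rewrite le_eqVlt => /orP[/eqP->//|st]; exact/ltW/lmono.
rewrite ler_distl; apply/andP; split.
  rewrite lerBlDr; apply: osc_le => s t u st tu.
  have [p0|/two_jumps_gt0[sc uc]] := leP (two_jumps g s t u) 0.
    by apply: le_trans p0 _; rewrite addr_ge0// osc_ge0.
  have [sI tI uI] := inI3 s t u st tu sc uc.
  have [ls1 ls2] := ld s sI; have [lt1 lt2] := ld t tI; have [lu1 lu2] := ld u uI.
  apply: le_trans (two_jumps_close (f := f) (s' := lam s) (t' := lam t) (u' := lam u)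
    (ltW ls1) (ltW lt1) (ltW lu1) (ltW ls2) (ltW lu2)) _.
  by rewrite lerD2r; apply: osc_ge; exact: wmono.
apply: osc_le => s t u st tu.
have [p0|/two_jumps_gt0[sc uc]] := leP (two_jumps f s t u) 0.
  by apply: le_trans p0 _; rewrite addr_ge0// osc_ge0.
have [sI tI uI] := inI3 s t u st tu sc uc.
have inv v : v \in `[- a, a] -> exists2 v0, v0 \in `[- a, a] & lam v0 = v.
  by move=> vI; have [v0 v0I <-] := lsurj v vI; exists v0.
have [s0 s0I sE] := inv s sI; have [t0 t0I tE] := inv t tI; have [u0 u0I uE] := inv u uI.
have st0 : s0 <= t0.
  by rewrite leNgt; apply/negP => /(lmono _ _ t0I s0I); rewrite sE tE ltNge st.
have tu0 : t0 <= u0.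
  by rewrite leNgt; apply/negP => /(lmono _ _ u0I t0I); rewrite uE tE ltNge tu.
have [ls1 ls2] := ld s0 s0I; have [lt1 lt2] := ld t0 t0I; have [lu1 lu2] := ld u0 u0I.
rewrite sE in ls1 ls2; rewrite tE in lt1 lt2; rewrite uE in lu1 lu2.
have sym (x y : R) : `|x - y| < eta -> `|y - x| <= eta by rewrite distrC => /ltW.
apply: le_trans (two_jumps_close (f := g) (g := f) (s' := s0) (t' := t0) (u' := u0)
  (sym _ _ ls1) (sym _ _ lt1) (sym _ _ lu1) (sym _ _ ls2) (sym _ _ lu2)) _.
by rewrite lerD2r; exact: osc_ge.
Qed.

Lemma osc_J1_continuous : continuous (fun f : skorohod_space R => osc f).
Proof.
apply/continuousP => U oU.
suff : J1_open ((fun f : skorohod_space R => osc f) @^-1` U) by [].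
move=> f Uf.
have /nbhs_ballP[r /= r0 rU] : nbhs (osc f) U by exact: open_nbhs_nbhs.
pose L := 2 + delta^-1.
have L0 : 0 < L by rewrite addr_gt0// invr_gt0.
pose eta := Num.min 1 (r / 2 / L).
have eta0 : 0 < eta by rewrite lt_min ltr01 !divr_gt0.
have eta1 : eta <= 1 by rewrite ge_min lexx.
have etaL : L * eta < r.
  have : eta <= r / 2 / L by rewrite ge_min lexx orbT.
  by rewrite ler_pdivlMr// mulrC; lra.
pose A := `|c| + delta.
have A0 : 0 <= A by rewrite addr_ge0// ltW.
exists (expR (- (A + 1)) * eta); first by rewrite mulr_gt0// expR_gt0.
move=> g /(dJ1_lt A0 eta0 eta1)[a Aa da]; apply: rU.
by rewrite /ball/=; apply: le_lt_trans (osc_dJ1_itv Aa eta0 da) etaL.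
Qed.

End osc.

(** * A criterion for non-convergence *)

Section limit.
Variable R : realType.
Variable c : R.

(** Near [c] the function is close to [f c] on the right and to its left limit
    on the left. One of the two changes of a triple takes place on one side of
    [c], so it is small. *)
Lemma osc_small (f : skorohod_space R) (e : R) : 0 < e ->
  exists2 r : R, 0 < r & forall delta, 0 < delta -> delta <= r -> osc c delta f <= e.
Proof.
move=> e0; have e2 : 0 < e / 2 by rewrite divr_gt0.
have [fr /cvg_ex[l fl]] := path_cadlag f c.
have [r1 r10 h1] : exists2 r, 0 < r & forall y, c <= y -> y < c + r -> `|f c - f y| < e / 2.
  move/cvgrPdist_lt : fr => /(_ _ e2) [r /= r0 hr].
  exists r => // y; rewrite le_eqVlt => /orP[/eqP<- _|cy yr].
    by rewrite subrr normr0.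
  by apply: hr => //=; rewrite ltr0_norm ?subr_lt0//; lra.
have [r2 r20 h2] : exists2 r, 0 < r & forall y, y < c -> c - r < y -> `|l - f y| < e / 2.
  move/cvgrPdist_lt : fl => /(_ _ e2) [r /= r0 hr].
  exists r => // y yc yr.
  by apply: hr => //=; rewrite gtr0_norm ?subr_gt0//; lra.
exists (Num.min r1 r2); first by rewrite lt_min r10.
move=> delta d0; rewrite le_min => /andP[d1 d2].
apply: osc_le => // s t u st tu.
have [p0|] := leP (two_jumps c delta f s t u) 0; first exact: le_trans p0 (ltW e0).
move=> /(two_jumps_gt0 d0)[]; rewrite !ltr_norml => /andP[s1 s2] /andP[u1 u2].
have [tc|ct] := ltP t c.
  apply: le_trans (_ : `|f t - f s| <= _).
    by rewrite /two_jumps !ge_min lexx ?orbT.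
  have a1 := h2 t tc ltac:(lra); have a2 := h2 s ltac:(lra) ltac:(lra).
  have := ler_normB (l - f s) (l - f t); rewrite (_ : l - f s - _ = f t - f s); last by ring.
  by lra.
apply: le_trans (_ : `|f u - f t| <= _).
  by rewrite /two_jumps !ge_min lexx ?orbT.
have a1 := h1 t ct ltac:(lra); have a2 := h1 u ltac:(lra) ltac:(lra).
have := ler_normB (f c - f t) (f c - f u); rewrite (_ : f c - f t - _ = f u - f t); last by ring.
by lra.
Qed.

Lemma osc_cvg0 (f : skorohod_space R) :
  (fun n : nat => osc c (n.+1%:R^-1) f) @ \oo --> 0.
Proof.
apply/cvgrPdist_le => e e0; have [r r0 hr] := osc_small f e0.
near=> n.
rewrite sub0r normrN ger0_norm ?osc_ge0 ?invr_gt0//.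
apply: hr; first by rewrite invr_gt0.
rewrite -[r]invrK lef_pV2 ?posrE ?invr_gt0//.
apply: le_trans (_ : n%:R <= _); last by rewrite ler_nat.
near: n; exact: nbhs_infty_ger.
Unshelve. all: by end_near. Qed.

Lemma osc_measurable (delta : R) : 0 < delta ->
  measurable_fun setT (fun f : g_sigma_algebraType (@open (skorohod_space R)) => osc c delta f).
Proof.
move=> d0; apply: (measurability _ (measurable_realfun.RGenOpens.measurableE R)).
move=> _ [_ [a [b ->] <-]]; rewrite setTI.
apply: sub_sigma_algebra.
have /continuousP cf := @osc_J1_continuous R c delta d0.
by apply: cf; exact: interval_open.
Qed.

Lemma osc_bounded (delta : R) : 0 < delta ->
  bounded_fun (fun f : skorohod_space R => osc c delta f).
Proof.
move=> d0; exists 1; split; first exact: num_real.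
move=> M M1 f _; rewrite /= ger0_norm ?osc_ge0//.
by apply: le_trans (osc_le1 _ _ _) (ltW M1).
Qed.

Lemma osc_expectation_cvg0
    (mu : probability (g_sigma_algebraType (@open (skorohod_space R))) R) :
  ('E_mu[fun f : g_sigma_algebraType (@open (skorohod_space R)) => osc c (n.+1%:R^-1) f])%E
    @[n --> \oo] --> (0 : \bar R).
Proof.
rewrite unlock.
have := @dominated_convergence _ _ R mu setT measurableT
  (fun n f => (osc c (n.+1%:R^-1) f)%:E) (cst 0%E) (cst 1%E).
case.
- by move=> n; apply/measurable_EFinP; apply: osc_measurable; rewrite invr_gt0.
- exact: measurable_cst.
- apply: aeW => f _ /=; apply/fine_cvgP; split.
    by apply: nearW.
  exact: osc_cvg0.
- by apply/integrableP; split => //; rewrite integral_cst//= normr1 mul1e probability_setT ltry.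
- apply: aeW => f n _ /=; rewrite lee_fin ger0_norm ?osc_ge0 ?invr_gt0//.
  exact: osc_le1.
by move=> _ _; rewrite integral0.
Qed.

(** The expectation of [osc] with parameter [delta] would pass to the limit law,
    where it tends to 0 with [delta] by dominated convergence, while along the
    sequence it is eventually at least [kappa * pr] whatever [delta]. *)
Lemma not_cvg_in_distribution d (Omega : measurableType d) (P : probability Omega R)
    (Z : nat -> Omega -> skorohod_space R) (kappa pr : R) :
  0 < kappa -> 0 < pr ->
  (forall delta : R, 0 < delta -> exists N0 : nat, forall N, (N0 <= N)%N ->
    exists A, [/\ measurable A, (pr%:E <= P A)%E &
      forall om, A om -> kappa <= osc c delta (Z N om)]) ->
  ~ cvg_in_distribution P Z.
Proof.
move=> k0 p0 H [mu cvgmu].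
have low n : ((kappa * pr)%:E <=
    'E_mu[fun f : g_sigma_algebraType (@open (skorohod_space R)) => osc c (n.+1%:R^-1) f])%E.
  have d0 : 0 < n.+1%:R^-1 :> R by rewrite invr_gt0.
  have cv := cvgmu (fun f => osc c (n.+1%:R^-1) f) (@osc_J1_continuous R c _ d0) (osc_bounded d0).
  have [N0 HN] := H _ d0.
  rewrite -(cvg_lim _ cv)//; apply: lime_ge; first by apply/cvg_ex; eexists; exact: cv.
  exists N0 => // N /= NN; have [A [mA PA Ak]] := HN N NN.
  apply: expectation_ge_cst mA (ltW k0) _ Ak PA => om; exact: osc_ge0.
have cv := osc_expectation_cvg0 mu.
have : ((kappa * pr)%:E <= 0)%E.
  rewrite -(cvg_lim _ cv)//; apply: lime_ge; first by apply/cvg_ex; eexists; exact: cv.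
  by apply: nearW.
by rewrite lee_fin leNgt mulr_gt0.
Qed.
End limit.

(** * Reflection and conclusion *)

Definition flip (s : sign) : sign := if s is Plus then Minus else Plus.

Lemma sgn_flip s : sgn_int (flip s) = - sgn_int s.
Proof. by case: s; rewrite /= ?opprK. Qed.

Lemma ell_opp s x n i : ell s (fun m => - x m) n i = ell (flip s) x n (- i).
Proof.
elim: n => [|n IH]; first by rewrite !ell0.
by rewrite !ellS IH sgn_flip -opprD !eqr_oppLR.
Qed.

Lemma hit_time_opp s x n i : hit_time s (fun m => - x m) n i = hit_time (flip s) x n (- i).
Proof.
pose first_hit (f : nat -> nat) :=
  if pselect (exists m, f m == n) is left h then ex_minn h else 0%N.
rewrite -[LHS]/(first_hit (fun m => ell s (fun m => - x m) m i)).
rewrite -[RHS]/(first_hit (fun m => ell (flip s) x m (- i))).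
by congr first_hit; apply/funext => m; exact: ell_opp.
Qed.

Lemma walk_opp (R : realType) d (Omega : measurableType d) (P : probability Omega R)
    (w : int -> R) (X : nat -> Omega -> int) :
  self_repelling_walk P w X -> self_repelling_walk P w (fun n om => - X n om).
Proof.
move=> [mX X0 XS].
have pre n i : (fun om => - X n om) @^-1` [set i] = X n @^-1` [set - i].
  by apply/seteqP; split => om /= => [<-|->]; rewrite opprK.
split => [n i||n x s]; rewrite pre ?oppr0//.
have hE : history (fun n om => - X n om) x n = history X (fun m => - x m) n.
  by apply/seteqP; split => om h m mn; have := h m mn; [move=> <-|move=> ->]; rewrite opprK.
rewrite hE opprD -sgn_flip (XS n (fun m => - x m) (flip s)); congr (_%:E * _)%E.
rewrite /step_prob !ell_opp !opprK sgn_flip /=.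
set a := (ell Minus x n (x n))%:Z; set b := (ell Plus x n (x n))%:Z.
by rewrite -[b - a]opprB mulrNN opprK; congr (_ / _); exact: addrC.
Qed.

Section osc_lower.
Variables (R : realType) (c delta : R).
Hypothesis delta_gt0 : 0 < delta.

Lemma two_jumpsC (f : R -> R) s t u : two_jumps c delta f s t u = two_jumps c delta f u t s.
Proof.
rewrite /two_jumps [Num.min (tent _ _ s) _]minC; congr (Num.min (Num.min _ _) _).
by rewrite minC distrC [X in Num.min _ X]distrC.
Qed.

Lemma tent_half v : `|v - c| <= delta / 2 -> 1 / 2 <= tent c delta v.
Proof.
move=> vc; rewrite /tent le_max; apply/orP; right.
have : `|v - c| / delta <= 1 / 2 by rewrite ler_pdivrMr//; lra.
by lra.
Qed.

(** The indices may run leftwards because the exploration goes away from the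
    origin, and [two_jumps] is symmetric. *)
Lemma osc_lower (f : R -> R) (kappa s t u : R) :
  (s <= t /\ t <= u) \/ (u <= t /\ t <= s) -> kappa <= 1 / 2 ->
  `|s - c| <= delta / 2 -> `|u - c| <= delta / 2 ->
  kappa <= `|f s - f t| -> kappa <= `|f t - f u| -> kappa <= osc c delta f.
Proof.
move=> ord k2 sc uc st tu.
have J : kappa <= two_jumps c delta f s t u.
  rewrite /two_jumps !le_min [`|f t - f s|]distrC [`|f u - f t|]distrC st tu /=.
  have := tent_half sc; have := tent_half uc => ? ?.
  by apply/and3P; split; lra.
case: ord => -[h1 h2]; first exact: le_trans J (osc_ge _ _ _ h1 h2).
by rewrite two_jumpsC in J; exact: le_trans J (osc_ge _ _ _ h1 h2).
Qed.
End osc_lower.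

Section fluct.
Variables (R : realType) (theta x : R) (io sg : sign).
Hypothesis theta_gt0 : 0 < theta.

(** At the edges of the exploration, in the direction [dir] away from the
    origin, the rescaled process is the gap to the wedge, up to the rounding of
    [N |x|] to [i0]. *)
Lemma fluct_gap (xi : nat -> int) (N i0 j : nat) (dir : int) :
  (0 < N)%N -> `|dir| = 1 -> Num.floor (N%:R * x) = dir * i0%:Z ->
  `|N%:R * `|x| - i0%:R| <= 1 ->
  `|Num.sqrt N%:R * fluct_fun theta x io sg xi N (dir%:~R * (i0 + j)%:R / N%:R) -
    ((ell sg xi (hit_time io xi (Num.truncn (N%:R * theta)) (dir * i0%:Z))
      (dir * (i0%:Z + j%:Z)))%:R - Num.max (N%:R * theta - j%:R / 2) 0)| <= 1 / 2.
Proof.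
move=> N0 d1 fl xi0; set T := hit_time _ _ _ (dir * _).
have n0 : 0 < N%:R :> R by rewrite ltr0n.
have dR : `|dir%:~R| = 1 :> R by rewrite -intr_norm d1.
rewrite /fluct_fun fl -/T.
have -> : N%:R * (dir%:~R * (i0 + j)%:R / N%:R) = (dir * (i0%:Z + j%:Z))%:~R :> R.
  rewrite intrM intrD natrD; field; by rewrite gt_eqF.
rewrite intrKfloor mulrA divff ?gt_eqF ?sqrtr_gt0// (mul1r (_ - _)).
have -> : forall a b y : R, a - b - (a - y) = y - b by move=> *; ring.
rewrite maxr_pMr ?(ltW n0)// mulr0.
apply: le_trans (wedge_lipschitz _ _) _.
have -> : `|dir%:~R * (i0 + j)%:R / N%:R| = (i0%:R + j%:R) / N%:R :> R.
  by rewrite !normrM dR mul1r normfV !normr_nat natrD.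
have -> : N%:R * ((`|x| - (i0%:R + j%:R) / N%:R) / 2 + theta) =
  N%:R * theta - j%:R / 2 + (N%:R * `|x| - i0%:R) / 2 by field; by rewrite gt_eqF.
rewrite opprD addrA subrr sub0r normrN normrM (ger0_norm (x := 2^-1)) ?invr_ge0//.
by lra.
Qed.

(** Stated for two paths, because for negative [x] the crossing is that of the
    reflected path [xi'], whose local times are those of [xi] read in the
    direction [dir]. *)
Lemma gap_crosses_osc (xi : nat -> int) (N i0 : nat) (dir : int) (delta kappa : R)
    (io' sg' : sign) (xi' : nat -> int) :
  (forall m j, ell sg xi m (dir * j) = ell sg' xi' m j) ->
  (forall n j, hit_time io xi n (dir * j) = hit_time io' xi' n j) ->
  (0 < N)%N -> dir = 1 \/ dir = -1 -> Num.floor (N%:R * x) = dir * i0%:Z ->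
  `|N%:R * `|x| - i0%:R| <= 1 -> 0 < delta -> 0 < kappa -> kappa <= 1 ->
  4 / delta <= N%:R -> 2 / kappa <= Num.sqrt N%:R ->
  gap_crosses io' sg' xi' i0 (Num.truncn (N%:R * theta)) (N%:R * theta)
    (delta / 4 * N%:R) (kappa * Num.sqrt N%:R) ->
  kappa / 2 <= osc (dir%:~R * (`|x| + 2 * theta)) delta (fluct_fun theta x io sg xi N).
Proof.
move=> ellE hitE N0 dir1 fl xi0 d0 k0 k1 Nd Nk [j1 [j2 [j3 [l12 l23 w1 w3 [c12 c23]]]]].
have n0 : 0 < N%:R :> R by rewrite ltr0n.
have S0 : 0 < Num.sqrt N%:R :> R by rewrite sqrtr_gt0.
have dN : `|dir| = 1 by case: dir1 => ->.
have G j := @fluct_gap xi N i0 j dir N0 dN fl xi0.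
pose y j : R := dir%:~R * (i0 + j)%:R / N%:R.
pose Y := fluct_fun theta x io sg xi N.
have {}G j : `|Num.sqrt N%:R * Y (y j) -
    level_gap io' sg' xi' i0 (Num.truncn (N%:R * theta)) (N%:R * theta) j| <= 1 / 2.
  by rewrite /level_gap; have := G j; rewrite /= hitE ellE.
have near j : `|j%:R - 2 * (N%:R * theta)| <= delta / 4 * N%:R ->
    `|y j - dir%:~R * (`|x| + 2 * theta)| <= delta / 2.
  move=> jw; have dR : `|dir%:~R| = 1 :> R by rewrite -intr_norm dN.
  have -> : y j - dir%:~R * (`|x| + 2 * theta) =
      dir%:~R * ((j%:R - 2 * (N%:R * theta)) - (N%:R * `|x| - i0%:R)) / N%:R.
    by rewrite /y natrD; field; by rewrite gt_eqF.
  rewrite !normrM dR mul1r normfV (ger0_norm (ltW n0)) ler_pdivrMr//.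
  apply: le_trans (ler_normB _ _) _; apply: le_trans (lerD jw xi0) _.
  by move: Nd; rewrite ler_pdivrMr//; lra.
have jump i j : kappa * Num.sqrt N%:R <=
    `|level_gap io' sg' xi' i0 (Num.truncn (N%:R * theta)) (N%:R * theta) i -
      level_gap io' sg' xi' i0 (Num.truncn (N%:R * theta)) (N%:R * theta) j| ->
    kappa / 2 <= `|Y (y i) - Y (y j)|.
  move: (G i) (G j); set gi := level_gap _ _ _ _ _ _ i; set gj := level_gap _ _ _ _ _ _ j.
  move=> Gi Gj cij; rewrite -(ler_pM2l S0) -[X in X * `|_|](ger0_norm (ltW S0)) -normrM mulrBr.
  set a := Num.sqrt N%:R * Y (y i) in Gi *; set b := Num.sqrt N%:R * Y (y j) in Gj *.
  have := ler_normD (a - b) ((b - gj) - (a - gi)); have := ler_normB (b - gj) (a - gi).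
  rewrite (_ : a - b + _ = gi - gj); last by ring.
  move: Nk; rewrite ler_pdivrMr//.
  by lra.
apply: (@osc_lower R _ delta d0 Y (kappa / 2) (y j1) (y j2) (y j3)).
- have mono i j : (i <= j)%N -> (i0 + i)%:R / N%:R <= (i0 + j)%:R / N%:R :> R.
    by move=> ij; rewrite ler_pM2r ?invr_gt0// ler_nat leq_add2l.
  rewrite /y; case: dir1 => ->; [left|right]; rewrite -!mulrA ?mul1r ?mulN1r ?lerN2.
    by split; exact: mono.
  by split; exact: mono.
- lra.
- exact: near.
- exact: near.
- exact: jump.
- exact: jump.
Qed.
End fluct.

(** The modulus is taken at [dir * (|x| + 2 theta)], where the limiting profile
    of the local times reaches 0. *)
Lemma fluctuation_not_cvg (R : realType) (d : measure_display)
    (Omega : measurableType d) (P : probability Omega R) (w : int -> R) :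
  (forall k : int, 0 < w k) -> {homo w : i j / i <= j} ->
  (exists i j : int, w i <> w j) ->
  forall (X : nat -> Omega -> int), self_repelling_walk P w X ->
  forall (theta x : R) (io sg : sign), 0 < theta ->
  ~ cvg_in_distribution P (fluctuation theta x io sg X).
Proof.
move=> w0 wh wn X Xw theta x io sg T0.
have [kap [pr [kap0 pr0 H]]] := walk_crosses P w0 wh wn T0.
pose kappa := Num.min 1 kap.
have k0 : 0 < kappa by rewrite lt_min ltr01.
have k1 : kappa <= 1 by rewrite ge_min lexx.
have kk : kappa <= kap by rewrite ge_min lexx orbT.
pose dir : int := if 0 <= x then 1 else -1.
apply: (@not_cvg_in_distribution R (dir%:~R * (`|x| + 2 * theta)) d Omega P _ (kappa / 2) pr) => //.
  by rewrite divr_gt0.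
move=> delta d0; have [N1 HN] := H (delta / 4) (divr_gt0 d0 (ltr0n _ 4)).
exists (maxn N1 (maxn (Num.truncn (4 / delta)).+1 (Num.truncn ((2 / kappa) ^+ 2)).+1)) => N.
rewrite !geq_max => /and3P[NN1 N2 N3].
have N0 : (0 < N)%N by rewrite (leq_ltn_trans _ N2).
have up q : (Num.truncn q < N)%N -> q <= N%:R :> R.
  by move=> qN; apply: le_trans (ltW (truncnS_gt q)) _; rewrite ler_nat.
have {N2}Nd := up _ N2; have {N3}Nk := up _ N3.
have {}Nk : 2 / kappa <= Num.sqrt N%:R.
  rewrite -(ler_pXn2r (n := 2)) ?nnegrE ?sqrtr_ge0 ?sqr_sqrtr//.
  by rewrite divr_ge0// ltW.
have weak io' sg' xi' i0 e : gap_crosses io' sg' xi' i0 (Num.truncn (N%:R * theta))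
    (N%:R * theta) e (kap * Num.sqrt N%:R) ->
    gap_crosses io' sg' xi' i0 (Num.truncn (N%:R * theta)) (N%:R * theta)
    e (kappa * Num.sqrt N%:R).
  have kS : kappa * Num.sqrt N%:R <= kap * Num.sqrt N%:R :> R.
    by rewrite ler_wpM2r// sqrtr_ge0.
  move=> [j1 [j2 [j3 [l1 l2 l3 l4 [l5 l6]]]]]; exists j1, j2, j3; split => //.
  by split; [exact: le_trans l5|exact: le_trans l6].
have fl := floor_le (N%:R * x); have flt := floorD1_gt (N%:R * x).
rewrite intrD in flt.
have [x0|x0] := leP 0 x.
  have dE : dir = 1 by rewrite /dir x0.
  have [i0 i0E] : exists i0 : nat, Num.floor (N%:R * x) = i0%:Z.
    have : 0 <= Num.floor (N%:R * x) by rewrite floor_ge0 mulr_ge0.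
    by case: (Num.floor _) => // i0 _; exists i0.
  have [A [mA PA HA]] := HN N i0 io sg X NN1 Xw.
  exists A; split => // om Aom.
  apply: (@gap_crosses_osc R theta x io sg (X ^~ om) N i0 dir delta kappa io sg (X ^~ om)) => //.
  - by move=> m j; rewrite dE mul1r.
  - by move=> n j; rewrite dE mul1r.
  - by left.
  - by rewrite dE mul1r.
  - rewrite i0E in fl flt; rewrite (ger0_norm x0) ler_norml.
    by apply/andP; split; rewrite -[i0%:R]/(i0%:Z%:~R); lra.
  - exact/weak/HA.
have dE : dir = -1 by rewrite /dir leNgt x0.
have [i0 i0E] : exists i0 : nat, Num.floor (N%:R * x) = - i0%:Z.
  have f0 : Num.floor (N%:R * x) <= 0.
    rewrite -ltzD1 add0r -(ltr_int R); apply: le_lt_trans fl _.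
    by apply: lt_trans (_ : 0 < _); rewrite ?pmulr_rlt0 ?ltr0n.
  by move: f0; case: (Num.floor _) => [[|n]|m] // _; [exists 0%N|exists m.+1].
have [A [mA PA HA]] := HN N i0 (flip io) (flip sg) _ NN1 (walk_opp Xw).
exists A; split => // om Aom.
apply: (@gap_crosses_osc R theta x io sg (X ^~ om) N i0 dir delta kappa (flip io) (flip sg)
  (fun m => - X m om)) => //.
- by move=> m j; rewrite dE mulN1r ell_opp; case: (sg).
- by move=> n j; rewrite dE mulN1r hit_time_opp; case: (io).
- by right.
- by rewrite dE mulN1r.
- rewrite i0E mulrNz in fl flt; rewrite (ltr0_norm x0) ler_norml mulrN.
  by apply/andP; split; rewrite -[i0%:R]/(i0%:Z%:~R); lra.
- exact/weak/HA.
Qed.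

Theorem proposition2 (R : realType) (d : measure_display)
    (Omega : measurableType d) (P : probability Omega R)
    (w : int -> R)
    (w_gt0 : forall k : int, 0 < w k)
    (w_nondecreasing : {homo w : i j / i <= j})
    (w_nonconstant : exists i j : int, w i <> w j)
    (X : nat -> Omega -> int) (X_walk : self_repelling_walk P w X)
    (theta x : R) (iota : sign) (theta_gt0 : 0 < theta) :
  ~ cvg_in_distribution P (fluctuation theta x iota Plus X) /\
  ~ cvg_in_distribution P (fluctuation theta x iota Minus X).
Proof. by split; exact: (fluctuation_not_cvg w_gt0). Qed.
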